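(* For every language $L$ in the class $NP$ there exists a finite set of colors $C$ and a finite set $\mathcal{F}'$ of finite $C$-colored graphs whose underlying graphs are connected, such that: (1) $L$ has a polynomial-time reduction to the $\mathcal{F}'$-free coloring problem; and (2) for every graph ${\bf G}$ one can compute, in time polynomial in $|G|$, polynomially many inputs $I_1,\dots,I_k$ of $L$ such that ${\bf G}$ belongs to the language of the $\mathcal{F}'$-free coloring problem if and only if $I_\ell\in L$ for every $1\le \ell\le k$.
   Context: A $C$-colored graph ${\bf G}'$ is a finite undirected graph ${\bf G}$ with a fixed assignment of a color from $C$ to each vertex. For a fixed finite set of colors $C$ and set $\mathcal{F}'$ of $C$-colored graphs, the $\mathcal{F}'$-free coloring problem is: given a finite graph ${\bf G}$, does there exist a $C$-coloring of its vertices such that the resulting colored graph contains no colored subgraph (not necessarily induced) isomorphic, as a colored graph, to some ${\bf F}'\in\mathcal{F}'$? *)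

(* Defs.v *)
From Stdlib Require List.
From mathcomp Require Import all_boot.
Set Implicit Arguments. Unset Strict Implicit. Unset Printing Implicit Defensive.

(* Machine model: deterministic single-tape Turing machines over the   *)
(* tape alphabet {0,1,blank} = option bool, tape unbounded to the right *)
(* (moving left at cell 0 stays at cell 0).                              *)

Record TM := {
  tm_st : finType;
  tm_start : tm_st;
  tm_halt : tm_st -> bool;
  (* next state, symbol written, direction (true = right, false = left) *)
  tm_delta : tm_st -> option bool -> tm_st * option bool * bool
}.

Record config (M : TM) := Config {
  cfg_st : tm_st M;
  cfg_left : seq (option bool);   (* cells left of head, nearest first *)
  cfg_cur : option bool;
  cfg_right : seq (option bool)   (* cells right of head, nearest first *)
}.

Definition tm_step (M : TM) (c : config M) : config M :=
  let: Config q l a r := c in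
  if @tm_halt M q then c else
  let: (q', w, d) := @tm_delta M q a in
  if d then
    match r with
    | [::] => Config q' (w :: l) None [::]
    | b :: r' => Config q' (w :: l) b r'
    end
  else
    match l with
    | [::] => Config q' [::] w r
    | b :: l' => Config q' l' b (w :: r)
    end.

Definition tm_run (M : TM) (t : nat) (c : config M) : config M :=
  iter t (@tm_step M) c.

Definition tm_init (M : TM) (x : seq bool) : config M :=
  match x with
  | [::] => Config (@tm_start M) [::] None [::]
  | b :: x' => Config (@tm_start M) [::] (Some b) [seq Some y | y <- x']
  end.

Fixpoint read_out (s : seq (option bool)) : seq bool :=
  match s with
  | Some b :: s' => b :: read_out s'
  | _ => [::]
  end.

Definition tm_output (M : TM) (c : config M) : seq bool :=
  read_out (cfg_cur c :: cfg_right c).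

Definition polytime (f : seq bool -> seq bool) : Prop :=
  exists (M : TM) (c k : nat), forall x : seq bool,
    exists t, t <= c * (size x).+1 ^ k /\
      @tm_halt M (cfg_st (@tm_run M t (@tm_init M x))) /\
      @tm_output M (@tm_run M t (@tm_init M x)) = f x.

Definition language := seq bool -> Prop.

Definition in_P (L : language) : Prop :=
  exists f, polytime f /\
    forall x, (L x -> f x = [:: true]) /\ (~ L x -> f x = [:: false]).

(* injective encoding of a list of strings as one string:
   each bit b becomes "1 b", each string is terminated by "0 0" *)
Definition enc_list (ss : seq (seq bool)) : seq bool :=
  flatten [seq flatten [seq [:: true; b] | b <- s] ++ [:: false; false] | s <- ss].

Definition in_NP (L : language) : Prop :=
  exists (V : language) (c k : nat), in_P V /\
    forall x, L x <-> exists w : seq bool,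
      size w <= c * (size x).+1 ^ k /\ V (enc_list [:: x; w]).

Definition poly_reduces (L1 L2 : language) : Prop :=
  exists f, polytime f /\ forall x, L1 x <-> L2 (f x).

(* A finite undirected graph with n vertices is encoded as the n*n      *)
(* adjacency matrix in row-major order (symmetric, zero diagonal).      *)

Definition adj_of (s : seq bool) (n : nat) (i j : 'I_n) : bool :=
  nth false s (i * n + j).

Definition encodes_graph (s : seq bool) (n : nat) : Prop :=
  size s = n * n /\
  (forall i j : 'I_n, adj_of s i j = adj_of s j i) /\
  (forall i : 'I_n, adj_of s i i = false).

Definition is_graph (s : seq bool) : Prop := exists n, encodes_graph s n.

Record cgraph (C : finType) := CGraph {
  cg_n : nat;
  cg_edge : rel 'I_cg_n;
  cg_col : 'I_cg_n -> C
}.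

Definition cg_simple (C : finType) (F : cgraph C) : Prop :=
  (forall i j, @cg_edge C F i j = @cg_edge C F j i) /\ (forall i, @cg_edge C F i i = false).

Definition cg_connected (C : finType) (F : cgraph C) : Prop :=
  0 < @cg_n C F /\ forall i j, connect (@cg_edge C F) i j.

(* F is isomorphic, as a colored graph, to a (not necessarily induced)
   colored subgraph of (G, col) *)
Definition cg_embeds (C : finType) (F : cgraph C)
    (n : nat) (e : rel 'I_n) (col : 'I_n -> C) : Prop :=
  exists h : 'I_(@cg_n C F) -> 'I_n,
    injective h /\
    (forall i j, @cg_edge C F i j -> e (h i) (h j)) /\
    (forall i, col (h i) = @cg_col C F i).

Definition free_coloring_lang (C : finType) (Fs : seq (cgraph C)) : language :=
  fun s => exists n, encodes_graph s n /\
    exists col : 'I_n -> C,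
      forall F, List.In F Fs -> ~ cg_embeds F (adj_of s (n:=n)) col.

(* Main.v *)
(* The class of F'-free coloring problems contains every L in NP because local
   conditions on colors can express a space-time diagram of a verifier.

   A pair of adjacent vertices a, b of prescribed degrees (at least 40 + tau and
   36 - tau, pairwise incomparable for different tau) turns a path u a b v into an
   arc of type tau from u to v.  Arcs of type 0 and 1 play the role of "right" and
   "down" in a grid, loops of the other types carry labels: the position class of
   a cell (first, inner, last row and column) and, in the first row, an input bit.
   A color is a window of a computation tableau.  Forbidding badly colored bounded
   configurations forces, on every complete labelled grid of the graph, the tableau
   of a run of the verifier (with guessed witness) and of a clock machine on the
   string read off the first row.  Incomplete grids can be colored by a dummy color,
   and graphs whose arcs or labels are ambiguous have no good coloring at all.  So
   a graph is colorable iff it is unambiguous and each of its finitely many complete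
   grids encodes a member of L and is large enough for the clock.  The clock makes
   "large enough" decidable in polynomial time, hence these strings, with a fixed
   non-member in place of every failed test, are the instances of (2).  The
   reduction (1) writes out the grid of the required size for its input.

   Polynomial-time computability is obtained from a small language of bounded
   loops over stacks that is compiled to Turing machines. *)

Require Import Defs.
From Stdlib Require List.
From mathcomp Require Import all_boot.
From mathcomp Require Import zify.
From mathcomp Require Import boolp.
Set Implicit Arguments. Unset Strict Implicit. Unset Printing Implicit Defensive.

(** * Turing machines executing stack programs *)

Arguments tm_run : simpl never.
Arguments tm_step : simpl never.

(** Forbidden subgraphs need not be induced, so they detect only properties that survive the
    addition of edges and vertices. This is why types of arcs are lower bounds on two degrees, one
    growing and one falling with the type: a gadget with exactly the prescribed degrees then has a
    single type. There are 2 types for the links of a grid and 27 for labels, hence 29. The main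
    obstacle is that an arbitrary graph may contain a complete grid which is too small for an
    accepting run on a member of [L]. Colorability would then depend on the dimensions of the grid
    in a way that membership queries to [L] cannot express. The clock is a deterministic machine,
    run in the same grid, that prints a string at least as long as the space and time the verifier
    needs. A grid that holds its run is therefore large enough for every admissible witness, and
    whether it does is found out by plain simulation. A second obstacle is that a local condition at
    one corner cannot know whether the opposite corner exists. Colors answer this in two passes:
    being forced spreads from the start corner over filled rectangles, and a forced last corner
    sends the obligation to compute back. *)

Definition store := nat -> seq bool.
Definition upd (s : store) i l : store := fun j => if j == i then l else s j.

Inductive instr := IPush of nat & bool | IPop of nat | IBr of nat & nat & nat & nat.

Definition ireg c := match c with IPush i _ | IPop i | IBr i _ _ _ => i end.

Definition ibr3 (h : option bool) (e f t : nat) :=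
  match h with None => e | Some false => f | Some true => t end.

Definition istep1 (c : instr) (pc : nat) (s : store) : nat * store :=
  match c with
  | IPush i b => (pc.+1, upd s i (b :: s i))
  | IPop i => (pc.+1, upd s i (behead (s i)))
  | IBr i e f t => (ibr3 (ohead (s i)) e f t, s)
  end.

Section StackMachine.
Variables (code : seq instr) (k : nat).
Let P := size code.

(** Program counter, phase, separator counter and one carried symbol. The transition table [dl]
    works with plain numbers, and the counter has room above the [k.+1] separators so that [inord]
    preserves it. *)
Definition smst : finType := ('I_P.+1 * 'I_7 * 'I_k.+3 * option bool)%type.
Definition mk (pc ph c : nat) (h : option bool) : smst := (inord pc, inord ph, inord c, h).

(* Phases: 0 seek stack i, 1 at its top, 2 insert (write held symbol, hold the
   old one), 3 run to the right end before a deletion, 5 delete while moving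
   left, 4 return to cell 0, 6 halted.  The counter c counts the separators
   passed when moving right, and those at or left of the head when moving left. *)
Definition dl (pc ph c : nat) (h a : option bool) :
    (nat * nat * nat * option bool) * option bool * bool :=
  let ins := nth (IPop 0) code pc in
  let i := ireg ins in
  match ph with
  | 0 => if pc == P then ((pc, 6, 0, None), a, true) else
         let c' := c + (a == None) in
         ((pc, if (a == None) && (c' == i.+1) then 1 else 0, c', None), a, true)
  | 1 => match ins with
         | IPush _ b => ((pc, 2, c, a), Some b, true)
         | IPop _ => if a == None then ((pc, 4, c, None), a, false)
                     else ((pc, 3, c, None), a, true)
         | IBr _ _ _ _ => ((pc, 4, c, a), a, false)
         end
  | 2 => let c' := c + (h == None) in
         if (h == None) && (c' == k.+1) then ((pc, 4, k, None), None, false)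
         else ((pc, 2, c', a), h, true)
  | 3 => let c' := c + (a == None) in
         if (a == None) && (c' == k.+1) then ((pc, 5, k, None), None, false)
         else ((pc, 3, c', None), a, true)
  | 4 => if (a == None) && (c == 1) then
           ((match ins with IBr _ e f t => ibr3 h e f t | _ => pc.+1 end, 0, 0, None),
            None, false)
         else ((pc, 4, c - (a == None), h), a, false)
  | 5 => if (a == None) && (c == i.+1) then ((pc, 4, maxn i 1, None), a, false)
         else ((pc, 5, c - (a == None), a), h, false)
  | _ => ((pc, ph, c, h), a, true)
  end.

Definition SM : TM := {|
  tm_st := smst;
  tm_start := mk 0 2 0 None;
  tm_halt := fun st : smst => let: (_, ph, _, _) := st in val ph == 6;
  tm_delta := fun (st : smst) a =>
    let: (pc, ph, c, h) := st in
    let: ((pc', ph', c', h'), w, d) := dl (val pc) (val ph) (val c) h a in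
    (mk pc' ph' c' h', w, d) |}.

Arguments mk : simpl never.

(** [conf] puts the head on the first cell of [v], [confl] on the last cell of [x]: the first form
    suits sweeps to the right, the second sweeps to the left. *)
Definition conf (st : smst) u v : config SM :=
  match v with
  | [::] => @Config SM st (rev u) None [::]
  | a :: r => @Config SM st (rev u) a r
  end.
Definition confl (st : smst) x v : config SM :=
  match rev x with
  | [::] => @Config SM st [::] None v
  | a :: l => @Config SM st l a v
  end.

Arguments conf : simpl never.
Arguments confl : simpl never.

Lemma conf_confl st u a v : conf st u (a :: v) = confl st (rcons u a) v.
Proof. by rewrite /confl rev_rcons. Qed.

Lemma conf_nil st u : conf st u [::] = conf st u [:: None].
Proof. by []. Qed.

Lemma delta_mk pc ph c h a pc' ph' c' h' w d :
  pc <= P -> ph < 7 -> c < k.+3 ->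
  dl pc ph c h a = ((pc', ph', c', h'), w, d) ->
  @tm_delta SM (mk pc ph c h) a = (mk pc' ph' c' h', w, d).
Proof. by move=> h1 h2 h3 /= e; rewrite !inordK // e. Qed.

Lemma halt_mk pc ph c h : ph < 7 -> @tm_halt SM (mk pc ph c h) = (ph == 6).
Proof. by move=> hp /=; rewrite inordK. Qed.

Lemma step_right pc ph c h a pc' ph' c' h' w u v :
  pc <= P -> ph < 6 -> c < k.+3 ->
  dl pc ph c h a = ((pc', ph', c', h'), w, true) ->
  tm_step (conf (mk pc ph c h) u (a :: v)) = conf (mk pc' ph' c' h') (rcons u w) v.
Proof.
move=> h1 h2 h3 e; have hp : ph < 7 by lia.
rewrite /tm_step /conf (halt_mk _ _ _ hp) (delta_mk h1 hp h3 e) ltn_eqF //.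
by case: v => [|b v]; rewrite rev_rcons.
Qed.

Lemma step_left pc ph c h a pc' ph' c' h' w x v :
  x != [::] -> pc <= P -> ph < 6 -> c < k.+3 ->
  dl pc ph c h a = ((pc', ph', c', h'), w, false) ->
  tm_step (confl (mk pc ph c h) (rcons x a) v) = confl (mk pc' ph' c' h') x (w :: v).
Proof.
move=> hx h1 h2 h3 e; have hp : ph < 7 by lia.
rewrite /tm_step /confl rev_rcons (halt_mk _ _ _ hp) (delta_mk h1 hp h3 e) ltn_eqF //.
by case/lastP: x hx => // x b _; rewrite rev_rcons.
Qed.

Lemma step_left0 pc ph c h a pc' ph' c' h' w v :
  pc <= P -> ph < 6 -> c < k.+3 ->
  dl pc ph c h a = ((pc', ph', c', h'), w, false) ->
  tm_step (confl (mk pc ph c h) [:: a] v) = conf (mk pc' ph' c' h') [::] (w :: v).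
Proof.
move=> h1 h2 h3 e; have hp : ph < 7 by lia.
rewrite /confl (_ : rev [:: a] = [:: a]) // /tm_step.
by rewrite (halt_mk _ _ _ hp) (delta_mk h1 hp h3 e) ltn_eqF.
Qed.

Definition nones (w : seq (option bool)) := count_mem None w.

Lemma run_add t1 t2 (c : config SM) : tm_run (t1 + t2) c = tm_run t2 (tm_run t1 c).
Proof. by rewrite /tm_run addnC iterD. Qed.

Lemma run1 (c : config SM) : tm_run 1 c = tm_step c. Proof. by []. Qed.

(** The bound on the separators in [w] keeps the counter below the value at which the phase changes.
    The other sweeps rest on the same observation. *)
Lemma sweep_right pc ph w : forall c u v,
  pc < P -> (ph = 0 /\ c + nones w < (ireg (nth (IPop 0) code pc)).+1 <= k.+1) \/
            (ph = 3 /\ c + nones w < k.+1) ->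
  tm_run (size w) (conf (mk pc ph c None) u (w ++ v)) =
  conf (mk pc ph (c + nones w) None) (u ++ w) v.
Proof.
elim: w => [|a w IH] c u v hpc H; first by rewrite /nones /= addn0 cats0.
rewrite /= -(add1n (size w)) run_add run1 (@step_right _ _ _ _ _ pc ph (c + (a == None)) None a).
- rewrite IH //; last by move: H; rewrite /nones /= addnA.
  by rewrite /nones /= addnA cat_rcons.
- exact: ltnW.
- by case: H => [[-> _]|[-> _]].
- by move: H; rewrite /nones /=; lia.
- move: H; rewrite /nones /= => -[[-> H]|[-> H]] /=.
  + rewrite (_ : (pc == P) = false); last by lia.
    case: a H => [b|] //= H; rewrite ifF //; lia.
  + case: a H => [b|] //= H; rewrite ifF //; lia.
Qed.

(** Insertion is a shift by one cell: the held symbol is written and the old one is held, whence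
    [belast] and [last]. *)
Lemma sweep_carry pc w : forall c h u v,
  pc <= P -> c + nones (belast h w) < k.+1 ->
  tm_run (size w) (conf (mk pc 2 c h) u (w ++ v)) =
  conf (mk pc 2 (c + nones (belast h w)) (last h w)) (u ++ belast h w) v.
Proof.
elim: w => [|a w IH] c h u v hpc H; first by rewrite /nones /= addn0 cats0.
rewrite /= -(add1n (size w)) run_add run1 (@step_right _ _ _ _ _ pc 2 (c + (h == None)) a h) //.
- rewrite IH //; last by move: H; rewrite /nones /= addnA.
  by rewrite /nones /= addnA cat_rcons.
- by move: H; rewrite /nones /=; lia.
- move: H; rewrite /nones /= => H; case: h H => [b|] //= H; rewrite ifF //; lia.
Qed.

Lemma sweep_return pc h w : forall c x v,
  pc <= P -> x != [::] -> nones w < c -> c < k.+3 ->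
  tm_run (size w) (confl (mk pc 4 c h) (x ++ w) v) =
  confl (mk pc 4 (c - nones w) h) x (w ++ v).
Proof.
elim/last_ind: w => [|w a IH] c x v hpc hx H hc.
  by rewrite /nones /= subn0 cats0.
rewrite size_rcons -(add1n (size w)) run_add run1 -rcons_cat.
have hn : nones (rcons w a) = nones w + (a == None).
  by rewrite /nones -cats1 count_cat /= addn0.
rewrite (@step_left _ _ _ _ _ pc 4 (c - (a == None)) h a) //; first 1 last.
- by case: x hx.
- by move: H; rewrite hn; case: (a) => [b|] //= H; rewrite ifF //; lia.
rewrite IH //; try by rewrite hn in H; lia.
by rewrite hn -cats1 -catA /= -subnDA [nones w + _]addnC.
Qed.

(** Deletion runs to the left, so each cell can receive the held old content of its right neighbour
    without lookahead. *)
Lemma sweep_shift pc w : forall c h x v,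
  pc <= P -> x != [::] -> (ireg (nth (IPop 0) code pc)).+1 + nones w <= c -> c < k.+3 ->
  tm_run (size w) (confl (mk pc 5 c h) (x ++ w) v) =
  confl (mk pc 5 (c - nones w) (head h w)) x (behead (rcons w h) ++ v).
Proof.
elim/last_ind: w => [|w a IH] c h x v hpc hx H hc.
  by rewrite /nones /= subn0 cats0.
rewrite size_rcons -(add1n (size w)) run_add run1 -rcons_cat.
have hn : nones (rcons w a) = nones w + (a == None).
  by rewrite /nones -cats1 count_cat /= addn0.
rewrite (@step_left _ _ _ _ _ pc 5 (c - (a == None)) a h) //; first 1 last.
- by case: x hx.
- by move: H; rewrite hn; case: (a) => [b|] //= H; rewrite ifF //; lia.
rewrite IH //; try by rewrite hn in H; lia.
rewrite hn -subnDA [nones w + _]addnC; congr confl; first by case: (w).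
by case: (w) => [|b w'] //=; rewrite -!cats1 -!catA.
Qed.

(** Each stack is preceded by a blank, with its top next to it. Blanks thus serve both as separators
    and as unwritten tape, which is why they have to be counted. *)
Definition blk (l : seq (seq bool)) : seq (option bool) :=
  flatten [seq None :: map Some s | s <- l].

Lemma nones_some (s : seq bool) : nones (map Some s) = 0.
Proof. by elim: s. Qed.
Lemma nones_cat u v : nones (u ++ v) = nones u + nones v.
Proof. exact: count_cat. Qed.
Lemma nones_blk l : nones (blk l) = size l.
Proof.
elim: l => // s l IH.
by rewrite -[blk (s :: l)]/(([:: None] ++ map Some s) ++ blk l) !nones_cat IH nones_some.
Qed.
Lemma blk_cat l1 l2 : blk (l1 ++ l2) = blk l1 ++ blk l2.
Proof. by rewrite /blk map_cat flatten_cat. Qed.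
Lemma blk_cons s l : blk (s :: l) = None :: map Some s ++ blk l.
Proof. by []. Qed.

Lemma blk_mid l1 s l2 v :
  blk (l1 ++ s :: l2) ++ v = blk (rcons l1 [::]) ++ map Some s ++ blk l2 ++ v.
Proof.
by rewrite -cats1 !blk_cat (_ : blk (s :: l2) = [:: None] ++ (map Some s ++ blk l2)) // -!catA.
Qed.

(* Extra blanks may accumulate after the last separator. *)
Definition confS pc l j := conf (mk pc 0 0 None) [::] (blk l ++ None :: nseq j None).

Definition len l := size (blk l).

Lemma len_mid l1 s l2 :
  size (blk (l1 ++ s :: l2)) = size (blk l1) + (size s).+1 + size (blk l2).
Proof. by rewrite blk_cat blk_cons size_cat /= size_cat size_map; lia. Qed.

Lemma seek_top pc l1 s l2 j : pc < P -> size l1 = ireg (nth (IPop 0) code pc) ->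
  size (l1 ++ s :: l2) = k ->
  tm_run (size (blk l1)).+1 (confS pc (l1 ++ s :: l2) j) =
  conf (mk pc 1 (size l1).+1 None) (rcons (blk l1) None)
       (map Some s ++ blk l2 ++ None :: nseq j None).
Proof.
move=> hpc h1; rewrite size_cat /= => hk.
rewrite /confS blk_cat blk_cons -catA -addn1 run_add sweep_right //; last first.
  by left; split => //; rewrite nones_blk -h1; lia.
rewrite nones_blk add0n run1.
rewrite (@step_right _ _ _ _ _ pc 1 (size l1).+1 None None) //.
- by rewrite -[LHS]/(conf _ _ ((map Some s ++ blk l2) ++ None :: nseq j None)) -catA.
- exact: ltnW.
- by lia.
- by rewrite /= (_ : (pc == P) = false) ?addn1 ?h1 ?eqxx //; lia.
Qed.

(** Among the separators only the one in cell 0 meets the counter 1; there the left move is blocked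
    and the next instruction begins. *)
Lemma return0 pc h l v c : pc < P -> l != [::] -> size l = c -> c < k.+3 ->
  tm_run (size (blk l)) (confl (mk pc 4 c h) (blk l) v) =
  conf (mk (match nth (IPop 0) code pc with IBr _ e f t => ibr3 h e f t | _ => pc.+1 end) 0 0 None)
       [::] (blk l ++ v).
Proof.
case: l => // s l hpc _ hl hc.
have -> : blk (s :: l) = [:: None] ++ (map Some s ++ blk l) by [].
rewrite size_cat addnC run_add sweep_return //; last first.
- by move: hl; rewrite nones_cat nones_some nones_blk /=; lia.
- exact: ltnW.
rewrite run1 nones_cat nones_some nones_blk /=.
rewrite (_ : c - (0 + size l) = 1); last by move: hl => /=; lia.
rewrite (@step_left0 _ _ _ _ _ (match nth (IPop 0) code pc with IBr _ e f t => ibr3 h e f t | _ => pc.+1 end) 0 0 None None) //.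
exact: ltnW.
Qed.

Lemma conf_nseq st u j : conf st u (nseq j None) = conf st u (None :: nseq j.-1 None).
Proof. by case: j. Qed.

Lemma carry_word pc c X u v : pc <= P -> c + nones X < k.+1 ->
  tm_run (size X) (conf (mk pc 2 c (head None X)) u (behead (rcons X None) ++ v)) =
  conf (mk pc 2 (c + nones X) None) (u ++ X) v.
Proof.
case: X => [|x X] hpc hc; first by rewrite /nones /= addn0 cats0.
have := @sweep_carry pc (rcons X None) c x u v hpc.
by rewrite size_rcons belast_rcons last_rcons => ->.
Qed.

Lemma carry_end pc l j u : pc < P -> l != [::] -> size l = k -> blk l = u ->
  tm_run (size u).+1 (conf (mk pc 2 k None) u (nseq j None)) =
  confS (match nth (IPop 0) code pc with IBr _ e f t => ibr3 None e f t | _ => pc.+1 end)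
    l j.-1.
Proof.
move=> hpc hl hk <-; rewrite -add1n run_add run1 conf_nseq conf_confl.
rewrite (@step_left _ _ _ _ _ pc 4 k None None) //.
- by rewrite return0 //; lia.
- by case: (l) hl => // s l' _; rewrite blk_cons.
- exact: ltnW.
- by lia.
- by rewrite /= addn1 eqxx.
Qed.

Lemma run_push pc i b l1 s l2 j : pc < P -> nth (IPop 0) code pc = IPush i b ->
  size l1 = i -> size (l1 ++ s :: l2) = k ->
  exists t j', t <= 2 * len (l1 ++ s :: l2) + 6 /\
    tm_run t (confS pc (l1 ++ s :: l2) j) = confS pc.+1 (l1 ++ (b :: s) :: l2) j'.
Proof.
move=> hpc hi h1 hk.
set X := map Some s ++ blk l2.
(* If [X] is empty, the head meets the final separator, which is again [head None X]. *)
have e2 : map Some s ++ blk l2 ++ None :: nseq j None =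
    head None X :: (behead (rcons X None) ++ nseq j None).
  by rewrite catA -/X; case: X => //= x X; rewrite cat_rcons.
have e3 : blk (l1 ++ (b :: s) :: l2) = rcons (rcons (blk l1) None) (Some b) ++ X.
  by rewrite blk_cat blk_cons -!cats1 -!catA.
have hn : nones X = size l2 by rewrite nones_cat nones_some nones_blk.
have hk' : size l1 + (size l2).+1 = k by move: hk; rewrite size_cat.
exists ((size (blk l1)).+1 + (1 + (size X + (size (blk (l1 ++ (b :: s) :: l2))).+1))), j.-1; split.
  by rewrite /len /X !len_mid size_cat size_map /=; lia.
rewrite !run_add seek_top // ?hi // e2 run1.
rewrite (@step_right _ _ _ _ _ pc 2 (size l1).+1 (head None X) (Some b)) //; last first.
- by rewrite /= hi.
- lia.
- exact: ltnW.
rewrite carry_word; [|exact: ltnW|lia].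
rewrite (_ : (size l1).+1 + nones X = k); last by lia.
rewrite e3 (@carry_end pc (l1 ++ (b :: s) :: l2)) ?hi //.
- by case: (l1).
- by move: hk; rewrite !size_cat.
Qed.

Lemma run_br pc i e f t l1 s l2 j : pc < P -> nth (IPop 0) code pc = IBr i e f t ->
  size l1 = i -> size (l1 ++ s :: l2) = k ->
  exists n j', n <= 2 * len (l1 ++ s :: l2) + 6 /\
    tm_run n (confS pc (l1 ++ s :: l2) j) = confS (ibr3 (ohead s) e f t) (l1 ++ s :: l2) j'.
Proof.
move=> hpc hi h1 hk.
have hk' : size l1 + (size l2).+1 = k by move: hk; rewrite size_cat.
exists ((size (blk l1)).+1 + (1 + size (blk (rcons l1 [::])))), j; split.
  by rewrite /len -cats1 !len_mid /=; lia.
rewrite !run_add seek_top // ?hi //.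
(* On an empty stack the head stands on the next separator, whose symbol [None] is [ohead s];
   emptiness needs no separate test. *)
have [v ev] : exists v, map Some s ++ blk l2 ++ None :: nseq j None = ohead s :: v.
  by case: s {hk} => [|a s]; [case: (l2) => [|y l]; eexists|eexists].
rewrite ev conf_confl run1 (@step_left _ _ _ _ _ pc 4 (size l1).+1 (ohead s) (ohead s)) //.
- have -> : rcons (blk l1) None = blk (rcons l1 [::]) by rewrite -!cats1 blk_cat.
  rewrite return0 ?size_rcons //; last 2 first.
  + by case: (l1).
  + by lia.
  by rewrite hi /confS -ev blk_mid.
- by case: (blk l1).
- exact: ltnW.
- by lia.
- by rewrite /= hi.
Qed.

Lemma run_pop pc i l1 s l2 j : pc < P -> nth (IPop 0) code pc = IPop i ->
  size l1 = i -> size (l1 ++ s :: l2) = k ->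
  exists t j', t <= 2 * len (l1 ++ s :: l2) + 6 /\
    tm_run t (confS pc (l1 ++ s :: l2) j) = confS pc.+1 (l1 ++ behead s :: l2) j'.
Proof.
move=> hpc hi h1 hk.
have hk' : size l1 + (size l2).+1 = k by move: hk; rewrite size_cat.
have hpc' := ltnW hpc.
have hx : rcons (blk l1) None != [::] by case: (blk l1).
case: s hk => [|a s] hk.
  exists ((size (blk l1)).+1 + (1 + size (blk (rcons l1 [::])))), j; split.
    by rewrite /len -cats1 !len_mid /=; lia.
  rewrite !run_add seek_top // ?hi //.
  have [v ev] : exists v, map Some [::] ++ blk l2 ++ None :: nseq j None = None :: v.
    by case: (l2) => [|y l]; eexists.
  rewrite ev conf_confl run1 (@step_left _ _ _ _ _ pc 4 (size l1).+1 None None) //.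
  - have -> : rcons (blk l1) None = blk (rcons l1 [::]) by rewrite -!cats1 blk_cat.
    rewrite return0 ?size_rcons //; last 2 first.
    + by case: (l1).
    + by lia.
    by rewrite hi /confS -ev blk_mid.
  - by lia.
  - by rewrite /= hi.
set Y := map Some s ++ blk l2.
have hn : nones Y = size l2 by rewrite nones_cat nones_some nones_blk.
(* Closing the gap leaves one more blank behind the last separator, hence [j.+1]. *)
have e1 : confS pc.+1 (l1 ++ s :: l2) j.+1 =
    conf (mk pc.+1 0 0 None) [::] (rcons (blk l1) None ++ rcons Y None ++ None :: nseq j None).
  by rewrite /confS blk_mid -!cats1 blk_cat -!catA.
exists ((size (blk l1)).+1 + (1 + (size Y + (1 + (size (Some a :: Y) + (1 + maxn (size (blk l1)) 1)))))), j.+1.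
split.
  by rewrite /len /Y len_mid /= size_cat size_map; lia.
rewrite !run_add seek_top // ?hi // !run1.
rewrite (_ : map Some (a :: s) ++ _ = Some a :: (Y ++ None :: nseq j None)); last by rewrite /Y -catA.
rewrite (@step_right _ _ _ _ _ pc 3 (size l1).+1 None (Some a)) //; last 2 first.
- lia.
- by rewrite /= hi.
rewrite sweep_right //; last by right; split => //; lia.
rewrite (_ : (size l1).+1 + nones Y = k); last by lia.
rewrite conf_confl (@step_left _ _ _ _ _ pc 5 k None None) //; last 3 first.
- by case: (blk l1).
- lia.
- by rewrite /= addn1 eqxx.
rewrite cat_rcons (@sweep_shift pc (Some a :: Y)) //; last 2 first.
- by rewrite hi /= -h1 /nones /= -/(nones Y); lia.
- lia.
rewrite (_ : k - _ = (size l1).+1); last by rewrite /nones /= -/(nones Y); lia.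
rewrite [head _ _]/= [behead _]/= e1.
(* The separator of stack 0 is cell 0, where a left move stays put; this is what [maxn i 1] in phase
   5 accounts for. *)
have [l10|l1n] := eqVneq l1 [::].
  rewrite l10 [blk _]/= [maxn _ _]/= run1.
  rewrite (@step_left0 _ _ _ _ _ pc 4 1 None None) //; last first.
  - by rewrite /= hi -h1 l10.
  rewrite conf_confl (@step_left0 _ _ _ _ _ pc.+1 0 0 None None) //.
  by rewrite /= hi.
rewrite (@step_left _ _ _ _ _ pc 4 (size l1) None None) //; last 3 first.
- by case: (l1) l1n => // y l _; rewrite blk_cons.
- by lia.
- rewrite /= hi /= h1 eqxx; congr (_, _, _, _, _, _).
  by rewrite -h1; move: l1n; case: (l1) => // ? ? _ /=; lia.
rewrite (maxn_idPl _); last by case: (l1) l1n => // y l _; rewrite blk_cons.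
rewrite return0 //; last by lia.
by rewrite hi (cat_rcons _ (blk l1)).
Qed.

(** The right part of the configuration stays empty here: the machine runs over unwritten cells and
    turns them into separators of empty stacks. *)
Lemma carry_blank m : forall c h u, 0 < P -> c + nones (belast h (nseq m None)) < k.+1 ->
  tm_run m (conf (mk 0 2 c h) u [::]) =
  conf (mk 0 2 (c + nones (belast h (nseq m None))) (last h (nseq m None)))
     (u ++ belast h (nseq m None)) [::].
Proof.
elim: m => [|m IH] c h u hpc H; first by rewrite /nones /= addn0 cats0.
rewrite /= -(add1n m) run_add run1 conf_nil.
rewrite (@step_right _ _ _ _ _ 0 2 (c + (h == None)) None h) //.
- rewrite IH //; last by move: H; rewrite /nones /= addnA.
  by rewrite /nones /= addnA cat_rcons.
- by move: H; rewrite /nones /=; lia.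
- move: H; rewrite /nones /= => H; case: h H => [b|] //= H; rewrite ifF //; lia.
Qed.

(* The dummy instruction 0 is entered in its insertion phase: this inserts the
   separator in front of the input and creates the empty stacks. *)
Lemma run_init x i b : 0 < P -> nth (IPop 0) code 0 = IPush i b -> 0 < k ->
  exists t, t <= 2 * (size x + k) + 6 /\
    tm_run t (tm_init SM x) = confS 1 (x :: nseq k.-1 [::]) 0.
Proof.
move=> hP h0 hk.
have eX : belast None (map Some x ++ nseq k None) = blk (x :: nseq k.-1 [::]).
  have eb n : blk (nseq n [::]) = nseq n None by elim: n => // n IH; rewrite /= blk_cons IH.
  rewrite blk_cons eb -[nseq k None]/(nseq k None) -{1}(prednK hk).
  by rewrite -addn1 nseqD catA cats1 belast_rcons.
have eL : last None (map Some x ++ nseq k None) = None.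
  by rewrite -{1}(prednK hk) -addn1 nseqD catA cats1 last_rcons.
have hn : nones (belast None (map Some x ++ nseq k None)) = k.
  by rewrite eX nones_blk /= size_nseq prednK.
have e0 : tm_init SM x = conf (mk 0 2 0 None) [::] (map Some x) by case: (x).
have hs : size (blk (x :: nseq k.-1 [::])) = size x + k.
  by rewrite -eX size_belast size_cat size_map size_nseq.
exists (size (map Some x) + (k + (size (blk (x :: nseq k.-1 [::]))).+1)); split.
  by rewrite hs size_map; lia.
rewrite e0 -[map Some x]cats0 !run_add cats0 -[in conf _ _ (map _ _)](cats0 (map Some x)).
move: hn; rewrite belast_cat nones_cat => hn.
rewrite sweep_carry //; last by lia.
rewrite carry_blank //; last by lia.
rewrite cat0s -last_cat eL add0n hn -belast_cat eX.
by rewrite (@carry_end 0 (x :: nseq k.-1 [::]) 0) ?h0 //= size_nseq prednK.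
Qed.

(** One step to the right of cell 0 puts the head on the top of stack 0, and the output convention
    reads up to the next blank, that is, this stack. *)
Lemma run_halt s l j : exists c, tm_run 1 (confS P (s :: l) j) = c /\
  tm_halt (cfg_st c) /\ tm_output c = s.
Proof.
exists (conf (mk P 6 0 None) [:: None] (map Some s ++ blk l ++ None :: nseq j None)); split.
  rewrite /confS blk_cons run1 (@step_right _ _ _ _ _ P 6 0 None None) ?catA //.
  by rewrite /= eqxx.
split.
  rewrite (_ : @cfg_st SM _ = mk P 6 0 None :> tm_st SM) ?halt_mk //.
  by case: (s) => //; case: (l).
have -> : forall st u v, @tm_output SM (conf st u v) = read_out v by move=> st u [|? ?].
elim: s => [|a s IH] /=; first by case: (l).
by rewrite IH.
Qed.
End StackMachine.

(** * Polynomial bounds and structured stack programs *)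

Definition isp (q : nat -> nat) :=
  {homo q : m m' / m <= m'} /\ exists c k, forall m, q m <= c * m.+1 ^ k.

Lemma isp_const c : isp (fun=> c).
Proof. by split => //; exists c, 0 => m; rewrite expn0 muln1. Qed.
Lemma isp_id : isp id.
Proof. by split => //; exists 1, 1 => m; rewrite expn1 mul1n. Qed.
Lemma isp_add p q : isp p -> isp q -> isp (fun m => p m + q m).
Proof.
move=> [hp [c [k hc]]] [hq [c' [k' hc']]]; split.
  by move=> m m' h; rewrite leq_add ?hp ?hq.
exists (c + c'), (k + k') => m; rewrite mulnDl leq_add //.
  by rewrite (leq_trans (hc m)) // leq_mul2l leq_pexp2l ?orbT // leq_addr.
by rewrite (leq_trans (hc' m)) // leq_mul2l leq_pexp2l ?orbT // leq_addl.
Qed.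
Lemma isp_mul p q : isp p -> isp q -> isp (fun m => p m * q m).
Proof.
move=> [hp [c [k hc]]] [hq [c' [k' hc']]]; split.
  by move=> m m' h; rewrite leq_mul ?hp ?hq.
exists (c * c'), (k + k') => m; rewrite expnD mulnACA; exact: leq_mul.
Qed.

Lemma leq_expl m n k : m <= n -> m ^ k <= n ^ k.
Proof. by case: k => // k h; rewrite leq_exp2r. Qed.

Lemma isp_comp p q : isp p -> isp q -> isp (fun m => p (q m)).
Proof.
move=> [hp [c [k hc]]] [hq [c' [k' hc']]]; split.
  by move=> m m' h; rewrite hp ?hq.
exists (c * c'.+1 ^ k), (k' * k) => m; apply: (leq_trans (hc _)).
rewrite -mulnA leq_mul2l expnM -expnMn leq_expl ?orbT //.
rewrite mulSn -addn1 addnC leq_add ?hc' //.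
by rewrite expn_gt0.
Qed.
Lemma isp_exp p k : isp p -> isp (fun m => p m ^ k).
Proof.
move=> hp; elim: k => [|k IH]; first exact: isp_const.
by under eq_fun do rewrite expnS; apply: isp_mul.
Qed.

Inductive com :=
  | Nop | Push of nat & bool | Pop of nat | Seq of com & com
  | If of nat & com & com     (* top of the stack is true: second branch *)
  | Each of nat & com & com.  (* pop until empty, branching on the popped bit *)

(** The times bound the number of compiled instructions: a test and a jump for [If]; a test, a pop
    and a jump for every round of [Each]. *)
Inductive run : com -> store -> store -> nat -> Prop :=
  | RNop s : run Nop s s 0
  | RPush s i b : run (Push i b) s (upd s i (b :: s i)) 1
  | RPop s i : run (Pop i) s (upd s i (behead (s i))) 1
  | RSeq c1 c2 s s1 s2 t1 t2 : run c1 s s1 t1 -> run c2 s1 s2 t2 ->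
      run (Seq c1 c2) s s2 (t1 + t2)
  | RIf i c0 c1 s s' t : run (if head false (s i) then c1 else c0) s s' t ->
      run (If i c0 c1) s s' (t + 2)
  | REach0 i c0 c1 s : s i = [::] -> run (Each i c0 c1) s s 1
  | REach1 i c0 c1 s s1 s2 b l t1 t2 : s i = b :: l ->
      run (if b then c1 else c0) (upd s i l) s1 t1 ->
      run (Each i c0 c1) s1 s2 t2 -> run (Each i c0 c1) s s2 (t1 + t2 + 3).

Definition jmp l := IBr 0 l l l.

Fixpoint csize c := match c with
  | Nop => 0 | Push _ _ | Pop _ => 1 | Seq c1 c2 => csize c1 + csize c2
  | If _ c0 c1 => csize c0 + csize c1 + 2
  | Each _ c0 c1 => csize c0 + csize c1 + 5 end.

Fixpoint comp c o : seq instr := match c with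
  | Nop => [::] | Push i b => [:: IPush i b] | Pop i => [:: IPop i]
  | Seq c1 c2 => comp c1 o ++ comp c2 (o + csize c1)
  | If i c0 c1 =>
      IBr i o.+1 o.+1 (o.+2 + csize c0) :: comp c0 o.+1 ++
      jmp (o + csize c0 + csize c1 + 2) :: comp c1 (o.+2 + csize c0)
  | Each i c0 c1 =>
      [:: IBr i (o + csize c0 + csize c1 + 5) o.+1 (o.+3 + csize c0), IPop i & comp c0 o.+2] ++
      [:: jmp o, IPop i & comp c1 (o.+4 + csize c0)] ++ [:: jmp o]
  end.

Lemma size_comp c o : size (comp c o) = csize c.
Proof.
elim: c o => //= [c1 I1 c2 I2|i c0 I0 c1 I1|i c0 I0 c1 I1] o.
- by rewrite size_cat I1 I2.
- by rewrite size_cat /= I0 I1; lia.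
- by rewrite !size_cat /= size_cat /= I0 I1; lia.
Qed.

Definition istep code (p : nat * store) : nat * store :=
  if p.1 < size code then istep1 (nth (IPop 0) code p.1) p.1 p.2 else p.

Lemma istep_at code pre ins post s : code = pre ++ ins :: post ->
  istep code (size pre, s) = istep1 ins (size pre) s.
Proof.
move=> ->; rewrite /istep size_cat /= addnS ltnS leq_addr nth_cat ltnn subnn //.
Qed.

Definition reach code n p q := iter n (istep code) p = q.
Lemma reach_trans code n m p q r : reach code n p q -> reach code m q r ->
  reach code (n + m) p r.
Proof. by rewrite /reach addnC iterD => -> ->. Qed.

(** Jump targets are absolute, so the code is considered inside a context [pre], [post]. The
    induction is on the run and not on the program, because a loop revisits its own code. *)
Lemma comp_ok c s s' t : run c s s' t -> forall code pre post o, o = size pre ->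
  code = pre ++ comp c o ++ post ->
  exists n, n <= t /\ reach code n (o, s) (o + csize c, s').
Proof.
elim=> {c s s' t}.
- by move=> s code pre post o _ _; exists 0; rewrite addn0.
- move=> s i b code pre post o -> /= e; exists 1; split=> //.
  by rewrite /reach /= (istep_at s e) /= addn1.
- move=> s i code pre post o -> /= e; exists 1; split=> //.
  by rewrite /reach /= (istep_at s e) /= addn1.
- move=> c1 c2 s s1 s2 t1 t2 _ I1 _ I2 code pre post o ho e /=.
  have [|n1 [h1 r1]] := I1 code pre (comp c2 (o + csize c1) ++ post) o ho.
    by rewrite e /= -catA.
  have [||n2 [h2 r2]] := I2 code (pre ++ comp c1 o) post (o + csize c1).
  + by rewrite size_cat size_comp ho.
  + by rewrite e /= -?catA /= -?catA /= -?catA.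
  exists (n1 + n2); split; first exact: leq_add.
  by rewrite addnA; apply: reach_trans r1 r2.
- move=> i c0 c1 s s' t _ IH code pre post o ho e.
  set L := o + csize c0 + csize c1 + 2.
  have r0 : reach code 1 (o, s) ((if head false (s i) then o.+2 + csize c0 else o.+1), s).
    rewrite /reach /= ho (istep_at s e) -ho /=.
    by case: (s i) => [|[] l].
  case: (head false (s i)) IH r0 => IH r0.
    have [||n1 [h1 r1]] := IH code (pre ++ [:: IBr i o.+1 o.+1 (o.+2 + csize c0)] ++
        comp c0 o.+1 ++ [:: jmp L]) post (o.+2 + csize c0).
    + by rewrite !size_cat /= ?size_cat ?size_comp /= ho; lia.
    + by rewrite e /= -?catA /= -?catA /= -?catA.
    exists (1 + n1); split; first by lia.
    by apply: reach_trans r0 _; move: r1; congr reach; congr pair => /=; lia.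
  have [||n1 [h1 r1]] := IH code (pre ++ [:: IBr i o.+1 o.+1 (o.+2 + csize c0)])
       (jmp L :: comp c1 (o.+2 + csize c0) ++ post) o.+1.
  + by rewrite !size_cat /= ho; lia.
  + by rewrite e /= -?catA /= -?catA /= -?catA.
  exists (1 + (n1 + 1)); split; first by lia.
  apply: reach_trans r0 _; apply: reach_trans r1 _.
  rewrite /reach /= (_ : o.+1 + csize c0 =
     size (pre ++ [:: IBr i o.+1 o.+1 (o.+2 + csize c0)] ++ comp c0 o.+1)); last first.
    by rewrite !size_cat /= size_comp ho; lia.
  rewrite (@istep_at _ _ (jmp L) (comp c1 (o.+2 + csize c0) ++ post)).
    by rewrite /= /ibr3; case: ohead => [[]|]; congr pair; rewrite /L; lia.
  by rewrite e /= -?catA /= -?catA /= -?catA.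
- move=> i c0 c1 s e0 code pre post o ho e; exists 1; split=> //.
  rewrite /reach /= ho (istep_at s e) -ho /= e0 /=; congr pair; lia.
- move=> i c0 c1 s s1 s2 b l t1 t2 e0 _ I1 _ I2 code pre post o ho e.
  have {I2} [n2 [h2 r2]] := I2 code pre post o ho e.
  set hd := IBr i (o + csize c0 + csize c1 + 5) o.+1 (o.+3 + csize c0).
  have r0 : reach code 1 (o, s) ((if b then o.+3 + csize c0 else o.+1), s).
    by rewrite /reach /= ho (istep_at s e) -ho /= e0 /=; case: (b).
  case: b e0 I1 r0 => e0 I1 r0.
    set p := pre ++ [:: hd, IPop i & comp c0 o.+2] ++ [:: jmp o].
    have hp : size p = o.+3 + csize c0 by rewrite !size_cat /= size_comp ho; lia.
    have ep : code = p ++ IPop i :: comp c1 (o.+4 + csize c0) ++ [:: jmp o] ++ post.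
      by rewrite e /p /= -?catA /= -?catA /= -?catA.
    clearbody p.
    have r1 : reach code 1 (o.+3 + csize c0, s) (o.+4 + csize c0, upd s i l).
      by rewrite /reach /= -hp (istep_at s ep) /= e0 hp.
    have [||n1 [h1 r3]] := I1 code (p ++ [:: IPop i]) ([:: jmp o] ++ post) (o.+4 + csize c0).
    + by rewrite size_cat hp /=; lia.
    + by rewrite ep -?catA /= -?catA /= -?catA.
    exists (1 + (1 + (n1 + (1 + n2)))); split; first by lia.
    apply: reach_trans r0 _; apply: reach_trans r1 _; apply: reach_trans r3 _.
    apply: reach_trans r2; rewrite /reach /=.
    rewrite (_ : _ + csize c1 = size (p ++ [:: IPop i] ++ comp c1 (o.+4 + csize c0))); last first.
      by rewrite !size_cat hp size_comp /=; lia.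
    rewrite (@istep_at _ _ (jmp o) post).
      by rewrite /= /ibr3; case: ohead => [[]|].
    by rewrite ep -?catA /= -?catA /= -?catA.
  set p := pre ++ [:: hd].
  have hp : size p = o.+1 by rewrite !size_cat /= ho; lia.
  have ep : code = p ++ IPop i :: comp c0 o.+2 ++
      ([:: jmp o, IPop i & comp c1 (o.+4 + csize c0)] ++ [:: jmp o]) ++ post.
    by rewrite e /p /= -?catA /= -?catA /= -?catA.
  clearbody p.
  have r1 : reach code 1 (o.+1, s) (o.+2, upd s i l).
    by rewrite /reach /= -hp (istep_at s ep) /= e0 hp.
  have [||n1 [h1 r3]] := I1 code (p ++ [:: IPop i])
     (([:: jmp o, IPop i & comp c1 (o.+4 + csize c0)] ++ [:: jmp o]) ++ post) o.+2.
  + by rewrite size_cat hp /=; lia.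
  + by rewrite ep -?catA /= -?catA /= -?catA.
  exists (1 + (1 + (n1 + (1 + n2)))); split; first by lia.
  apply: reach_trans r0 _; apply: reach_trans r1 _; apply: reach_trans r3 _.
  apply: reach_trans r2; rewrite /reach /=.
  rewrite (_ : _ + csize c0 = size (p ++ [:: IPop i] ++ comp c0 o.+2)); last first.
    by rewrite !size_cat hp size_comp /=; lia.
  rewrite (@istep_at _ _ (jmp o) ([:: IPop i & comp c1 (o.+4 + csize c0)] ++ [:: jmp o] ++ post)).
    by rewrite /= /ibr3; case: ohead => [[]|].
  by rewrite ep -?catA /= -?catA /= -?catA.
Qed.

Definition total k (s : store) := \sum_(i < k) size (s i).

Lemma total_upd k s i l : i < k -> total k (upd s i l) + size (s i) = total k s + size l.
Proof.
move=> hi; rewrite /total (bigD1 (Ordinal hi)) //= [in RHS](bigD1 (Ordinal hi)) //=.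
rewrite /upd eqxx; under eq_bigr => j hj.
  have -> : (nat_of_ord j == i) = false.
    by apply/negbTE; apply: contraNneq hj => e; apply/eqP/val_inj.
  over.
by lia.
Qed.

Lemma len_store k s : len (mkseq s k) = k + total k s.
Proof.
rewrite /len /mkseq /total; elim: k => [|k IH]; first by rewrite big_ord0.
rewrite -[in LHS](addn1 k) iotaD map_cat blk_cat size_cat IH /= big_ord_recr /=.
by rewrite cats0 size_map add0n; lia.
Qed.

Lemma mkseq_split k s i : i < k -> exists l1 l2, size l1 = i /\
  forall l, mkseq (upd s i l) k = l1 ++ l :: l2.
Proof.
move=> hi; exists (mkseq s i), [seq s j | j <- iota i.+1 (k - i.+1)].
split; first by rewrite size_mkseq.
move=> l; rewrite /mkseq -{1}(subnKC hi) -addn1 -addnA iotaD map_cat add0n add1n /=.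
congr (_ ++ _).
  apply/eq_in_map => j; rewrite mem_iota add0n /upd => hj.
  by rewrite ltn_eqF.
rewrite addn1; congr (_ :: _); first by rewrite /upd eqxx.
apply/eq_in_map => j; rewrite mem_iota /upd => hj; rewrite gtn_eqF //; lia.
Qed.

Lemma upd_id s i : upd s i (s i) = s.
Proof. by apply: funext => j; rewrite /upd; case: eqP => [->|]. Qed.

Lemma istep_tm code k pc s j : all (fun c => ireg c < k) code -> pc < size code ->
  exists t j', t <= 2 * (k + total k s) + 6 /\
   tm_run t (confS code k pc (mkseq s k) j) =
   confS code k (istep code (pc, s)).1 (mkseq (istep code (pc, s)).2 k) j'.
Proof.
move=> hall hpc; have hi := all_nthP (IPop 0) hall pc hpc.
rewrite /istep /= hpc -len_store.
have [l1 [l2 [h1 hu]]] := mkseq_split s hi.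
have es : mkseq s k = l1 ++ s (ireg (nth (IPop 0) code pc)) :: l2 by rewrite -hu upd_id.
have hk : size (l1 ++ s (ireg (nth (IPop 0) code pc)) :: l2) = k by rewrite -es size_mkseq.
case ei : (nth _ _ _) hk es hu h1 => [i b|i|i e f t] /= hk es hu h1; rewrite ?hu es.
- exact: run_push ei _ _.
- exact: run_pop ei _ _.
- exact: run_br ei _ _.
Qed.

Lemma total_istep code k pc s : all (fun c => ireg c < k) code ->
  total k (istep code (pc, s)).2 <= (total k s).+1.
Proof.
move=> hall; rewrite /istep /=; case: ltnP => //= hpc.
have := all_nthP (IPop 0) hall pc hpc.
case: nth => [i b|i|i e f t] //= hi.
  by have := total_upd s (b :: s i) hi => /=; lia.
by have := total_upd s (behead (s i)) hi; rewrite size_behead; lia.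
Qed.

(** One instruction costs about two sweeps of the tape and lengthens the stacks by at most one
    symbol in total, so during [n] instructions the tape stays within [k + total k s + n]. *)
Lemma isteps_tm code k n : forall pc s j, all (fun c => ireg c < k) code ->
  (iter n (istep code) (pc, s)).1 = size code ->
  exists t j', t <= n * (2 * (k + total k s + n) + 6) /\
   tm_run t (confS code k pc (mkseq s k) j) =
   confS code k (size code) (mkseq (iter n (istep code) (pc, s)).2 k) j'.
Proof.
elim: n => [|n IH] pc s j hall he.
  by exists 0, j; move: he => /= <-.
have [hpc|hpc] := ltnP pc (size code); last first.
  have e m : iter m (istep code) (pc, s) = (pc, s).
    by elim: m => //= m ->; rewrite /istep /= ltnNge hpc.
  by rewrite e in he *; exists 0, j; rewrite -he.
have [t1 [j1 [h1 r1]]] := istep_tm s j hall hpc.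
rewrite iterSr in he *.
case e1 : (istep code (pc, s)) r1 he => [pc1 s1] /= r1 he.
have ht := total_istep pc s hall; rewrite e1 /= in ht.
have [t2 [j2 [h2 r2]]] := IH pc1 s1 j1 hall he.
exists (t1 + t2), j2; split; last by rewrite run_add r1.
by rewrite mulSn leq_add //; [lia | apply: (leq_trans h2); nia].
Qed.

Fixpoint cmax c := match c with
  | Nop => 0 | Push i _ | Pop i => i | Seq c1 c2 => maxn (cmax c1) (cmax c2)
  | If i c0 c1 | Each i c0 c1 => maxn i (maxn (cmax c0) (cmax c1)) end.

Lemma comp_regs c k o : cmax c < k -> all (fun c => ireg c < k) (comp c o).
Proof.
elim: c o => //= [i b|i|c1 I1 c2 I2|i c0 I0 c1 I1|i c0 I0 c1 I1] o.
- by rewrite andbT.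
- by rewrite andbT.
- by rewrite gtn_max all_cat => /andP[h1 h2]; rewrite I1 ?I2.
- rewrite !gtn_max all_cat /= => /and3P[hi h1 h2]; rewrite I1 ?I0 // hi /= andbT; lia.
- rewrite !gtn_max all_cat /= all_cat /= => /and3P[hi h1 h2].
  rewrite I1 ?I0 // hi /= !andbT; lia.
Qed.

Definition store0 : store := fun=> [::].

Theorem com_polytime (c : com) (f : seq bool -> seq bool) (q : nat -> nat) : isp q ->
  (forall x, exists s' t, run c (upd store0 0 x) s' t /\ t <= q (size x) /\ s' 0 = f x) ->
  polytime f.
Proof.
move=> hq hf.
(* Instruction 0 is the dummy which [run_init] uses to set up the stacks; the program proper begins
   at address 1. *)
set k := (cmax c).+1; set code := IPush 0 true :: comp c 1.
have hall : all (fun c => ireg c < k) code by rewrite /= comp_regs.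
have : isp (fun m => (2 * (m + k) + 6) + ((q m * (2 * (k + m + q m) + 6)) + 1)).
  by do ![exact: isp_const | exact: isp_id | assumption | apply: isp_add | apply: isp_mul].
move=> [_ [C [K hCK]]]; exists (SM code k), C, K => x.
have [s' [t [hr [ht hs]]]] := hf x.
have [||n [hn hreach]] := comp_ok hr (code := code) (pre := [:: IPush 0 true]) (post := [::]) (o := 1).
- by [].
- by rewrite cats0.
have [|||t1 [h1 r1]] := @run_init code k x 0 true => //.
have e1 : (x :: nseq k.-1 [::]) = mkseq (upd store0 0 x) k.
  rewrite /k /mkseq /=; congr cons.
  apply: (@eq_from_nth _ [::]); first by rewrite size_nseq size_map size_iota.
  move=> i; rewrite size_nseq => hi; rewrite nth_nseq hi (nth_map 0) ?size_iota //.
  by rewrite nth_iota.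
have htot : total k (upd store0 0 x) = size x.
  rewrite /total /k big_ord_recl /= big1 ?addn0 //.
have he : (iter n (istep code) (1, upd store0 0 x)).1 = size code.
  by rewrite hreach /= size_comp.
have [t2 [j2 [h2 r2]]] := isteps_tm 0 hall he.
have [cf [r3 [hh ho]]] := @run_halt code k (s' 0) [seq s' i | i <- iota 1 k.-1] j2.
exists (t1 + (t2 + 1)).
have -> : tm_run (t1 + (t2 + 1)) (tm_init (SM code k) x) = cf.
  rewrite !run_add r1 e1 r2 hreach -r3 /mkseq /k //.
split; last by rewrite -hs.
apply: leq_trans (hCK (size x)); rewrite leq_add // leq_add //.
apply: (leq_trans h2); rewrite htot; apply: leq_mul; first exact: leq_trans hn ht.
by rewrite leq_add2r leq_mul2l /= leq_add2l (leq_trans hn ht).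
Qed.

(** * Bounded terms and loop programs *)

Definition runs c s s' T := exists t, run c s s' t /\ t <= T.

Lemma runs_eq c s s1 s2 T1 T2 : runs c s s1 T1 -> s1 = s2 -> T1 <= T2 -> runs c s s2 T2.
Proof. by move=> [t [r h]] <- h2; exists t; split=> //; apply: leq_trans h2. Qed.
Lemma runs_seq c1 c2 s s1 s2 T1 T2 : runs c1 s s1 T1 -> runs c2 s1 s2 T2 ->
  runs (Seq c1 c2) s s2 (T1 + T2).
Proof.
move=> [t1 [r1 h1]] [t2 [r2 h2]]; exists (t1 + t2); split; last exact: leq_add.
exact: RSeq r1 r2.
Qed.
Lemma runs_nop s : runs Nop s s 0. Proof. by exists 0; split=> //; constructor. Qed.
Lemma runs_push s i b : runs (Push i b) s (upd s i (b :: s i)) 1.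
Proof. by exists 1; split=> //; constructor. Qed.
Lemma runs_pop s i : runs (Pop i) s (upd s i (behead (s i))) 1.
Proof. by exists 1; split=> //; constructor. Qed.
Lemma runs_if i c0 c1 s s' T : runs (if head false (s i) then c1 else c0) s s' T ->
  runs (If i c0 c1) s s' (T + 2).
Proof. by move=> [t [r h]]; exists (t + 2); split; [constructor|rewrite leq_add2r]. Qed.

Lemma updE s i l j : upd s i l j = if j == i then l else s j. Proof. by []. Qed.
Lemma updxx s i l : upd s i l i = l. Proof. by rewrite /upd eqxx. Qed.
Lemma upd2 s i l l' : upd (upd s i l) i l' = upd s i l'.
Proof. by apply: funext => j; rewrite /upd; case: eqP. Qed.

Ltac upd_cases := rewrite /upd;
  repeat (match goal with |- context[@eq_op _ ?a ?b] =>
     let H := fresh in case: (@eqP _ a b) => H; try (exfalso; lia) end).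
Ltac stq := apply: funext => ?; upd_cases; subst => //.

(** [st n] describes the store after [n] rounds, except for the controlling stack, which holds the
    rest of [l]. *)
Lemma runs_each i c0 c1 T (l : seq bool) : forall (st : nat -> store),
  (forall n, n < size l -> runs (if nth false l n then c1 else c0)
     (upd (st n) i (drop n.+1 l)) (upd (st n.+1) i (drop n.+1 l)) T) ->
  runs (Each i c0 c1) (upd (st 0) i l) (upd (st (size l)) i [::]) (size l * (T + 3) + 1).
Proof.
elim: l => [|b l IH] st H.
  by exists 1; split=> //; apply: REach0; rewrite updxx.
have [t1 [r1 h1]] := H 0 isT.
have [n hn|t2 [r2 h2]] := IH (fun n => st n.+1); first exact: H n.+1 hn.
exists (t1 + t2 + 3); split; last by rewrite /=; lia.
apply: (REach1 (b := b) (l := l)) r2; first by rewrite updxx.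
by move: r1; rewrite /= drop0 upd2.
Qed.

Lemma runs_each' i c0 c1 T s s' (st : nat -> store) :
  (forall n, n < size (s i) -> runs (if nth false (s i) n then c1 else c0)
     (upd (st n) i (drop n.+1 (s i))) (upd (st n.+1) i (drop n.+1 (s i))) T) ->
  upd (st 0) i (s i) = s -> upd (st (size (s i))) i [::] = s' ->
  runs (Each i c0 c1) s s' (size (s i) * (T + 3) + 1).
Proof. by move=> H e1 <-; have := runs_each H; rewrite e1. Qed.

Definition Loop i c := Each i c c.
Definition mov i j := Each i (Push j false) (Push j true).
Definition movU i j := Loop i (Push j true).
Definition clear i := Loop i Nop.
(** Reading a stack destroys it, so the source is moved to the scratch stack [k] and rebuilt while
    the copy is made. *)
Definition copyU i j k := Seq (mov i k) (Each k (Seq (Push i false) (Push j true)) (Seq (Push i true) (Push j true))).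
Definition copy i j k := Seq (mov i k) (Each k (Seq (Push i false) (Push j false)) (Seq (Push i true) (Push j true))).

Lemma rev_take_step (l : seq bool) n : n < size l ->
  rev (take n.+1 l) = nth false l n :: rev (take n l).
Proof. by move=> h; rewrite (take_nth false h) rev_rcons. Qed.

Lemma runs_mov s i j : i != j ->
  runs (mov i j) s (upd (upd s i [::]) j (rev (s i) ++ s j)) (size (s i) * 4 + 1).
Proof.
move=> /eqP hij; apply: (runs_each' (T := 1) (st := fun n => upd s j (rev (take n (s i)) ++ s j))).
- move=> n hn; set b := nth _ _ _.
  have -> : (if b then Push j true else Push j false) = Push j b by case: (b).
  apply: runs_eq (runs_push _ _ _) _ _ => //.
  by rewrite (rev_take_step hn) -/b; stq.
- by rewrite take0; stq.
- by rewrite take_size; stq.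
Qed.

Lemma runs_movU s i j : i != j ->
  runs (movU i j) s (upd (upd s i [::]) j (nseq (size (s i)) true ++ s j)) (size (s i) * 4 + 1).
Proof.
move=> /eqP hij; apply: (runs_each' (T := 1) (st := fun n => upd s j (nseq n true ++ s j))).
- move=> n hn; rewrite if_same.
  by apply: runs_eq (runs_push _ _ _) _ _ => //; stq.
- by stq.
- by stq.
Qed.

Lemma runs_clear s i : runs (clear i) s (upd s i [::]) (size (s i) * 3 + 1).
Proof.
apply: (runs_each' (T := 0) (st := fun n => s)); last by [].
- by move=> n hn; rewrite if_same; apply: runs_nop.
- by rewrite upd_id.
Qed.

Lemma runs_copyU s i j k : i != j -> i != k -> j != k -> s k = [::] ->
  runs (copyU i j k) s (upd s j (nseq (size (s i)) true ++ s j)) (size (s i) * 9 + 2).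
Proof.
move=> /eqP hij /eqP hik /eqP hjk hk.
have r1 := @runs_mov s i k (introN eqP hik).
set s1 := upd _ _ _ in r1.
have e1 : s1 k = rev (s i) by rewrite /s1 updxx hk cats0.
have r2 : runs (Each k (Seq (Push i false) (Push j true)) (Seq (Push i true) (Push j true))) s1
   (upd s j (nseq (size (s i)) true ++ s j)) (size (s1 k) * (2 + 3) + 1).
  apply: (runs_each' (st := fun n => upd (upd s i (rev (take n (rev (s i))))) j (nseq n true ++ s j))).
  - move=> n; rewrite e1 => hn; set b := nth _ _ _.
    have -> : (if b then Seq (Push i true) (Push j true) else Seq (Push i false) (Push j true))
       = Seq (Push i b) (Push j true) by case: (b).
    apply: runs_eq (runs_seq (runs_push _ _ _) (runs_push _ _ _)) _ _ => //.
    by rewrite (rev_take_step hn) -/b; stq.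
  - by rewrite e1 /s1 take0; stq; rewrite hk cats0.
  - by rewrite e1 take_size size_rev revK; stq.
apply: runs_eq (runs_seq r1 r2) _ _ => //.
by rewrite e1 size_rev; lia.
Qed.

Lemma runs_copy s i j k : i != j -> i != k -> j != k -> s k = [::] ->
  runs (copy i j k) s (upd s j (s i ++ s j)) (size (s i) * 9 + 2).
Proof.
move=> /eqP hij /eqP hik /eqP hjk hk.
have r1 := @runs_mov s i k (introN eqP hik).
set s1 := upd _ _ _ in r1.
have e1 : s1 k = rev (s i) by rewrite /s1 updxx hk cats0.
have r2 : runs (Each k (Seq (Push i false) (Push j false)) (Seq (Push i true) (Push j true))) s1
   (upd s j (s i ++ s j)) (size (s1 k) * (2 + 3) + 1).
  apply: (runs_each' (st := fun n => upd (upd s i (rev (take n (rev (s i))))) j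
       (rev (take n (rev (s i))) ++ s j))).
  - move=> n; rewrite e1 => hn; set b := nth _ _ _.
    have -> : (if b then Seq (Push i true) (Push j true) else Seq (Push i false) (Push j false))
       = Seq (Push i b) (Push j b) by case: (b).
    apply: runs_eq (runs_seq (runs_push _ _ _) (runs_push _ _ _)) _ _ => //.
    by rewrite (rev_take_step hn) -/b; stq.
  - by rewrite e1 /s1 take0; stq; rewrite hk cats0.
  - by rewrite e1 take_size revK; stq.
apply: runs_eq (runs_seq r1 r2) _ _ => //.
by rewrite e1 size_rev; lia.
Qed.

(** * Terms with bounded counting and iteration *)

Inductive trm :=
  | V of nat | C of nat | Add of trm & trm | Mul of trm & trm | Sbt of trm & trm
  | Bit of nat & trm
  | Cnt of nat & trm
  | Let of nat & trm & trm
  | It of nat & trm & trm & trm.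

(* A stack denotes its size; stack 1 holds the range B of the quantifiers. *)
Fixpoint tev t (s : store) : nat := match t with
  | V i => size (s i)
  | C n => n
  | Add a b => tev a s + tev b s
  | Mul a b => tev a s * tev b s
  | Sbt a b => tev a s - tev b s
  | Bit i a => nth false (s i) (tev a s)
  | Cnt x a => count (fun v => tev a (upd s x (nseq v true)) != 0) (iota 0 (size (s 1)))
  | Let x a b => tev b (upd s x (nseq (tev a s) true))
  | It x a b c => iter (tev b s) (fun v => minn (tev c (upd s x (nseq v true))) (size (s 1))) (tev a s)
  end.

Fixpoint wft D t := match t with
  | V i => 0 < i < D
  | C _ => true
  | Add a b | Mul a b | Sbt a b => wft D a && wft D b
  | Bit i a => (0 < i < D) && wft D a
  | Cnt x a => (1 < x < D) && wft D a
  | Let x a b => [&& 1 < x < D, wft D a & wft D b]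
  | It x a b c => [&& 1 < x < D, wft D a, wft D b & wft D c]
  end.

(** Stack 0 is exempt because it collects the output and is not readable by terms. *)
Definition agree D (s s' : store) := forall i, 0 < i < D -> s i = s' i.

Lemma agree_upd D s s' x l : agree D s s' -> agree D (upd s x l) (upd s' x l).
Proof. by move=> h i hi; rewrite /upd; case: eqP => // _; apply: h. Qed.

Lemma agree_sym D s s' : agree D s s' -> agree D s' s.
Proof. by move=> h i hi; rewrite h. Qed.

Lemma tev_ext D t : 1 < D -> forall s s', wft D t -> agree D s s' -> tev t s = tev t s'.
Proof.
move=> hD; elim: t => [i|n|a IA b IB|a IA b IB|a IA b IB|i a IA|x a IA|x a IA b IB|x a IA b IB c IC] s s' /=.
- by move=> hi /(_ i hi) ->.
- by [].
- by move=> /andP[ha hb] h; rewrite (IA s s') // (IB s s').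
- by move=> /andP[ha hb] h; rewrite (IA s s') // (IB s s').
- by move=> /andP[ha hb] h; rewrite (IA s s') // (IB s s').
- by move=> /andP[hi ha] h; rewrite (IA s s') // (h i).
- move=> /andP[hx ha] h; rewrite (h 1) //; apply: eq_count => v.
  by rewrite (IA _ (upd s' x (nseq v true))) //; apply: agree_upd.
- move=> /and3P[hx ha hb] h; rewrite (IA s s') //; apply: IB => //; exact: agree_upd.
- move=> /and4P[hx ha hb hc] h; rewrite (IA s s') // (IB s s') // (h 1) //.
  apply: eq_iter => v; congr minn; apply: IC => //; exact: agree_upd.
Qed.

(** [d] is the first free stack. The value is left there in unary and the stacks above are scratch,
    empty again at the end. The old content of a bound variable is parked in scratch and
    restored. *)
Fixpoint tcomp d t : com := match t with
  | V i => copyU i d d.+1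
  | C n => iter n (Seq (Push d true)) Nop
  | Add a b => Seq (tcomp d a) (Seq (tcomp d.+1 b) (movU d.+1 d))
  | Mul a b => Seq (tcomp d a) (Seq (tcomp d.+1 b)
      (Seq (Loop d (copyU d.+1 d.+2 d.+3)) (Seq (clear d.+1) (movU d.+2 d))))
  | Sbt a b => Seq (tcomp d a) (Seq (tcomp d.+1 b) (Loop d.+1 (Pop d)))
  | Bit i a => Seq (tcomp d a) (Seq (copy i d.+1 d.+2)
      (Seq (Loop d (Pop d.+1)) (Seq (If d.+1 Nop (Push d true)) (clear d.+1))))
  | Cnt x a => Seq (mov x d.+1) (Seq (copyU 1 d.+2 d.+3) (Seq
      (Loop d.+2 (Seq (tcomp d.+3 a)
         (Seq (If d.+3 Nop (Seq (clear d.+3) (Push d true))) (Push x true))))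
      (Seq (clear x) (mov d.+1 x))))
  | Let x a b => Seq (tcomp d a) (Seq (mov x d.+1) (Seq (movU d x) (Seq (tcomp d.+2 b)
      (Seq (clear x) (Seq (mov d.+1 x) (movU d.+2 d))))))
  | It x a b c => Seq (tcomp d a) (Seq (tcomp d.+1 b) (Seq (mov x d.+2) (Seq
      (Loop d.+1 (Seq (movU d x) (Seq (tcomp d.+3 c) (Seq (copyU 1 d.+4 d.+4.+1)
         (Seq (Loop d.+3 (If d.+4 Nop (Seq (Pop d.+4) (Push d true))))
            (Seq (clear d.+4) (clear x)))))))
      (mov d.+2 x))))
  end.

Definition clean d (s : store) := forall i, d <= i -> s i = [::].
Definition bnd D M (s : store) := forall i, 0 < i < D -> size (s i) <= M.

Lemma clean_upd d d' s i l : clean d s -> d <= d' -> i < d' -> clean d' (upd s i l).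
Proof. by move=> h hd hi j hj; rewrite /upd gtn_eqF ?h //; lia. Qed.
Lemma bnd_upd D M M' s i l : bnd D M s -> M <= M' -> size l <= M' -> bnd D M' (upd s i l).
Proof. by move=> h hM hl j hj; rewrite /upd; case: eqP => // _; have := h j hj; lia. Qed.
Lemma bnd_ext D M s s' : bnd D M s -> agree D s s' -> bnd D M s'.
Proof. by move=> h ha j hj; rewrite -ha //; apply: h. Qed.
Lemma agree_upd_out D s s' i l : agree D s s' -> (i == 0) || (D <= i) -> agree D (upd s i l) s'.
Proof. by move=> h hi j hj; rewrite /upd; case: eqP => [e|_]; [lia|apply: h]. Qed.

Lemma minn_iter_push n m : minn n.+1 m = minn n m + (n < m).
Proof. lia. Qed.

Lemma runs_loop_pop s i j : i != j ->
  runs (Loop i (Pop j)) s (upd (upd s i [::]) j (drop (size (s i)) (s j))) (size (s i) * 4 + 1).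
Proof.
move=> /eqP hij; apply: (runs_each' (T := 1) (st := fun n => upd s j (drop n (s j)))).
- move=> n hn; rewrite if_same.
  apply: runs_eq (runs_pop _ _) _ _ => //.
  by stq; rewrite -drop1 drop_drop add1n.
- by rewrite drop0; stq.
- by stq.
Qed.

(** This implements truncation: with a copy of the range bound on [j], no more symbols than the
    bound are passed from [i] to [k]. *)
Lemma runs_loop_min s i j k : i != j -> i != k -> j != k ->
  s j = nseq (size (s j)) true ->
  runs (Loop i (If j Nop (Seq (Pop j) (Push k true)))) s
    (upd (upd (upd s i [::]) j (drop (size (s i)) (s j))) k
       (nseq (minn (size (s i)) (size (s j))) true ++ s k)) (size (s i) * 7 + 1).
Proof.
move=> /eqP hij /eqP hik /eqP hjk hu.
apply: (runs_each' (T := 4) (st := fun n => upd (upd s j (drop n (s j))) k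
   (nseq (minn n (size (s j))) true ++ s k))).
- move=> n hn; rewrite if_same.
  have [h|h] := ltnP n (size (s j)).
    apply: runs_eq (runs_if (T := 2) (s' := upd (upd (upd s j (drop n.+1 (s j))) k
      (nseq (minn n.+1 (size (s j))) true ++ s k)) i (drop n.+1 (s i))) _) _ _ => //.
    rewrite (_ : head false _ = true); last first.
      upd_cases; by rewrite -nth0 nth_drop addn0 hu nth_nseq h.
    apply: runs_eq (runs_seq (runs_pop _ _) (runs_push _ _ _)) _ _ => //.
    rewrite minn_iter_push h addn1; stq.
    - by rewrite (minn_idPl (ltnW h)).
    - by rewrite -drop1 drop_drop add1n.
  apply: runs_eq (runs_if (T := 0) (s' := upd (upd (upd s j (drop n.+1 (s j))) k
      (nseq (minn n.+1 (size (s j))) true ++ s k)) i (drop n.+1 (s i))) _) _ _ => //.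
  rewrite (_ : head false _ = false); last first.
    by upd_cases; rewrite drop_oversize.
  apply: runs_eq (runs_nop _) _ _ => //.
  by rewrite (minn_idPr (leqW h)) (drop_oversize h) (drop_oversize (leqW h)).
- by rewrite drop0 min0n; stq.
- by stq.
Qed.

Lemma drop_nseqb n m (b : bool) : drop n (nseq m b) = nseq (m - n) b.
Proof. by elim: m n => [|m IH] [|n] //=. Qed.
Lemma rev_nseqb n (b : bool) : rev (nseq n b) = nseq n b.
Proof.
elim: n => // n IH; rewrite /= rev_cons IH.
by elim: (n) => //= m ->.
Qed.

Lemma clean_scratch d s : clean d s ->
  (s d = [::]) * (s d.+1 = [::]) * (s d.+2 = [::]) * (s d.+3 = [::]) * (s d.+4 = [::]) * (s d.+4.+1 = [::]).
Proof. by move=> h; rewrite !h //; lia. Qed.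

Ltac fin hz := rewrite ?hz ?size_nseq ?revK ?cats0 ?hz ?cats0 //; try lia.

Ltac isp_auto := do ![exact: isp_const | exact: isp_id | assumption | apply: isp_add
  | apply: isp_mul | apply: isp_exp].

Section TermCompile.
Variable D : nat.
Hypothesis hD : 1 < D.

(** One function bounds value and time together, since values are written in unary and enter the
    time bounds of the enclosing terms. *)
Definition tok t (q : nat -> nat) := forall d s M, D <= d -> clean d s -> bnd D M s ->
  tev t s <= q M /\ runs (tcomp d t) s (upd s d (nseq (tev t s) true)) (q M).

Lemma runs_pushn n d s :
  runs (iter n (Seq (Push d true)) Nop) s (upd s d (nseq n true ++ s d)) n.
Proof.
elim: n s => [|n IH] s /=; first by rewrite upd_id; apply: runs_nop.
apply: runs_eq (runs_seq (runs_push _ _ _) (IH _)) _ _ => //.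
rewrite upd2 updxx; congr upd; elim: (n) => //= m <- //.
Qed.

Lemma tok_V i : 0 < i < D -> tok (V i) (fun m => m * 9 + 2).
Proof.
move=> hi d s M hd hc hb; have hs := hb i hi; split=> /=; first by lia.
have [e1 e2] : s d = [::] /\ s d.+1 = [::] by rewrite !hc //; lia.
by apply: runs_eq (runs_copyU _ _ _ _) _ _; rewrite ?e1 ?e2 ?cats0 //; lia.
Qed.

Lemma tok_C n : tok (C n) (fun=> n).
Proof.
move=> d s M hd hc hb; split=> //=.
by apply: runs_eq (runs_pushn _ _ _) _ _ => //; rewrite hc ?cats0.
Qed.

Lemma tev_up t s d l : wft D t -> D <= d -> tev t (upd s d l) = tev t s.
Proof.
by move=> hw hd; apply: (tev_ext hD hw); apply: agree_upd_out; rewrite ?hd ?orbT.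
Qed.

Lemma bnd_up s d l M : D <= d -> bnd D M s -> bnd D M (upd s d l).
Proof.
by move=> hd hb; apply: bnd_ext hb _; apply/agree_sym/agree_upd_out; rewrite ?hd ?orbT.
Qed.

Lemma runs_two a b qa qb : wft D a -> wft D b -> tok a qa -> tok b qb ->
  forall d s M, D <= d -> clean d s -> bnd D M s ->
  [/\ tev a s <= qa M, tev b s <= qb M &
  runs (Seq (tcomp d a) (tcomp d.+1 b)) s
     (upd (upd s d (nseq (tev a s) true)) d.+1 (nseq (tev b s) true)) (qa M + qb M)].
Proof.
move=> wa wb ha hb d s M hd hc hbd.
have [va ra] := ha d s M hd hc hbd.
have [|||vb rb] := hb d.+1 (upd s d (nseq (tev a s) true)) M.
- by lia.
- by apply: clean_upd hc _ _.
- exact: bnd_up.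
rewrite tev_up // in vb rb.
by split=> //; apply: runs_seq ra rb.
Qed.

Lemma runs_assoc c1 c2 c3 s s' T : runs (Seq (Seq c1 c2) c3) s s' T ->
  runs (Seq c1 (Seq c2 c3)) s s' T.
Proof.
move=> [t [r h]]; exists t; split=> //.
inversion r as [| | |c12 c3' ? s2 ? t12 t3 r12 r3| | |]; subst.
inversion r12 as [| | |c1' c2' ? s1 ? t1 t2 r1 r2| | |]; subst.
by rewrite -addnA; apply: RSeq r1 (RSeq r2 r3).
Qed.

Lemma tok_Add a b qa qb : wft D a -> wft D b -> tok a qa -> tok b qb ->
  tok (Add a b) (fun m => qa m + qb m * 6 + 1).
Proof.
move=> wa wb ha hb d s M hd hc hbd.
have [va vb r] := runs_two wa wb ha hb hd hc hbd; split=> /=; first by lia.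
apply: runs_assoc.
apply: runs_eq (runs_seq r (@runs_movU _ d.+1 d _)) _ _; first by lia.
  stq; rewrite ?size_nseq -?nseqD ?(addnC (tev b s)) //; by rewrite hc.
by upd_cases; rewrite size_nseq; lia.
Qed.

Lemma tok_Sub a b qa qb : wft D a -> wft D b -> tok a qa -> tok b qb ->
  tok (Sbt a b) (fun m => qa m + qb m * 6 + 1).
Proof.
move=> wa wb ha hb d s M hd hc hbd.
have [va vb r] := runs_two wa wb ha hb hd hc hbd; split=> /=; first by lia.
apply: runs_assoc.
apply: runs_eq (runs_seq r (@runs_loop_pop _ d.+1 d _)) _ _; first by lia.
  by stq; rewrite ?size_nseq ?drop_nseqb // hc.
by upd_cases; rewrite size_nseq; lia.
Qed.

Lemma tok_Mul a b qa qb : wft D a -> wft D b -> tok a qa -> tok b qb ->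
  tok (Mul a b) (fun m => qa m + qb m + (qa m * (qb m * 9 + 5) + 1) + (qb m * 3 + 1) + (qa m * qb m * 4 + 1) ).
Proof.
move=> wa wb ha hb d s M hd hc hbd.
have [va vb r] := runs_two wa wb ha hb hd hc hbd; split=> /=; first by nia.
apply: runs_assoc.
set x := tev a s in va r *; set y := tev b s in vb r *.
set s1 := upd _ _ _ in r.
have r2 : runs (Loop d (copyU d.+1 d.+2 d.+3)) s1
   (upd (upd s d.+1 (nseq y true)) d.+2 (nseq (x * y) true)) (size (s1 d) * (y * 9 + 2 + 3) + 1).
  apply: (runs_each' (st := fun n => upd (upd s d.+1 (nseq y true)) d.+2 (nseq (n * y) true))).
  - move=> n hn; rewrite if_same.
    apply: runs_eq (@runs_copyU _ d.+1 d.+2 d.+3 _ _ _ _) _ _; try lia.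
    + by upd_cases; rewrite hc //; lia.
    + by stq; rewrite size_nseq -nseqD mulSn.
    + by upd_cases; rewrite size_nseq; lia.
  - by rewrite /s1; stq; rewrite hc //; lia.
  - by rewrite /s1; stq; rewrite ?size_nseq ?hc.
have e1 : size (s1 d) = x by rewrite /s1; upd_cases; rewrite size_nseq.
apply: runs_eq (runs_seq r (runs_seq r2 (runs_seq (runs_clear _ d.+1) (@runs_movU _ d.+2 d _)))) _ _.
- by lia.
- by stq; rewrite ?size_nseq ?hc ?cats0 //; lia.
- rewrite e1; upd_cases; rewrite !size_nseq; have : x * y <= qa M * qb M by apply: leq_mul.
  have : x * (y * 9 + 5) <= qa M * (qb M * 9 + 5) by apply: leq_mul => //; lia.
  have -> : y * 9 + 2 + 3 = y * 9 + 5 by lia.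
  lia.
Qed.

Lemma tok_Bit i a qa : 0 < i < D -> wft D a -> tok a qa ->
  tok (Bit i a) (fun m => qa m * 5 + m * 12 + 10).
Proof.
move=> hi wa ha d s M hd hc hbd.
have [va r] := ha d s M hd hc hbd; have hs := hbd i hi.
split=> /=; first by case: nth => /=; lia.
set x := tev a s in va r *; set s1 := upd _ _ _ in r.
have e1 : s1 i = s i by rewrite /s1; upd_cases.
have r2 : runs (copy i d.+1 d.+2) s1 (upd s1 d.+1 (s1 i ++ s1 d.+1)) (size (s1 i) * 9 + 2).
  by apply: runs_copy; try lia; rewrite /s1; upd_cases; rewrite hc //; lia.
rewrite e1 in r2; set s2 := upd s1 _ _ in r2.
have e2 : s2 d.+1 = s i by rewrite /s2 /s1; upd_cases; rewrite (hc d.+1) ?cats0 //; lia.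
have e2' : s2 d = nseq x true by rewrite /s2 /s1; upd_cases.
have r3 := @runs_loop_pop s2 d d.+1 (ltac:(lia)).
rewrite e2 e2' size_nseq in r3; set s3 := upd _ d.+1 (drop _ _) in r3.
have e3 : head false (s3 d.+1) = nth false (s i) x.
  by rewrite /s3; upd_cases; rewrite -nth0 nth_drop addn0.
have r4 : runs (If d.+1 Nop (Push d true)) s3 (upd s3 d (nseq (nth false (s i) x) true)) 3.
  have e4 : s3 d = [::] by rewrite /s3; upd_cases.
  apply: runs_eq (runs_if (T := 1) (s' := upd s3 d (nseq (nth false (s i) x) true)) _) _ _ => //.
  rewrite e3; case: nth => /=.
    by apply: runs_eq (runs_push _ _ _) _ _ => //; rewrite e4.
  by apply: runs_eq (runs_nop _) _ _ => //; rewrite -e4 upd_id.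
apply: runs_eq (runs_seq r (runs_seq r2 (runs_seq r3 (runs_seq r4 (runs_clear _ d.+1))))) _ _.
- by rewrite /s3 /s2 /s1; stq; rewrite hc //; lia.
- have : size (s3 d.+1) <= size (s i) by rewrite /s3; upd_cases; rewrite size_drop; lia.
  rewrite updE (_ : (d.+1 == d) = false); last by lia.
  lia.
Qed.

Lemma tok_Cnt x a qa : 1 < x < D -> wft D a -> tok a qa ->
  tok (Cnt x a) (fun m => m * (qa m * 4 + 8) + m * 30 + 20).
Proof.
move=> hx wa ha d s M hd hc hbd; have hz := clean_scratch hc.
have hB := hbd 1 (ltac:(lia)); have hsx := hbd x (ltac:(lia)).
set B := size (s 1) in hB.
have hcnt : tev (Cnt x a) s <= M.
  rewrite /= (leq_trans (count_size _ _)) // size_iota //.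
split; first by lia.
set P := fun v => tev a (upd s x (nseq v true)) != 0.
pose cn n := count P (iota 0 n).
have r1 := @runs_mov s x d.+1 (ltac:(lia)); set s1 := upd _ _ _ in r1.
have e1 : s1 1 = s 1 by rewrite /s1; upd_cases.
have r2 : runs (copyU 1 d.+2 d.+3) s1 (upd s1 d.+2 (nseq (size (s1 1)) true ++ s1 d.+2)) (size (s1 1) * 9 + 2).
  by apply: runs_copyU; try lia; rewrite /s1; upd_cases; fin hz.
rewrite e1 -/B in r2; set s2 := upd s1 _ _ in r2.
have e2 : s2 d.+2 = nseq B true by rewrite /s2 /s1; upd_cases; fin hz.
(* The variable [x] is itself the counter: it grows by one symbol per round and is cleared only
   after the loop. *)
pose st n := upd (upd (upd s x (nseq n true)) d (nseq (cn n) true)) d.+1 (rev (s x)).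
have r3 : runs (Loop d.+2 (Seq (tcomp d.+3 a)
         (Seq (If d.+3 Nop (Seq (clear d.+3) (Push d true))) (Push x true)))) s2
    (upd (st B) d.+2 [::]) (size (s2 d.+2) * (qa M * 4 + 5 + 3) + 1).
  apply: (runs_each' (st := st)); first 1 last.
  - by rewrite /st /s2 /s1 /cn /=; stq; fin hz.
  - by rewrite e2 size_nseq.
  move=> n; rewrite e2 size_nseq => hn; rewrite if_same.
  set sn := upd (st n) _ _.
  have en : tev a sn = tev a (upd s x (nseq n true)).
    apply: (tev_ext hD wa) => i hi; rewrite /sn /st; upd_cases => //.
  have [|||vn rn] := ha d.+3 sn M.
  - by lia.
  - by move=> i hi; rewrite /sn /st; upd_cases; apply: hc; lia.
  - move=> i hi; rewrite /sn /st; upd_cases; rewrite ?size_nseq; last exact: hbd.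
    by lia.
  rewrite en in vn rn; set s3 := upd sn _ _ in rn.
  have hcn : cn n.+1 = cn n + P n by rewrite /cn -addn1 iotaD count_cat /= addn0.
  have r4 : runs (If d.+3 Nop (Seq (clear d.+3) (Push d true))) s3
      (upd sn d (nseq (cn n.+1) true)) (qa M * 3 + 4).
    apply: runs_eq (runs_if (T := qa M * 3 + 2) (s' := upd sn d (nseq (cn n.+1) true)) _) _ _ => //; last by lia.
    rewrite (_ : head false _ = P n); last first.
      by rewrite /s3 updxx /P; case: (tev a _).
    rewrite hcn /P; case: eqP => [e0|_] /=.
      apply: runs_eq (runs_nop _) _ _ => //; rewrite /s3 e0 /sn /st; stq; rewrite ?addn0; fin hz.
    apply: runs_eq (runs_seq (runs_clear _ _) (runs_push _ _ _)) _ _ => //.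
      rewrite /s3 /sn /st; stq; rewrite ?addn1; fin hz.
    by rewrite /s3 updxx size_nseq; lia.
  apply: runs_eq (runs_seq rn (runs_seq r4 (runs_push _ _ _))) _ _ => //; last by lia.
  by rewrite /sn /st; stq.
rewrite e2 size_nseq in r3.
apply: runs_eq (runs_seq r1 (runs_seq r2 (runs_seq r3 (runs_seq (runs_clear _ x) (@runs_mov _ d.+1 x _))))) _ _.
- by lia.
- rewrite /st; stq; fin hz.
- rewrite /st; upd_cases; rewrite size_nseq size_rev -/B.
  have : B * (qa M * 4 + 5 + 3) <= M * (qa M * 4 + 8) by apply: leq_mul => //; lia.
  lia.
Qed.

(** Inside [b] the stack [x] may have length [qa m], so the bound of [b] is taken at [m + qa m]. *)
Lemma tok_Let x a b qa qb : 1 < x < D -> wft D a -> wft D b -> tok a qa -> tok b qb -> isp qb ->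
  tok (Let x a b) (fun m => qa m * 10 + m * 10 + qb (m + qa m) * 6 + 10).
Proof.
move=> hx wa wb ha hb [hmono _] d s M hd hc hbd; have hz := clean_scratch hc.
have hsx := hbd x (ltac:(lia)).
have [va ra] := ha d s M hd hc hbd.
set v := tev a s in va ra; set s1 := upd _ _ _ in ra.
have r2 := @runs_mov s1 x d.+1 (ltac:(lia)); set s2 := upd _ d.+1 _ in r2.
have r3 := @runs_movU s2 d x (ltac:(lia)); set s3 := upd _ x _ in r3.
have e3 : s3 = upd (upd s x (nseq v true)) d.+1 (rev (s x)).
  rewrite /s3 /s2 /s1; stq; fin hz.
have [|||vb rb] := hb d.+2 s3 (M + qa M).
- by lia.
- by move=> i hi; rewrite e3; upd_cases; apply: hc; lia.
- move=> i hi; rewrite e3; upd_cases; rewrite ?size_nseq; last by have := hbd i hi; lia.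
  by lia.
have en : tev b s3 = tev (Let x a b) s.
  by apply: (tev_ext hD wb) => i hi; rewrite e3; upd_cases.
rewrite en in vb rb; set w := tev (Let x a b) s in vb rb *.
split; first by lia.
set s4 := upd s3 _ _ in rb.
apply: runs_eq (runs_seq ra (runs_seq r2 (runs_seq r3 (runs_seq rb (runs_seq (runs_clear _ x)
   (runs_seq (@runs_mov _ d.+1 x _) (@runs_movU _ d.+2 d _))))))) _ _; try lia.
- rewrite /s4 e3; stq; fin hz.
- have -> : size (s1 x) = size (s x) by rewrite /s1; upd_cases.
  have -> : size (s2 d) = v by rewrite /s2 /s1; upd_cases; rewrite size_nseq.
  rewrite /s4 e3; upd_cases; rewrite !size_nseq size_rev; lia.
Qed.

Lemma tok_It x a b c qa qb qc : 1 < x < D -> wft D a -> wft D b -> wft D c ->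
  tok a qa -> tok b qb -> tok c qc -> isp qc ->
  tok (It x a b c) (fun m => (qa m + qb m) + (m * 4 + 1) +
    (qb m * ((qa m + m) * 10 + qc (m + qa m) * 10 + m * 20 + 20) + 1) + (m * 4 + 1) + m + qa m).
Proof.
move=> hx wa wb wc ha hb hcc [hmono _] d s M hd hc hbd; have hz := clean_scratch hc.
have hsx := hbd x (ltac:(lia)); have hB := hbd 1 (ltac:(lia)).
have [va vb r1] := runs_two wa wb ha hb hd hc hbd.
set v := tev a s in va r1 *; set n0 := tev b s in vb r1 *; set s1 := upd _ _ _ in r1.
set B := size (s 1) in hB.
pose F v := minn (tev c (upd s x (nseq v true))) B.
(* Truncation of every iterate at the range bound keeps iteration polynomial; otherwise the size
   could be squared in every round. *)
have hF n : iter n F v <= M + qa M by case: n => [|n] /=; rewrite ?/F; lia.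
split; first by rewrite /= -/n0 -/v -/B -/F; have := hF n0; lia.
have r2 := @runs_mov s1 x d.+2 (ltac:(lia)); set s2 := upd _ d.+2 _ in r2.
pose st n := upd (upd (upd s x [::]) d (nseq (iter n F v) true)) d.+2 (rev (s x)).
have e2 : s2 d.+1 = nseq n0 true by rewrite /s2 /s1; upd_cases.
set T := (qa M + M) * 10 + qc (M + qa M) * 10 + M * 20 + 17.
have r3 : runs (Loop d.+1 (Seq (movU d x) (Seq (tcomp d.+3 c) (Seq (copyU 1 d.+4 d.+4.+1)
         (Seq (Loop d.+3 (If d.+4 Nop (Seq (Pop d.+4) (Push d true))))
            (Seq (clear d.+4) (clear x))))))) s2
    (upd (st n0) d.+1 [::]) (size (s2 d.+1) * (T + 3) + 1).
  apply: (runs_each' (st := st)); first 1 last.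
  - rewrite /st /s2 /s1 /=; stq; fin hz.
  - by rewrite e2 size_nseq.
  move=> n; rewrite e2 size_nseq => hn; rewrite if_same.
  set sn := upd (st n) _ _; set w := iter n F v.
  have q1 := @runs_movU sn d x (ltac:(lia)); set sn1 := upd _ x _ in q1.
  have f1 : sn1 = upd (upd (upd s x (nseq w true)) d.+2 (rev (s x))) d.+1 (drop n.+1 (nseq n0 true)).
    rewrite /sn1 /sn /st -/w; stq; fin hz.
  have en : tev c sn1 = tev c (upd s x (nseq w true)).
    by apply: (tev_ext hD wc) => i hi; rewrite f1; upd_cases.
  have [|||vn rn] := hcc d.+3 sn1 (M + qa M).
  - by lia.
  - by move=> i hi; rewrite f1; upd_cases; apply: hc; lia.
  - move=> i hi; rewrite f1; upd_cases; rewrite ?size_nseq; last by have := hbd i hi; lia.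
    exact: hF.
  rewrite en in vn rn; set u := tev c _ in vn rn; set sn2 := upd sn1 _ _ in rn.
  have g2 : sn2 1 = s 1 by rewrite /sn2 f1; upd_cases.
  have q3 : runs (copyU 1 d.+4 d.+4.+1) sn2 (upd sn2 d.+4 (nseq B true)) (B * 9 + 2).
    apply: runs_eq (@runs_copyU _ 1 d.+4 d.+4.+1 _ _ _ _) _ _; try lia.
    + by rewrite /sn2 f1; upd_cases; fin hz.
    + by rewrite g2 /sn2 f1; stq; fin hz.
    + by rewrite g2.
  set sn3 := upd sn2 _ _ in q3.
  have g3 : sn3 d.+4 = nseq B true by rewrite /sn3 updxx.
  have q4 := @runs_loop_min sn3 d.+3 d.+4 d (ltac:(lia)) (ltac:(lia)) (ltac:(lia)) (ltac:(by rewrite g3 size_nseq)).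
  have g3' : sn3 d.+3 = nseq u true by rewrite /sn3 /sn2; upd_cases.
  rewrite g3 g3' !size_nseq drop_nseqb in q4; set sn4 := upd _ d _ in q4.
  apply: runs_eq (runs_seq q1 (runs_seq rn (runs_seq q3 (runs_seq q4 (runs_seq (runs_clear _ d.+4) (runs_clear _ x)))))) _ _.
  - rewrite /sn4 /sn3 /sn2 f1 /sn /st iterS -/w; stq; fin hz.
  - have -> : size (sn d) = w by rewrite /sn /st; upd_cases; rewrite size_nseq.
    have -> : size (sn4 d.+4) = B - u by rewrite /sn4; upd_cases; rewrite size_nseq.
    have -> : size (upd sn4 d.+4 [::] x) = w by rewrite /sn4 /sn3 /sn2 f1; upd_cases; rewrite size_nseq.
    by have := hF n; rewrite -/w /T; lia.
rewrite e2 size_nseq in r3.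
apply: runs_assoc.
apply: runs_eq (runs_seq r1 (runs_seq r2 (runs_seq r3 (@runs_mov _ d.+2 x _)))) _ _.
- by lia.
- rewrite /st; stq; fin hz.
- rewrite /st; upd_cases; rewrite size_rev.
  have -> : size (s1 x) = size (s x) by rewrite /s1; upd_cases.
  have : n0 * (T + 3) <= qb M * (T + 3) by rewrite leq_mul2r vb orbT.
  rewrite {2}/T (_ : (qa M + M) * 10 + qc (M + qa M) * 10 + M * 20 + 17 + 3 =
     (qa M + M) * 10 + qc (M + qa M) * 10 + M * 20 + 20); last by lia.
  lia.
Qed.

Theorem tcomp_ok t : wft D t -> exists q, isp q /\ tok t q.
Proof.
elim: t => [i|n|a IA b IB|a IA b IB|a IA b IB|i a IA|x a IA|x a IA b IB|x a IA b IB c IC] /=.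
- by move=> hi; eexists; split; last exact: tok_V; isp_auto.
- by move=> _; eexists; split; last exact: tok_C; isp_auto.
- move=> /andP[wa wb]; have [qa [pa ha]] := IA wa; have [qb [pb hb]] := IB wb.
  by eexists; split; last exact: (tok_Add wa wb ha hb); isp_auto.
- move=> /andP[wa wb]; have [qa [pa ha]] := IA wa; have [qb [pb hb]] := IB wb.
  by eexists; split; last exact: (tok_Mul wa wb ha hb); isp_auto.
- move=> /andP[wa wb]; have [qa [pa ha]] := IA wa; have [qb [pb hb]] := IB wb.
  by eexists; split; last exact: (tok_Sub wa wb ha hb); isp_auto.
- move=> /andP[wi wa]; have [qa [pa ha]] := IA wa.
  by eexists; split; last exact: (tok_Bit wi wa ha); isp_auto.
- move=> /andP[wi wa]; have [qa [pa ha]] := IA wa.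
  by eexists; split; last exact: (tok_Cnt wi wa ha); isp_auto.
- move=> /and3P[wi wa wb]; have [qa [pa ha]] := IA wa; have [qb [pb hb]] := IB wb.
  eexists; split; last exact: (tok_Let wi wa wb ha hb pb); isp_auto.
  by apply: (@isp_comp qb) => //; isp_auto.
- move=> /and4P[wi wa wb wc]; have [qa [pa ha]] := IA wa; have [qb [pb hb]] := IB wb.
  have [qc [pc hc]] := IC wc.
  eexists; split; last exact: (tok_It wi wa wb wc ha hb hc pc); isp_auto.
  by apply: (@isp_comp qc) => //; isp_auto.
Qed.
End TermCompile.

(** * Loop programs and their polynomial running time *)

Inductive lcom :=
  | LNop | LSeq of lcom & lcom | LIf of trm & lcom & lcom | LFor of nat & lcom
  | LSet of nat & trm | LPush of nat & bool | LPop of nat | LOut of bool.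

(* Writes are truncated at the size B of stack 1, which makes every program
   polynomial; stack 0 is the output, last symbol first. *)
Fixpoint lexec c (s : store) : store := match c with
  | LNop => s
  | LSeq c1 c2 => lexec c2 (lexec c1 s)
  | LIf t c1 c2 => if tev t s != 0 then lexec c1 s else lexec c2 s
  | LFor x c => upd (foldl (fun s v => lexec c (upd s x (nseq v true))) s (iota 0 (size (s 1)))) x [::]
  | LSet x t => upd s x (nseq (minn (tev t s) (size (s 1))) true)
  | LPush x b => if size (s x) < size (s 1) then upd s x (b :: s x) else s
  | LPop x => upd s x (behead (s x))
  | LOut b => upd s 0 (b :: s 0)
  end.

Fixpoint wfl D c := match c with
  | LNop | LOut _ => true
  | LSeq c1 c2 => wfl D c1 && wfl D c2
  | LIf t c1 c2 => [&& wft D t, wfl D c1 & wfl D c2]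
  | LFor x c => (1 < x < D) && wfl D c
  | LSet x t => (1 < x < D) && wft D t
  | LPush x _ | LPop x => 1 < x < D
  end.

(** In a loop, [d] holds the rounds to come and [d.+1] the rounds done. The loop variable is reset
    from [d.+1] in every round, as the body may change it. *)
Fixpoint lcomp d c : com := match c with
  | LNop => Nop
  | LSeq c1 c2 => Seq (lcomp d c1) (lcomp d c2)
  | LIf t c1 c2 => Seq (tcomp d t) (If d (lcomp d c2) (Seq (clear d) (lcomp d c1)))
  | LFor x c => Seq (copyU 1 d d.+1) (Seq
      (Loop d (Seq (clear x) (Seq (copyU d.+1 x d.+2) (Seq (lcomp d.+2 c) (Push d.+1 true)))))
      (Seq (clear d.+1) (clear x)))
  | LSet x t => Seq (tcomp d t) (Seq (clear x) (Seq (copyU 1 d.+1 d.+2)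
      (Seq (Loop d (If d.+1 Nop (Seq (Pop d.+1) (Push x true)))) (clear d.+1))))
  | LPush x b => Seq (tcomp d (Sbt (V 1) (V x))) (If d Nop (Seq (clear d) (Push x b)))
  | LPop x => Pop x
  | LOut b => Push 0 b
  end.

Lemma updC s i j l l' : i != j -> upd (upd s i l) j l' = upd (upd s j l') i l.
Proof. by move=> h; stq. Qed.

Section Lcom.
Variable D : nat.
Hypothesis hD : 2 < D.
Let hD1 : 1 < D. Proof. exact: ltnW. Qed.

(** The counters of the enclosing loops live on stacks from [D] on; they survive a body because its
    effect commutes with any change there. *)
Lemma lexec_upd c s i l : wfl D c -> D <= i -> lexec c (upd s i l) = upd (lexec c s) i l.
Proof.
elim: c s => [|c1 I1 c2 I2|t c1 I1 c2 I2|x c IH|x t|x b|x|b] s /=.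
- by [].
- by move=> /andP[h1 h2] hi; rewrite I1 ?I2.
- move=> /and3P[ht h1 h2] hi; rewrite (tev_up hD1) //.
  by case: ifP => _; [apply: I1|apply: I2].
- move=> /andP[hx hc] hi.
  rewrite (_ : upd s i l 1 = s 1); last by upd_cases.
  rewrite [RHS]updC; last by lia.
  congr upd; move: (iota 0 _) => r; elim: r s => //= v r IHr s.
  by rewrite updC ?IH ?IHr //; lia.
- move=> /andP[hx ht] hi; rewrite (tev_up hD1) // updC; last by lia.
  by rewrite (_ : upd s i l 1 = s 1) //; upd_cases.
- move=> hx hi; rewrite (_ : upd s i l 1 = s 1); last by upd_cases.
  rewrite (_ : upd s i l x = s x); last by upd_cases.
  by case: ifP => // _; rewrite updC //; lia.
- move=> hx hi; rewrite (_ : upd s i l x = s x); last by upd_cases.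
  by rewrite updC //; lia.
- move=> _ hi; rewrite (_ : upd s i l 0 = s 0); last by upd_cases.
  by rewrite updC //; lia.
Qed.

Lemma lexec_out c s i : wfl D c -> D <= i -> lexec c s i = s i.
Proof. by move=> hw hi; rewrite -{1}(upd_id s i) lexec_upd // updxx. Qed.

(** Stack 1 is never written and all writes except to the output stop at its size, so one bound
    serves a whole run, however deeply loops are nested. *)
Lemma lexec_bnd c s M : wfl D c -> bnd D M s -> bnd D M (lexec c s).
Proof.
elim: c s => [|c1 I1 c2 I2|t c1 I1 c2 I2|x c IH|x t|x b|x|b] s //=.
- by move=> /andP[h1 h2] hb; apply: I2 => //; apply: I1.
- by move=> /and3P[ht h1 h2] hb; case: ifP => _; [apply: I1|apply: I2].
- move=> /andP[hx hc] hb; apply: (bnd_upd (M := M)) => //.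
  have : all (fun v => v <= M) (iota 0 (size (s 1))).
    apply/allP => v; rewrite mem_iota => hv; have := hb 1 (ltac:(lia)); lia.
  move: (iota 0 _) => r; elim: r s hb => //= v r IHr s hb /andP[hv hr].
  apply: IHr => //; apply: IH => //; apply: (bnd_upd (M := M)) => //.
  by rewrite size_nseq.
- move=> /andP[hx ht] hb; apply: (bnd_upd (M := M)) => //; rewrite size_nseq.
  have := hb 1 (ltac:(lia)); lia.
- move=> hx hb; case: ifP => // h; apply: (bnd_upd (M := M)) => //=.
  have := hb 1 (ltac:(lia)); lia.
- move=> hx hb; apply: (bnd_upd (M := M)) => //; rewrite size_behead.
  have := hb x (ltac:(lia)); lia.
- by move=> _ hb i hi; rewrite updE ifF; [apply: hb|lia].
Qed.

Definition lok c (q : nat -> nat) := forall d s M, D <= d -> clean d s -> bnd D M s ->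
  runs (lcomp d c) s (lexec c s) (q M).

Lemma lexec_clean c s d : wfl D c -> D <= d -> clean d s -> clean d (lexec c s).
Proof. by move=> hw hd hc i hi; rewrite lexec_out ?hc //; lia. Qed.

Lemma lok_for x c q : 1 < x < D -> wfl D c -> lok c q ->
  lok (LFor x c) (fun m => m * (q m + m * 12 + 7) + m * 20 + 20).
Proof.
move=> hx hw hq d s M hd hc hb; have hz := clean_scratch hc.
have hB := hb 1 (ltac:(lia)); set B := size (s 1) in hB.
have r1 := @runs_copyU s 1 d d.+1 (ltac:(lia)) (ltac:(lia)) (ltac:(lia)) (ltac:(by rewrite hz)).
rewrite hz cats0 -/B in r1; set s1 := upd _ _ _ in r1.
pose F n := foldl (fun s v => lexec c (upd s x (nseq v true))) s (iota 0 n).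
have FS n : F n.+1 = lexec c (upd (F n) x (nseq n true)).
  by rewrite /F -addn1 iotaD foldl_cat.
have hFz i n : D <= i -> F n i = s i.
  by move=> hi; elim: n => // n IH; rewrite FS lexec_out // -IH; upd_cases.
have hFb n : n <= M -> bnd D M (F n).
  elim: n => // n IH hn; rewrite FS; apply: lexec_bnd => //.
  by apply: (bnd_upd (M := M)) (IH _) _ _ => //; rewrite ?size_nseq; lia.
pose st n := upd (F n) d.+1 (nseq n true).
have e1 : s1 d = nseq B true by rewrite /s1 updxx.
have r2 : runs (Loop d (Seq (clear x) (Seq (copyU d.+1 x d.+2) (Seq (lcomp d.+2 c) (Push d.+1 true))))) s1
   (upd (st B) d [::]) (size (s1 d) * (q M + M * 12 + 4 + 3) + 1).
  apply: (runs_each' (st := st)); first 1 last.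
  - by rewrite /st /s1 /F /=; stq; fin hz.
  - by rewrite e1 size_nseq.
  move=> n; rewrite e1 size_nseq => hn; rewrite if_same.
  set sn := upd (st n) _ _.
  have e2 : sn x = F n x by rewrite /sn /st; upd_cases.
  have e3 : sn d.+1 = nseq n true by rewrite /sn /st; upd_cases.
  have hsx : size (F n x) <= M by apply: hFb; lia.
  have q1 := runs_clear sn x; rewrite e2 in q1.
  set sn1 := upd sn x _ in q1.
  have q2 : runs (copyU d.+1 x d.+2) sn1 (upd sn x (nseq n true)) (n * 9 + 2).
    apply: runs_eq (@runs_copyU sn1 d.+1 x d.+2 _ _ _ _) _ _; try lia.
    + rewrite /sn1 /sn /st; upd_cases; rewrite hFz; [by rewrite hz|lia].
    + by rewrite /sn1 upd2 updxx cats0 updE ifF ?e3 ?size_nseq //; lia.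
    + by rewrite /sn1 updE ifF ?e3 ?size_nseq //; lia.
  set sn2 := upd sn x _ in q2.
  have q3 : runs (lcomp d.+2 c) sn2 (lexec c sn2) (q M).
    apply: hq; first by lia.
    - move=> i hi; rewrite /sn2 /sn /st; upd_cases; rewrite hFz ?hc //; lia.
    - move=> i hi; rewrite /sn2 /sn /st; upd_cases; rewrite ?size_nseq; first by lia.
      by apply: hFb => //; lia.
  have e4 : lexec c sn2 = upd (upd (F n.+1) d.+1 (nseq n true)) d (drop n.+1 (nseq B true)).
    rewrite FS -!lexec_upd //; last by lia.
    by congr lexec; rewrite /sn2 /sn /st; stq.
  rewrite e4 in q3.
  apply: runs_eq (runs_seq q1 (runs_seq q2 (runs_seq q3 (runs_push _ _ _)))) _ _.
  - by rewrite /st; stq.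
  - by lia.
rewrite e1 size_nseq in r2.
apply: runs_eq (runs_seq r1 (runs_seq r2 (runs_seq (runs_clear _ d.+1) (runs_clear _ x)))) _ _.
- rewrite /= -/B -/(F B) /st; stq; rewrite hFz ?hz //; lia.
- have -> : size (upd (st B) d [::] d.+1) = B by rewrite /st; upd_cases; rewrite size_nseq.
  have -> : size (upd (upd (st B) d [::]) d.+1 [::] x) = size (F B x) by rewrite /st; upd_cases.
  have : size (F B x) <= M by apply: hFb => //; lia.
  rewrite -addnA; have : B * (q M + M * 12 + (4 + 3)) <= M * (q M + M * 12 + 7) by rewrite leq_mul2r hB orbT.
  rewrite -addnA; lia.
Qed.

Lemma lok_set x t q : 1 < x < D -> wft D t -> tok D t q ->
  lok (LSet x t) (fun m => q m * 9 + m * 20 + 20).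
Proof.
move=> hx hw hq d s M hd hc hb; have hz := clean_scratch hc.
have hB := hb 1 (ltac:(lia)); have hsx := hb x (ltac:(lia)).
have [v r1] := hq d s M hd hc hb; set s1 := upd _ _ _ in r1.
have r2 := runs_clear s1 x; set s2 := upd _ _ _ in r2.
have r3 := @runs_copyU s2 1 d.+1 d.+2 (ltac:(lia)) (ltac:(lia)) (ltac:(lia))
  (ltac:(by rewrite /s2 /s1; upd_cases; rewrite hz)).
have e2 : s2 1 = s 1 by rewrite /s2 /s1; upd_cases.
have e2' : s2 d.+1 = [::] by rewrite /s2 /s1; upd_cases; rewrite hz.
rewrite e2 e2' cats0 in r3; set s3 := upd s2 _ _ in r3.
have e3 : s3 d.+1 = nseq (size (s 1)) true by rewrite /s3 updxx.
have e3' : s3 d = nseq (tev t s) true by rewrite /s3 /s2 /s1; upd_cases.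
have r4 := @runs_loop_min s3 d d.+1 x (ltac:(lia)) (ltac:(lia)) (ltac:(lia)) (ltac:(by rewrite e3 size_nseq)).
rewrite e3 e3' !size_nseq drop_nseqb in r4; set s4 := upd _ x _ in r4.
apply: runs_eq (runs_seq r1 (runs_seq r2 (runs_seq r3 (runs_seq r4 (runs_clear _ d.+1))))) _ _.
- by rewrite /= /s4 /s3 /s2 /s1; stq; fin hz.
- have -> : size (s1 x) = size (s x) by rewrite /s1; upd_cases.
  have -> : size (s4 d.+1) = size (s 1) - tev t s by rewrite /s4; upd_cases; rewrite size_nseq.
  lia.
Qed.

Lemma lok_if t c1 c2 q q1 q2 : wft D t -> tok D t q -> lok c1 q1 -> lok c2 q2 ->
  lok (LIf t c1 c2) (fun m => q m * 4 + q1 m + q2 m + 3).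
Proof.
move=> hw hq h1 h2 d s M hd hc hb; have hz := clean_scratch hc.
have [v r1] := hq d s M hd hc hb; set s1 := upd _ _ _ in r1.
apply: runs_eq (runs_seq r1 (runs_if (s' := lexec (LIf t c1 c2) s) (T := q M * 3 + 1 + q1 M + q2 M) _)) _ _ => //; last by lia.
rewrite /s1 updxx /=; case e : (tev t s) => [|n] /=.
  have -> : upd s d [::] = s by rewrite -hz.1.1.1.1.1 upd_id.
  by apply: runs_eq (h2 d s M hd hc hb) _ _ => //; lia.
have := runs_clear (upd s d (true :: nseq n true)) d.
rewrite upd2 updxx -[[::]]hz.1.1.1.1.1 upd_id => rc.
apply: runs_eq (runs_seq rc (h1 d s M hd hc hb)) _ _ => //=.
by move: v; rewrite e size_nseq; lia.
Qed.

Lemma lok_push x b q : 1 < x < D -> tok D (Sbt (V 1) (V x)) q ->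
  lok (LPush x b) (fun m => q m * 4 + 4).
Proof.
move=> hx hq d s M hd hc hb; have hz := clean_scratch hc.
have [v r1] := hq d s M hd hc hb; set s1 := upd _ _ _ in r1.
apply: runs_eq (runs_seq r1 (runs_if (s' := lexec (LPush x b) s) (T := q M * 3 + 2) _)) _ _ => //; last by lia.
rewrite /s1 updxx /= -subn_gt0 in v *; case e : (_ - _) => [|n] /=.
  have -> : upd s d [::] = s by rewrite -hz.1.1.1.1.1 upd_id.
  exact: runs_eq (runs_nop _) _ _.
have := runs_clear (upd s d (true :: nseq n true)) d.
rewrite upd2 updxx -[[::]]hz.1.1.1.1.1 upd_id => rc.
apply: runs_eq (runs_seq rc (runs_push _ _ _)) _ _ => //=.
by move: v; rewrite /= e size_nseq; lia.
Qed.

Theorem lcomp_ok c : wfl D c -> exists q, isp q /\ lok c q.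
Proof.
elim: c => [|c1 I1 c2 I2|t c1 I1 c2 I2|x c IH|x t|x b|x|b] /=.
- by move=> _; exists (fun=> 0); split; [exact: isp_const|move=> d s M *; apply: runs_nop].
- move=> /andP[h1 h2]; have [q1 [p1 k1]] := I1 h1; have [q2 [p2 k2]] := I2 h2.
  exists (fun m => q1 m + q2 m); split; first exact: isp_add.
  move=> d s M hd hc hb; apply: runs_seq (k1 d s M hd hc hb) (k2 d _ M hd _ _).
    exact: lexec_clean.
  exact: lexec_bnd.
- move=> /and3P[ht h1 h2]; have [q1 [p1 k1]] := I1 h1; have [q2 [p2 k2]] := I2 h2.
  have [q [p hq]] := tcomp_ok hD1 ht.
  by eexists; split; last exact: lok_if ht hq k1 k2; isp_auto.
- move=> /andP[hx hc]; have [q [p hq]] := IH hc.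
  by eexists; split; last exact: lok_for hx hc hq; isp_auto.
- move=> /andP[hx ht]; have [q [p hq]] := tcomp_ok hD1 ht.
  by eexists; split; last exact: lok_set hx ht hq; isp_auto.
- move=> hx; have [|q [p hq]] := @tcomp_ok D hD1 (Sbt (V 1) (V x)); first by rewrite /=; lia.
  by eexists; split; last exact: lok_push hx hq; isp_auto.
- move=> hx; exists (fun=> 1); split; first exact: isp_const.
  by move=> d s M *; apply: runs_pop.
- move=> _; exists (fun=> 1); split; first exact: isp_const.
  by move=> d s M *; apply: runs_push.
Qed.

(** The polynomial on stack 1 is at once the range of loops and quantifiers and the size limit of
    writes. *)
Definition inits c k (x : seq bool) : store :=
  upd (upd store0 2 x) 1 (nseq (c * (size x).+1 ^ k) true).

Definition boundT c k := Mul (C c) (iter k (Mul (Add (V 2) (C 1))) (C 1)).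

Theorem lpolytime c k p : wfl D p -> polytime (fun x => rev (lexec p (inits c k x) 0)).
Proof.
move=> hw; have [qp [pp hp]] := lcomp_ok hw.
have wB : wft D (boundT c k).
  by rewrite /boundT /=; elim: (k) => //= n ->; rewrite hD.
have eB s : tev (boundT c k) s = c * (size (s 2)).+1 ^ k.
  by rewrite /boundT /=; congr muln; elim: (k) => //= n ->; rewrite addn1 expnS.
have [qB [pB hB]] := tcomp_ok hD1 wB.
pose M m := m + c * m.+1 ^ k.
have iM : isp M.
  apply: isp_add; first exact: isp_id.
  apply: isp_mul; first exact: isp_const.
  by apply: isp_exp; split=> //; exists 1, 1 => m; rewrite mul1n.
pose T m := qp (M m) + m.
have iT : isp T by apply: isp_add; [apply: (isp_comp pp iM)|exact: isp_id].
(* Every move reverses a stack: two moves bring the input to stack 2 unchanged, and the three at the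
   end reverse the output. *)
apply: (@com_polytime (Seq (mov 0 D) (Seq (mov D 2) (Seq (tcomp D (boundT c k)) (Seq (movU D 1)
   (Seq (lcomp D p) (Seq (mov 0 D) (Seq (mov D D.+1) (mov D.+1 0)))))))) _
   (fun m => m * 8 + 2 + qB m + (M m * 4 + 1) + qp (M m) + T m * 12 + 3)).
  do ![exact: isp_const | exact: isp_id | assumption | apply: isp_add | apply: isp_mul
     | apply: (isp_comp pp iM)].
move=> x; set n := size x.
have r1 := @runs_mov (upd store0 0 x) 0 D (ltac:(lia)); set s1 := upd _ D _ in r1.
have r2 := @runs_mov s1 D 2 (ltac:(lia)); set s2 := upd _ 2 _ in r2.
have e2 : s2 = upd store0 2 x.
  by rewrite /s2 /s1; stq; rewrite /store0 ?cats0 ?revK.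
have [|||vB r3] := hB D s2 n; first by [].
- by move=> i hi; rewrite e2; upd_cases.
- by move=> i hi; rewrite e2; upd_cases.
rewrite eB (_ : s2 2 = x) in r3 vB; last by rewrite e2.
set s3 := upd s2 _ _ in r3.
have r4 := @runs_movU s3 D 1 (ltac:(lia)); set s4 := upd _ 1 _ in r4.
have e4 : s4 = inits c k x.
  by rewrite /s4 /s3 e2 /inits; stq; rewrite size_nseq cats0.
have r5 : runs (lcomp D p) s4 (lexec p s4) (qp (M n)).
  apply: hp => //; rewrite e4 /inits.
  - by move=> i hi; upd_cases.
  - move=> i hi; upd_cases; rewrite ?size_nseq ?leq_addl ?leq_addr //.
(* The output stack is not truncated, but each unit of time adds at most one symbol to it. *)
have hout : size (lexec p s4 0) <= T n.
  have [t [rr ht]] := r5.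
  suff H c' s s' t' : run c' s s' t' -> size (s' 0) <= size (s 0) + t'.
    by have := H _ _ _ _ rr; rewrite {2}e4 /inits /T /=; lia.
  elim=> {c' s s' t' rr ht} => [s|s i b|s i|c1 c2 s u w t1 t2 _ h1 _ h2
     |i c0 c1 s u t' _ h|i c0 c1 s _|i c0 c1 s u w b l t1 t2 es _ h1 _ h2]; try lia.
  - by upd_cases; subst => /=; lia.
  - by upd_cases; subst; rewrite ?size_behead; lia.
  - move: h1; rewrite updE; case: eqP => [e|_]; last by lia.
    by subst i; rewrite es /=; lia.
set o := lexec p s4 0 in hout.
have ho : lexec p s4 0 = o by [].
have hc5 : clean D (lexec p s4).
  by apply: lexec_clean => // i hi; rewrite e4 /inits; upd_cases.
have hz := clean_scratch hc5.
have r6 := @runs_mov (lexec p s4) 0 D (ltac:(lia)); set s6 := upd _ D _ in r6.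
have e6 : s6 D = rev o by rewrite /s6 updxx hz cats0.
have r7 := @runs_mov s6 D D.+1 (ltac:(lia)); set s7 := upd _ D.+1 _ in r7.
have e7 : s7 D.+1 = o by rewrite /s7 updxx e6 revK /s6; upd_cases; rewrite hz cats0.
have r8 := @runs_mov s7 D.+1 0 (ltac:(lia)).
rewrite e6 size_rev in r7; rewrite e7 in r8; rewrite ho in r6.
have [t [rt ht]] := runs_seq r1 (runs_seq r2 (runs_seq r3 (runs_seq r4 (runs_seq r5
   (runs_seq r6 (runs_seq r7 r8)))))).
exists (upd (upd s7 D.+1 [::]) 0 (rev o ++ s7 0)), t; split=> //; split; last first.
  by rewrite updxx -e4 (_ : s7 0 = [::]) ?cats0 // /s7 /s6; upd_cases.
apply: (leq_trans ht).
have -> : size (upd store0 0 x 0) = n by [].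
have -> : size (s1 D) = n by rewrite /s1; upd_cases; rewrite size_cat size_rev /= addn0.
have -> : size (s3 D) = c * n.+1 ^ k by rewrite /s3 updxx size_nseq.
rewrite /M; lia.
Qed.
End Lcom.

(** * Simulation of a Turing machine by a loop program *)

Definition NotT a := Sbt (C 1) a.
Definition LtT a b := Sbt b a.
Definition LeT a b := NotT (Sbt a b).
Definition EqT a b := NotT (Add (Sbt a b) (Sbt b a)).
Definition AllT x t := NotT (Cnt x (NotT t)).

Definition tt t (s : store) := tev t s != 0.

Lemma ttNot a s : tt (NotT a) s = ~~ tt a s.
Proof. by rewrite /tt /=; case: (tev a s). Qed.
Lemma ttAnd a b s : tt (Mul a b) s = tt a s && tt b s.
Proof. by rewrite /tt /= muln_eq0 negb_or. Qed.
Lemma ttOr a b s : tt (Add a b) s = tt a s || tt b s.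
Proof. by rewrite /tt /= addn_eq0 negb_and. Qed.
Lemma ttLt a b s : tt (LtT a b) s = (tev a s < tev b s).
Proof. by rewrite /tt /= subn_eq0 -ltnNge. Qed.
Lemma ttLe a b s : tt (LeT a b) s = (tev a s <= tev b s).
Proof. by rewrite ttNot /tt /= subn_eq0 negbK. Qed.
Lemma ttEq a b s : tt (EqT a b) s = (tev a s == tev b s).
Proof. by rewrite ttNot /tt /= addn_eq0 !subn_eq0 negbK eqn_leq. Qed.
Lemma ttEx x t s :
  tt (Cnt x t) s = has (fun v => tt t (upd s x (nseq v true))) (iota 0 (size (s 1))).
Proof. by rewrite has_count lt0n. Qed.
Lemma ttAll x t s :
  tt (AllT x t) s = all (fun v => tt t (upd s x (nseq v true))) (iota 0 (size (s 1))).
Proof.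
rewrite ttNot ttEx -all_predC; apply: eq_all => v /=.
by rewrite ttNot negbK.
Qed.
Lemma ttBit i a s : tt (Bit i a) s = nth false (s i) (tev a s).
Proof. by rewrite /tt /=; case: nth. Qed.
Lemma ttLet x a b s : tt (Let x a b) s = tt b (upd s x (nseq (tev a s) true)).
Proof. by []. Qed.
Lemma ttC n s : tt (C n) s = (n != 0). Proof. by []. Qed.
Definition ttE := (ttAll, ttLe, ttEq, ttNot, ttAnd, ttOr, ttLt, ttBit, ttLet, ttC).

Lemma lexecIf t c1 c2 s : lexec (LIf t c1 c2) s = if tt t s then lexec c1 s else lexec c2 s.
Proof. by []. Qed.
Lemma lexecSeq c1 c2 s : lexec (LSeq c1 c2) s = lexec c2 (lexec c1 s).
Proof. by []. Qed.

Lemma for_inv x c s (I : nat -> store -> Prop) : I 0 s ->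
  (forall n s', n < size (s 1) -> I n s' -> I n.+1 (lexec c (upd s' x (nseq n true)))) ->
  exists s', lexec (LFor x c) s = upd s' x [::] /\ I (size (s 1)) s'.
Proof.
move=> h0 hS; rewrite /=; eexists; split; first by [].
have H n : n <= size (s 1) -> I n (foldl (fun s v => lexec c (upd s x (nseq v true))) s (iota 0 n)).
  elim: n => [|n IH] hn //.
  by rewrite -addn1 iotaD foldl_cat /= addn1; apply: hS => //; apply: IH; lia.
exact: H.
Qed.

Definition scode (a : option bool) : nat := match a with None => 0 | Some false => 1 | Some true => 2 end.
Definition bits2 (a : option bool) : seq bool :=
  match a with None => [:: false; false] | Some b => [:: true; b] end.
Definition enc2 (l : seq (option bool)) : seq bool := flatten (map bits2 l).

Lemma size_enc2 l : size (enc2 l) = 2 * size l.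
Proof. by elim: l => // [[b|]] l /=; rewrite /enc2 /= => ->; lia. Qed.

Lemma scode_inj : injective scode.
Proof. by move=> [[]|] [[]|]. Qed.

(* Stacks 30, 31 hold the tape left and right of the head (two bits per cell),
   32 the scanned symbol and 33 the state, both in unary. *)
Section Simulation.
Variable M : TM.

Definition sidx (q : tm_st M) : nat := index q (enum (tm_st M)).
Lemma sidx_inj : injective sidx.
Proof.
move=> q q' /(congr1 (nth q (enum (tm_st M)))).
by rewrite !nth_index ?mem_enum.
Qed.
Lemma sidx_lt q : sidx q < #|tm_st M|.
Proof. by rewrite cardE index_mem mem_enum. Qed.

Lemma sidx_le q n : #|tm_st M| + 2 <= n -> sidx q <= n.
Proof. by move=> h; apply: leq_trans (ltnW (sidx_lt q)) (leq_trans (leq_addr 2 _) h). Qed.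
Lemma le2 n : #|tm_st M| + 2 <= n -> 2 <= n.
Proof. exact/leq_trans/leq_addl. Qed.

Definition symT X := Mul (Bit X (C 0)) (Add (C 1) (Bit X (C 1))).
Definition push2 X (a : option bool) :=
  match bits2 a with [:: b; b'] => LSeq (LPush X b') (LPush X b) | _ => LNop end.
(** An exhausted stack yields a blank without a test: [Bit] is 0 beyond the end, and 0 is the code
    of a blank. *)
Definition pop2 X := LSeq (LSet 32 (symT X)) (LSeq (LPop X) (LPop X)).

Definition branchL (q : tm_st M) (a : option bool) : lcom :=
  if tm_halt q then LNop else
  let: (q', w, d) := tm_delta q a in
  LSeq (LSet 33 (C (sidx q')))
    (if d then LSeq (push2 30 w) (pop2 31)
     else LIf (V 30) (LSeq (push2 31 w) (pop2 30)) (LSet 32 (C (scode w)))).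

Definition stepL : lcom :=
  foldr (fun p rest => LIf (Mul (EqT (V 33) (C (sidx p.1))) (EqT (V 32) (C (scode p.2))))
     (branchL p.1 p.2) rest) LNop (enum {: tm_st M * option bool}).

Definition simrep (s : store) (cf : config M) :=
  [/\ s 30 = enc2 (cfg_left cf), s 31 = enc2 (cfg_right cf),
      s 32 = nseq (scode (cfg_cur cf)) true & s 33 = nseq (sidx (cfg_st cf)) true].

Definition frame (l : seq nat) (s s' : store) := forall i, i \notin l -> s' i = s i.

(** The codes of states and symbols are injective, so all tests before the entry of [(q, a)] in the
    unrolled table fail. *)
Lemma stepL_branch s q a : s 33 = nseq (sidx q) true -> s 32 = nseq (scode a) true ->
  lexec stepL s = lexec (branchL q a) s.
Proof.
move=> h3 h2; rewrite /stepL.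
have : (q, a) \in enum {: tm_st M * option bool} by rewrite mem_enum.
elim: (enum _) => // p l IH; rewrite [foldr _ _ _]/= lexecIf !ttE [tev _ _]/= [tev _ _]/= [tev (V 32) _]/= [tev (C (scode _)) _]/= h3 h2 !size_nseq.
rewrite in_cons; case: eqP => [<- _|hne /= /IH <-]; first by rewrite !eqxx.
rewrite ifF //; apply/negP => /andP[/eqP e1 /eqP e2]; apply: hne.
by case: p e1 e2 => q' a' /= /sidx_inj -> /scode_inj ->.
Qed.

Lemma push2_ok X a s : 1 < X -> size (s X) + 2 <= size (s 1) ->
  lexec (push2 X a) s = upd s X (bits2 a ++ s X).
Proof.
move=> hX hs; have H b b' : lexec (LSeq (LPush X b') (LPush X b)) s = upd s X [:: b, b' & s X].
  rewrite /= (_ : size (s X) < size (s 1) = true); last by lia.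
  rewrite updxx /= (_ : upd _ _ _ 1 = s 1); last by upd_cases.
  rewrite (_ : _ < _ = true); last by lia.
  by rewrite upd2.
by rewrite /push2; case: a => [b|] /=; rewrite -H.
Qed.

Lemma pop2_ok X l s : X != 32 -> 1 < X -> s X = enc2 l -> 2 <= size (s 1) ->
  lexec (pop2 X) s = upd (upd s 32 (nseq (scode (head None l)) true)) X (enc2 (behead l)).
Proof.
move=> hX h1 hs hB; rewrite /pop2 !lexecSeq /=.
have -> : minn (nth false (s X) 0 * (1 + nth false (s X) 1)) (size (s 1)) = scode (head None l).
  by rewrite hs; case: l {hs} => [|[[]|] l] /=; lia.
stq; rewrite ?updE ?eqxx // hs.
by case: l {hs} => [|[b|] l].
Qed.

Lemma stepL_ok s cf : simrep s cf -> #|tm_st M| + 2 <= size (s 1) ->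
  2 * (size (cfg_left cf) + size (cfg_right cf)) + 2 <= size (s 1) ->
  simrep (lexec stepL s) (tm_step cf) /\ frame [:: 30; 31; 32; 33] s (lexec stepL s).
Proof.
case: cf => q l a r [/= h0 h1 h2 h3] hB hc; have hB2 := le2 hB.
rewrite (stepL_branch h3 h2) /branchL /tm_step.
case: (tm_halt q); first by split.
case: (tm_delta q a) => [[q' w] d]; rewrite lexecSeq.
set s1 := lexec (LSet _ _) s.
have e1 : s1 = upd s 33 (nseq (sidx q') true).
  by rewrite /s1 /= (minn_idPl _) //; apply: sidx_le.
case: d.
  rewrite lexecSeq push2_ok //; last by rewrite e1 !updE /= h0 size_enc2; lia.
  rewrite (@pop2_ok 31 r) //; try by rewrite e1 !updE /=.
  split; last by move=> i hi; rewrite !inE in hi; rewrite e1; upd_cases.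
  by case: r h1 {hc} => [|b r] h1; split; rewrite e1 !updE /= ?h0.
have et : tt (V 30) s1 = (l != [::]) by rewrite e1 /tt /= !updE /= h0 size_enc2; case: (l).
rewrite lexecIf et e1; case: l h0 hc {et} => [|b l] h0 hc.
  have -> : lexec (LSet 32 (C (scode w))) (upd s 33 (nseq (sidx q') true)) =
     upd (upd s 33 (nseq (sidx q') true)) 32 (nseq (scode w) true).
    by rewrite /= (minn_idPl _) // updE /=; case: w => [[]|] /=; lia.
  rewrite (_ : forall (a b : store), (if [::] != [::] :> seq (option bool) then a else b) = b) //.
  split; last by move=> i hi; rewrite !inE in hi; upd_cases.
  by split; rewrite !updE.
rewrite (_ : forall (x y : store), (if b :: l != [::] then x else y) = x) // lexecSeq push2_ok //; last first.
  by move: hc; rewrite !updE /= h1 size_enc2 /=; lia.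
rewrite (@pop2_ok 30 (b :: l)) //; try by rewrite !updE /=.
split; last by move=> i hi; rewrite !inE in hi; upd_cases.
by split; rewrite !updE /= ?h1.
Qed.

Definition simInit X : lcom :=
  LSeq (LSet 33 (C (sidx (@tm_start M))))
  (LSeq (LSet 32 (Mul (NotT (NotT (V X))) (Add (C 1) (Bit X (C 0)))))
  (LSeq (LSet 30 (C 0)) (LSeq (LSet 31 (C 0))
  (LFor 34 (LIf (LtT (V 34) (Sbt (V X) (C 1)))
     (LIf (Bit X (Sbt (Sbt (V X) (C 1)) (V 34))) (push2 31 (Some true)) (push2 31 (Some false)))
     LNop))))).

Lemma simInit_ok X s : 1 < X < 30 -> #|tm_st M| + 2 <= size (s 1) ->
  2 * size (s X) <= size (s 1) ->
  simrep (lexec (simInit X) s) (tm_init M (s X)) /\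
  frame [:: 30; 31; 32; 33; 34] s (lexec (simInit X) s).
Proof.
move=> hX hB hs; set y := s X in hs *; rewrite /simInit !lexecSeq.
have hB2 := le2 hB.
set s1 := lexec (LSet 31 _) _.
have fr : frame [:: 30; 31; 32; 33] s s1.
  by move=> i hi; rewrite !inE in hi; rewrite /s1 /=; upd_cases.
have eX : s1 X = y by rewrite fr // !inE; lia.
have e1 : s1 1 = s 1 by rewrite fr.
have e30 : s1 30 = [::] by rewrite /s1 /= !updE /= min0n.
have e31 : s1 31 = [::] by rewrite /s1 /= !updE /= min0n.
have e33 : s1 33 = nseq (sidx (@tm_start M)) true.
  by rewrite /s1 /= !updE /= (minn_idPl _) //; apply: sidx_le.
have e32 : s1 32 = nseq (scode (cfg_cur (tm_init M y))) true.
  rewrite /s1 /= !updE /= !ifF; try lia.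
  rewrite -/y; congr nseq; case: (y) hs => [|[] y'] /= hs; lia.
set z := behead y; have ez : size z = size y - 1 by rewrite /z size_behead subn1.
(* The tail [z] of the input is pushed starting from its end: after [n] rounds the stack holds the
   last [n] bits, and rounds beyond its length do nothing. *)
have [||s' [-> [fr' e]]] := @for_inv 34 (LIf (LtT (V 34) (Sbt (V X) (C 1)))
     (LIf (Bit X (Sbt (Sbt (V X) (C 1)) (V 34))) (push2 31 (Some true)) (push2 31 (Some false)))
     LNop) s1 (fun n s' => frame [:: 31; 34] s1 s' /\
       s' 31 = enc2 [seq Some b | b <- drop (size z - n) z]).
- by split=> //; rewrite subn0 drop_size.
- move=> n s' hn [fr' e]; set s2 := upd s' 34 _.
  have fX : s2 X = y by rewrite /s2 updE ifF ?fr' // ?inE; lia.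
  have f34 : s2 34 = nseq n true by rewrite /s2 updxx.
  have f31 : s2 31 = s' 31 by rewrite /s2 updE.
  have f1 : s2 1 = s 1 by rewrite /s2 updE /= fr'.
  rewrite lexecIf !ttE /= f34 size_nseq fX -ez; case: ltnP => hm; last first.
    rewrite f31 e; split; first by move=> i hi; rewrite /s2 updE; move: (hi); rewrite !inE => /norP[_ /negbTE ->]; apply: fr'.
    have [-> ->] : size z - n.+1 = 0 /\ size z - n = 0 by lia.
    by [].
  have hb : nth false y (size z - n) = nth false z (size z - n.+1).
    by rewrite /z nth_behead; congr nth; rewrite -/z; lia.
  have -> : (if (nth false y (size z - n) : nat) != 0 then lexec (push2 31 (Some true)) s2
     else lexec (push2 31 (Some false)) s2) =
     lexec (push2 31 (Some (nth false z (size z - n.+1)))) s2 by rewrite hb; case: nth.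
  rewrite push2_ok // f31 ?e; last first.
    by rewrite f1 size_enc2 size_map size_drop; lia.
  split.
    move=> i; rewrite !inE /s2 !updE => /norP[h31 h34]; rewrite (negbTE h31) (negbTE h34).
    by apply: fr'; rewrite !inE negb_or h31.
  rewrite updxx (drop_nth false (n := size z - n.+1)); last by lia.
  by rewrite (_ : (size z - n.+1).+1 = size z - n) //; lia.
have ez0 : size z - size (s1 1) = 0 by rewrite e1; lia.
rewrite ez0 drop0 in e.
split; last first.
  move=> i; rewrite !inE updE => /norP[h30 /norP[h31 /norP[h32 /norP[h33 h34]]]].
  rewrite (negbTE h34) fr' ?inE ?negb_or ?h31 ?h34 //.
  by rewrite fr // !inE !negb_or h30 h31 h32 h33.
have e0 : simrep s1 (Config (cfg_st (tm_init M y)) [::] (cfg_cur (tm_init M y)) [::]).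
  by split=> //; case: (y) e33.
case: e0 => a0 _ a2 a3.
by split; rewrite updE /= ?e ?fr' // ?a0 ?a2 ?a3 //; rewrite /z; case: (y).
Qed.
End Simulation.

(* M halts on z after T steps with head on a 1, never leaving the first S cells *)
Definition accb (M : TM) (z : seq bool) (S T : nat) : bool :=
  [&& all (fun t => size (cfg_left (tm_run t (tm_init M z))) < S) (iota 0 T.+1),
      tm_halt (cfg_st (tm_run T (tm_init M z))) &
      cfg_cur (tm_run T (tm_init M z)) == Some true].

Section Acc.
Variable M : TM.

Definition chkL := LIf (LeT (Mul (C 2) (V 38)) (V 30)) (LSet 37 (C 1)) LNop.
Definition simAcc X := LSeq (simInit M X) (LSeq (LSet 37 (C 0)) (LSeq chkL
  (LFor 35 (LIf (LtT (V 35) (V 36)) (LSeq (stepL M) chkL) LNop)))).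
Definition haltT := foldr (fun q r => Add (Mul (C (tm_halt q)) (EqT (V 33) (C (sidx q)))) r)
  (C 0) (enum (tm_st M)).
Definition accT := Mul (NotT (V 37)) (Mul haltT (EqT (V 32) (C 2))).

Lemma haltT_ok s (q : tm_st M) : s 33 = nseq (sidx q) true -> tt haltT s = tm_halt q.
Proof.
move=> h; rewrite /haltT.
have : q \in enum (tm_st M) by rewrite mem_enum.
have : uniq (enum (tm_st M)) by exact: enum_uniq.
elim: (enum _) => // p l IH /= /andP[hp hu].
rewrite !ttE /= h size_nseq in_cons; case: eqP => [e0 _|hne /= hq]; first subst p.
  rewrite eqxx andbT; case: (tm_halt q) => //=.
  apply/negbTE; elim: l hp {IH hu} => //= r l IH; rewrite in_cons => /norP[hr /IH].
  rewrite !ttE /= h size_nseq => /negbTE ->; rewrite orbF negb_and; apply/orP; right.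
  by apply/negP => /eqP /sidx_inj e; rewrite e eqxx in hr.
rewrite (IH hu hq) (_ : (sidx q == sidx p) = false) ?andbF //.
by apply/negP => /eqP /sidx_inj.
Qed.

Lemma tape_size z t : size (cfg_left (tm_run t (tm_init M z))) +
  size (cfg_right (tm_run t (tm_init M z))) <= size z + t.
Proof.
elim: t => [|t IH]; first by case: z => //= b z; rewrite size_map; lia.
rewrite /tm_run iterS -/(tm_run t _); move: IH.
case: (tm_run t _) => q l a r /=; rewrite /tm_step.
case: (tm_halt q) => /=; first by lia.
case: (tm_delta q a) => [[q' w] []].
  by case: r => [|b r] /=; lia.
by case: l => [|b l] /=; lia.
Qed.

Lemma chkL_ok s : 0 < size (s 1) -> exists s', lexec chkL s = s' /\ frame [:: 37] s s' /\
  tt (V 37) s' = tt (V 37) s || (2 * size (s 38) <= size (s 30)).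
Proof.
move=> hB; eexists; split; first by [].
rewrite /chkL lexecIf ttE [tev (Mul _ _) _]/= [tev (V 30) _]/=.
case: leqP => h; last by rewrite orbF; split.
rewrite /= (minn_idPl _) //; split.
  by move=> i hi; rewrite !inE in hi; upd_cases.
by rewrite orbT.
Qed.

Lemma simAcc_ok X s : 1 < X < 30 -> #|tm_st M| + 2 <= size (s 1) ->
  2 * (size (s X) + size (s 36)) + 2 <= size (s 1) ->
  tt accT (lexec (simAcc X) s) = accb M (s X) (size (s 38)) (size (s 36)) /\
  frame [:: 30; 31; 32; 33; 34; 35; 37] s (lexec (simAcc X) s).
Proof.
move=> hX hB hc; set y := s X in hc *; set S := size (s 38); set T := size (s 36) in hc *.
rewrite /simAcc !lexecSeq.
have [|r1 fr1] := @simInit_ok M X s hX hB; first by rewrite -/y; lia.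
rewrite -/y in r1.
set s1 := lexec (simInit M X) s in r1 fr1 *.
set s2 := lexec (LSet 37 _) s1.
have e2 : s2 = upd s1 37 [::] by rewrite /s2 /= min0n.
have b2 : size (s2 1) = size (s 1) by rewrite e2 updE /= fr1.
have [|s3 [-> [fr3 v3]]] := @chkL_ok s2; first by rewrite b2; lia.
(* The flag on stack 37 remembers that the head has been outside the first [S] cells. The loop has
   more rounds than needed; those after round [T] are idle, whence [minn n T] below. *)
pose lost n := has (fun t => S <= size (cfg_left (tm_run t (tm_init M y)))) (iota 0 n.+1).
have hS2 : s2 38 = s 38 by rewrite e2 updE /= fr1.
pose I n s' := [/\ frame [:: 30; 31; 32; 33; 34; 35; 37] s s',
   simrep s' (tm_run (minn n T) (tm_init M y)) & tt (V 37) s' = lost (minn n T)].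
have simf (u u' : store) cf : simrep u cf -> frame [:: 37] u u' -> @simrep M u' cf.
  by move=> [a1 a2 a3 a4] f; split; rewrite f.
have I0 : I 0 s3.
  split.
  - move=> i hi; rewrite fr3; last by move: hi; rewrite !inE; lia.
    rewrite e2 updE ifF; last by move: hi; rewrite !inE; lia.
    by rewrite fr1 //; move: hi; rewrite !inE; lia.
  - rewrite min0n; apply: (simf s2) fr3; rewrite e2.
    by apply: (simf s1) => // i hi; rewrite !inE in hi; upd_cases.
  - have -> : tt (V 37) s3 = (2 * S <= size (s1 30)) by rewrite v3 hS2 e2 /tt.
    rewrite min0n /lost /= orbF.
    by have [-> _ _ _] := r1; rewrite size_enc2 leq_mul2l.
have [n s' hn [fr sr lo]|s' [-> [fr sr lo]]] := for_inv (x := 35)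
  (c := LIf (LtT (V 35) (V 36)) (LSeq (stepL M) chkL) LNop) I0.
  set s4 := upd s' 35 _.
  have f4 : frame [:: 35] s' s4 by move=> i hi; rewrite !inE in hi; rewrite /s4; upd_cases.
  have sr4 : simrep s4 (tm_run (minn n T) (tm_init M y)).
    by case: sr => a1 a2 a3 a4; split; rewrite f4.
  have b4 : size (s4 1) = size (s 1) by rewrite f4 // fr.
  have T4 : size (s4 36) = T by rewrite f4 // fr.
  have S4 : size (s4 38) = S by rewrite f4 // fr.
  rewrite lexecIf ttE [tev (V 35) _]/= [tev (V 36) _]/= T4 {1}/s4 updxx size_nseq.
  case: ltnP => hnT; last first.
    have e : minn n.+1 T = minn n T by lia.
    split; rewrite ?e //.
      move=> i hi; rewrite [lexec _ _]/= f4 ?fr //; move: hi; rewrite !inE; lia.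
  rewrite lexecSeq.
  have en : minn n T = n by lia.
  have en1 : minn n.+1 T = n.+1 by lia.
  rewrite en in sr4 lo.
  have [||sr5 f5] := @stepL_ok M s4 _ sr4.
  - by rewrite b4.
  - by have := tape_size y n; rewrite b4; lia.
  set s5 := lexec (stepL M) s4 in sr5 f5 *.
  have [|s6 [-> [fr6 v6]]] := @chkL_ok s5; first by rewrite f5 // b4; lia.
  split; rewrite ?en1.
  - move=> i hi; rewrite fr6; last by move: hi; rewrite !inE; lia.
    rewrite f5; last by move: hi; rewrite !inE; lia.
    by rewrite f4 ?fr //; move: hi; rewrite !inE; lia.
  - exact: (simf s5) sr5 fr6.
  - have a : s5 37 = s' 37 by rewrite f5 // f4.
    have -> : tt (V 37) s6 = tt (V 37) s' || (2 * S <= size (s5 30)).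
      by rewrite v6 (f5 38) // S4 /tt /= a.
    rewrite lo /lost -[in RHS](addn1 n.+1) iotaD has_cat; congr orb.
    by rewrite /= orbF add0n; have [-> _ _ _] := sr5; rewrite size_enc2 leq_mul2l.
have eT : minn (size (s3 1)) T = T.
  by rewrite fr3 // b2; apply/minn_idPr; lia.
rewrite eT in sr lo.
split; last first.
  by move=> i hi; rewrite updE ifF ?fr //; move: hi; rewrite !inE; lia.
have [h0 h1 h2 h3] := sr.
rewrite /accT !ttE (@haltT_ok _ (cfg_st (tm_run T (tm_init M y)))); last by rewrite updE.
rewrite /accb; congr (_ && (_ && _)).
  have -> : tt (V 37) (upd s' 35 [::]) = lost T by rewrite -lo.
  rewrite /lost -all_predC.
  by apply: eq_all => t /=; rewrite ltnNge.
rewrite /= updE /= h2 size_nseq.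
by case: (cfg_cur _) => [[]|].
Qed.

Lemma wfl_stepL : wfl 60 (stepL M).
Proof.
rewrite /stepL; elim: (enum _) => // [[q a]] l IH; rewrite [foldr _ _ _]/=.
rewrite -[wfl 60 _]/(wft 60 _ && (wfl 60 _ && wfl 60 _)) IH andbT /= /branchL.
case: tm_halt => //; case: tm_delta => [[q' w] []] /=; by case: w => [[]|].
Qed.
Lemma wfl_simAcc X : 1 < X < 30 -> wfl 60 (simAcc X).
Proof. by move=> hX; rewrite /= wfl_stepL; lia. Qed.
Lemma wft_accT : wft 60 accT.
Proof. by rewrite /=; rewrite andbT /haltT; elim: (enum _). Qed.

Lemma run_halted t n (c : config M) : tm_halt (cfg_st (tm_run t c)) -> t <= n ->
  tm_run n c = tm_run t c.
Proof.
move=> hh hn; rewrite -(subnKC hn) /tm_run addnC iterD -/(tm_run t c).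
elim: (n - t) => //= m ->; move: hh; case: (tm_run t c) => q l a r /= hh.
by rewrite /tm_step hh.
Qed.

Lemma left_size z t : size (cfg_left (tm_run t (tm_init M z))) <= t.
Proof.
elim: t => [|t IH]; first by case: z.
rewrite /tm_run iterS -/(tm_run t _); move: IH.
case: (tm_run t _) => q l a r /=; rewrite /tm_step.
case: (tm_halt q) => /=; first by lia.
case: (tm_delta q a) => [[q' w] []]; first by case: r => [|b r] /=; lia.
by case: l => [|b l] /=; lia.
Qed.
End Acc.

(** * Self-delimiting encodings, the clock function and the verifier *)

Definition enc1 (x : seq bool) : seq bool := flatten [seq [:: true; b] | b <- x] ++ [:: false; false].

Lemma enc_list1 x : enc_list [:: x] = enc1 x.
Proof. by rewrite /enc_list /= cats0. Qed.
Lemma enc_list2 x w : enc_list [:: x; w] = enc1 x ++ enc1 w.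
Proof. by rewrite /enc_list /= cats0. Qed.
Lemma enc_list_cat l l' : enc_list (l ++ l') = enc_list l ++ enc_list l'.
Proof. by rewrite /enc_list map_cat flatten_cat. Qed.
Lemma size_enc1 x : size (enc1 x) = 2 * size x + 2.
Proof. by rewrite size_cat /=; congr addn; elim: x => //= b x ->; lia. Qed.

(** The continuation bits mark the end of the code, so the input can be recovered from any extension
    of it by a witness. *)
Lemma enc1_inj x x' u u' : enc1 x ++ u = enc1 x' ++ u' -> x = x' /\ u = u'.
Proof.
elim: x x' => [|b x IH] [|b' x'] //=.
  by rewrite /enc1 /= => -[].
by rewrite /enc1 /= -/(enc1 x) -/(enc1 x') => -[-> /IH[-> ->]].
Qed.

(** Validity speaks of single positions only, so that a bounded quantifier over bits can express
    it. *)
Definition valid1 (y : seq bool) m := [/\ size y = 2 * m + 2,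
  forall i, i < m -> nth false y (2 * i), nth false y (2 * m) = false &
  nth false y (2 * m).+1 = false].

Lemma valid1P y m : valid1 y m <-> exists x, y = enc1 x /\ size x = m.
Proof.
split.
  elim: m y => [|m IH] y [hs h1 h2 h3].
    exists [::]; split=> //.
    by case: y hs h2 h3 {h1} => [|a [|b [|c y]]] //= _ -> ->.
  case: y hs h1 h2 h3 => [|a [|b y]] hs h1 h2 h3; try by exfalso; move: hs => /=; lia.
  have [|x [-> hx]] := IH y.
    split; first by move: hs => /=; lia.
    - move=> i hi; have := h1 i.+1 (ltac:(lia)).
      by rewrite (_ : 2 * i.+1 = (2 * i).+2) //; lia.
    - by move: h2; rewrite (_ : 2 * m.+1 = (2 * m).+2) //; lia.
    - by move: h3; rewrite (_ : 2 * m.+1 = (2 * m).+2) //; lia.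
  by exists (b :: x); rewrite /= hx; split=> //; have := h1 0 isT => /= ->.
move=> [x [-> <-]]; elim: x => [|b x [hs h1 h2 h3]].
  by split.
have em k : 2 * k.+1 = (2 * k).+2 by lia.
split; first by rewrite size_enc1.
- by move=> [|i] hi //; rewrite em; apply: h1.
- by rewrite [size _]/= em.
- by rewrite [size _]/= em.
Qed.

Definition powT t k := iter k (Mul t) (C 1).
Lemma tev_pow t k s : tev (powT t k) s = tev t s ^ k.
Proof. by elim: k => //= k ->; rewrite expnS. Qed.
Lemma wft_pow D t k : wft D t -> wft D (powT t k).
Proof. by move=> h; elim: k => //= k ->; rewrite h. Qed.

(* stack 2 from position V 6 on is an encoded string of length V m *)
Definition partT m := Mul (AllT 5 (Add (LeT (V m) (V 5)) (Bit 2 (Add (V 6) (Mul (C 2) (V 5))))))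
  (Mul (NotT (Bit 2 (Add (V 6) (Mul (C 2) (V m)))))
       (NotT (Bit 2 (Add (C 1) (Add (V 6) (Mul (C 2) (V m))))))).

(** The padding by [false] mirrors [Bit], which reads [false] beyond the end of a stack. *)
Lemma partT_ok m s : m \in [:: 3; 4] -> size (s m) <= size (s 1) ->
  reflect (valid1 (take (2 * size (s m) + 2) (drop (size (s 6)) (s 2) ++ nseq (2 * size (s m) + 2) false))
     (size (s m))) (tt (partT m) s).
Proof.
move=> hm hB.
have em u v : upd s 5 u v = if v == 5 then u else s v by [].
have hm5 : (m == 5) = false by move: hm; rewrite !inE; lia.
set y := take _ _.
have hy : size y = 2 * size (s m) + 2.
  by rewrite size_take size_cat size_nseq; case: ltnP => //; lia.
have ny i : i < 2 * size (s m) + 2 -> nth false y i = nth false (s 2) (size (s 6) + i).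
  move=> hi; rewrite nth_take // nth_cat size_drop nth_drop; case: ltnP => // h.
  by rewrite nth_nseq [in RHS]nth_default ?if_same //; lia.
rewrite /partT ttAnd ttAll ttAnd !ttNot !ttBit.
apply: (iffP and3P) => [[/allP h1 h2 h3]|[_ h1 h2 h3]]; split=> //.
- move=> i hi; rewrite ny; last by lia.
  have : i \in iota 0 (size (s 1)) by rewrite mem_iota; lia.
  move/h1; rewrite !ttE /= !em hm5 /= size_nseq; case/orP => //; lia.
- rewrite ny; [exact: negbTE h2|lia].
- rewrite ny; [rewrite addnS; exact: negbTE h3|lia].
- apply/allP => i _; rewrite !ttE /= !em hm5 /= size_nseq.
  case: leqP => //= hi; rewrite -ny; [exact: h1|lia].
- by rewrite [tev _ _]/= -ny ?h2 //; lia.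
- by rewrite [tev _ _]/= add1n -addnS -ny ?h3 //; lia.
Qed.

Lemma ttExP x t s : reflect (exists v, v < size (s 1) /\ tt t (upd s x (nseq v true))) (tt (Cnt x t) s).
Proof.
rewrite ttEx; apply: (iffP hasP) => [[v]|[v [hv ht]]].
  by rewrite mem_iota add0n => /andP[_ hv] ht; exists v.
by exists v => //; rewrite mem_iota.
Qed.

Lemma polytime_ext f g : (forall x, f x = g x) -> polytime f -> polytime g.
Proof.
move=> e [M [c [k h]]]; exists M, c, k => x; have [t [h1 [h2 h3]]] := h x.
by exists t; rewrite -e.
Qed.

Lemma partT0 m n s : m \in [:: 3; 4] -> s m = nseq n true -> n <= size (s 1) ->
  2 * n + 2 + size (s 6) <= size (s 2) ->
  tt (partT m) s <-> exists x, take (2 * n + 2) (drop (size (s 6)) (s 2)) = enc1 x /\ size x = n.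
Proof.
move=> hm hn hB hs.
have := @partT_ok m s hm; rewrite hn size_nseq => /(_ hB) h.
rewrite -valid1P; move: h; rewrite takel_cat; last by rewrite size_drop; lia.
by split; move/h.
Qed.

Definition validT := Cnt 3 (Mul (EqT (V 2) (Add (Mul (C 2) (V 3)) (C 2))) (Let 6 (C 0) (partT 3))).

Lemma validT_ok s : size (s 2) < size (s 1) -> tt validT s <-> exists x, s 2 = enc1 x.
Proof.
move=> hB; split.
  move/ttExP => [n [hn]]; rewrite ttAnd ttEq ttLet /= updE /= updxx size_nseq => /andP[/eqP hs].
  rewrite -/(tt _ _) (@partT0 _ n) //= ?updE //=; try lia.
  by move=> [x [e _]]; exists x; rewrite -e drop0 take_oversize // hs; lia.
move=> [x e]; apply/ttExP; exists (size x).
rewrite ttAnd ttEq ttLet /= updE /= updxx size_nseq e size_enc1 eqxx /=.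
split; first by move: hB; rewrite e size_enc1; lia.
rewrite -/(tt _ _) (@partT0 _ (size x)) //= ?updE //=; try by move: hB; rewrite ?e size_enc1; lia.
by exists x; rewrite e drop0 take_oversize // size_enc1.
Qed.

Lemma inits2 c k x : inits c k x 2 = x. Proof. by []. Qed.
Lemma inits1 c k x : inits c k x 1 = nseq (c * (size x).+1 ^ k) true. Proof. by []. Qed.

Lemma bound_ge c k n : 0 < c -> 0 < k -> n < c * n.+1 ^ k.
Proof.
move=> hc hk; apply: (@leq_trans (n.+1 ^ 1)); first by rewrite expn1.
by apply: leq_trans (leq_pmull _ hc); rewrite leq_pexp2l.
Qed.

(** The clock computes this function. For [0 < c] a nonempty value certifies that [y] is an
    encoding, and the length of the value certifies that the tape which holds it is long. *)
Definition clockf c k (y : seq bool) : seq bool :=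
  if `[< exists x, y = enc1 x >] then nseq (c * (size y).+1 ^ k) true else [::].

Theorem clockf_poly c k : 0 < c -> 0 < k -> polytime (clockf c k).
Proof.
move=> hc hk.
have := @lpolytime 60 isT c k (LIf validT (LFor 3 (LOut true)) LNop) isT.
apply: polytime_ext => y; rewrite lexecIf /clockf.
have hv := @validT_ok (inits c k y).
rewrite inits1 inits2 size_nseq in hv.
have {}hv := hv (bound_ge _ hc hk).
case: (asboolP _) => [/hv ->|hn]; last by case: ifP => // /hv.
have [||s' [-> e]] := @for_inv 3 (LOut true) (inits c k y)
   (fun n s => s 0 = nseq n true) => //.
  by move=> n s' _ e /=; rewrite !updE /= e.
by rewrite updE /= e inits1 size_nseq rev_nseqb.
Qed.

Section Verifier.
Variables (c0 k0 : nat).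

Definition pairT := Cnt 3 (Cnt 4 (Mul (EqT (V 2) (Add (Add (Mul (C 2) (V 3)) (C 2)) (Add (Mul (C 2) (V 4)) (C 2))))
  (Mul (Let 6 (C 0) (partT 3)) (Mul (Let 6 (Add (Mul (C 2) (V 3)) (C 2)) (partT 4))
   (LeT (V 4) (Mul (C c0) (powT (Add (V 3) (C 1)) k0))))))).

Lemma pairT_ok s : size (s 2) < size (s 1) -> tt pairT s <->
  exists x w, s 2 = enc_list [:: x; w] /\ size w <= c0 * (size x).+1 ^ k0.
Proof.
move=> hB; split.
  move/ttExP => [n [hn /ttExP [m [hm]]]].
  rewrite !ttAnd ttEq !ttLet ttLe [tev (C 0) _]/= [tev (V 2) _]/= [tev (Add _ _) _]/= [tev (Mul (C c0) _) _]/=.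
  rewrite [tev (V 4) _]/= [tev (Add (Mul _ _) _) _]/= tev_pow [tev (Add _ _) _]/= !updE /= !size_nseq addn1.
  case/and4P => /eqP hs.
  rewrite (@partT0 3 n) //= ?updE //=; try lia.
  move=> [x [ex hx]].
  rewrite (@partT0 4 m) //= ?updE //= ?size_nseq; try lia.
  move=> [w [ew hw]] hle; exists x, w; rewrite enc_list2 hw hx; split=> //.
  rewrite -(cat_take_drop (2 * n + 2) (s 2)); congr (_ ++ _); first by rewrite -ex drop0.
  by rewrite -ew take_oversize // size_drop; lia.
move=> [x [w [e hle]]]; rewrite enc_list2 in e.
have hs : size (s 2) = 2 * size x + 2 + (2 * size w + 2) by rewrite e size_cat !size_enc1.
apply/ttExP; exists (size x); split; first by lia.
apply/ttExP; exists (size w); split; first by rewrite updE /=; lia.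
rewrite !ttAnd ttEq !ttLet ttLe [tev (C 0) _]/= [tev (V 2) _]/= [tev (Add _ _) _]/= [tev (Mul (C c0) _) _]/=.
rewrite [tev (V 4) _]/= [tev (Add (Mul _ _) _) _]/= tev_pow [tev (Add _ _) _]/= !updE /= !size_nseq addn1.
apply/and4P; split=> //; first by rewrite hs.
- rewrite (@partT0 3 (size x)) //= ?updE //=; try lia.
  by exists x; rewrite drop0 e take_size_cat // size_enc1.
- rewrite (@partT0 4 (size w)) //= ?updE //= ?size_nseq; try lia.
  exists w; rewrite e drop_size_cat ?size_enc1 // take_oversize // size_enc1 //.
Qed.

(** The witness area of a grid can be filled at will, so ill-formed pairs and witnesses that are too
    long have to be rejected by the verifier itself. This test precedes the simulation of the given
    decider of [W]. *)
Theorem verifier_inP (W : language) : in_P W ->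
  in_P (fun z => (exists x w, z = enc_list [:: x; w] /\ size w <= c0 * (size x).+1 ^ k0) /\ W z).
Proof.
move=> [f [[M [cM [kM hM]]] hf]].
(* With enough time for the decider and more cells than steps, the bounds of [accb] are no
   restriction. *)
have hacc z S T : cM * (size z).+1 ^ kM <= T -> T < S -> accb M z S T = `[< W z >].
  move=> hT hS; have [t [ht [hh ho]]] := hM z.
  rewrite /accb (run_halted hh (leq_trans ht hT)) hh.
  rewrite (_ : all _ _ = true); last first.
    apply/allP => u; rewrite mem_iota => hu; apply: leq_ltn_trans (left_size _ _ _) _; lia.
  move: ho; rewrite /tm_output /=; case: (asboolP (W z)) => [/(proj1 (hf z)) ->|/(proj2 (hf z)) ->].
    by case: (cfg_cur _) => [[]|].
  by case: (cfg_cur _) => [[]|].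
pose T := Mul (C cM) (powT (Add (V 2) (C 1)) kM).
pose P := LIf pairT (LSeq (LSet 36 T) (LSeq (LSet 38 (Add T (C 1))) (LSeq (simAcc M 2)
   (LIf (accT M) (LOut true) (LOut false))))) (LOut false).
(* Large enough for twice the input length plus simulated time and for the state codes, so that the
   simulation is never truncated. *)
pose cB := 2 * cM + #|tm_st M| + 10.
have hw : wfl 60 P.
  rewrite /P -[wfl _ _]/[&& wft 60 pairT, [&& wft 60 T, wft 60 T && true, wfl 60 (simAcc M 2) & (wft 60 (accT M)) && true] & true].
  rewrite wfl_simAcc // wft_accT /= !wft_pow //.
exists (fun z => rev (lexec P (inits cB kM.+1 z) 0)); split.
  exact: (@lpolytime 60 isT cB kM.+1 P hw).
move=> z; set s := inits cB kM.+1 z.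
have hB : size (s 1) = cB * (size z).+1 ^ kM.+1 by rewrite /s inits1 size_nseq.
have hzB : size z < size (s 1) by rewrite hB bound_ge // /cB; lia.
have hp : tt pairT s <-> exists x w, z = enc_list [:: x; w] /\ size w <= c0 * (size x).+1 ^ k0.
  exact: pairT_ok hzB.
rewrite /P lexecIf.
suff H : tt pairT s -> rev (lexec (LSeq (LSet 36 T) (LSeq (LSet 38 (Add T (C 1))) (LSeq (simAcc M 2)
   (LIf (accT M) (LOut true) (LOut false))))) s 0) = [:: `[< W z >]].
  split=> [[/hp hpt hW]|hn].
    by rewrite hpt H //; congr cons; apply/asboolP.
  case: ifP => // hpt; rewrite H //; congr cons; apply/asboolP => hW.
  by apply: hn; split=> //; apply/hp.
move=> _; rewrite 3!lexecSeq.
set t0 := cM * (size z).+1 ^ kM.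
have eT u : u 2 = z -> tev T u = t0.
  by move=> e; rewrite /T [tev _ _]/= tev_pow /= e addn1.
have ht0 : 2 * (size z + t0) + #|tm_st M| + 4 <= size (s 1).
  rewrite hB expnS /cB /t0; set e := _ ^ kM.
  have he : 0 < e by rewrite expn_gt0.
  nia.
have e1 : lexec (LSet 36 T) s = upd s 36 (nseq t0 true).
  by rewrite -[LHS]/(upd s 36 (nseq (minn (tev T s) (size (s 1))) true)) eT // (minn_idPl _) //; lia.
rewrite e1; set s1 := upd s 36 _.
have e2 : lexec (LSet 38 (Add T (C 1))) s1 = upd s1 38 (nseq (t0 + 1) true).
  rewrite -[LHS]/(upd s1 38 (nseq (minn (tev T s1 + 1) (size (s1 1))) true)) eT // (minn_idPl _) //.
  by rewrite (_ : s1 1 = s 1) //; lia.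
rewrite e2; set s2 := upd s1 38 _.
have [|||ha fr] := @simAcc_ok M 2 s2 => //.
- by rewrite (_ : s2 1 = s 1) //; lia.
- rewrite (_ : s2 1 = s 1) // (_ : s2 2 = z) // (_ : s2 36 = nseq t0 true) // size_nseq; lia.
rewrite lexecIf ha hacc; last 2 first.
- by rewrite (_ : s2 2 = z) // (_ : s2 36 = nseq t0 true) // size_nseq.
- by rewrite (_ : s2 36 = nseq t0 true) // (_ : s2 38 = nseq (t0 + 1) true) // !size_nseq; lia.
have e0 : lexec (simAcc M 2) s2 0 = [::] by rewrite fr.
rewrite (_ : s2 2 = z) //.
by case: (asboolP _) => _; rewrite -[lexec (LOut _) _]/(upd _ 0 (_ :: _)) updxx e0.
Qed.
End Verifier.

(** * Forbidden patterns of bounded size *)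

Definition deg (T : finType) (e : rel T) (v : T) : nat := #|[pred w | e v w]|.

(* u ~ a ~ b ~ v where the pair (deg a, deg b) encodes the type tau: the pairs
   (40 + tau, 36 - tau), tau < 29, are pairwise incomparable. *)
Definition garc (T : finType) (e : rel T) (tau : nat) (u v : T) : bool :=
  [exists a, exists b, [&& [&& e u a, e a b & e b v], 40 + tau <= deg e a, 36 - tau <= deg e b,
     (u != b) && (v != a) & (2 <= deg e u) && (2 <= deg e v)]].

Section Support.
Variables (T : finType) (e : rel T).
Hypothesis esym : symmetric e.

Definition within (W : seq T) : rel T := fun x y => [&& x \in W, y \in W & e x y].
Definition cnn (W : seq T) := {in W &, forall x y, connect (within W) x y}.
(** The maps under which patterns are searched: injective, preserving edges but not non-edges. *)
Definition homW (T' : finType) (e' : rel T') (W : seq T) (g : T -> T') :=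
  {in W &, injective g} /\ {in W &, forall x y, e x y -> e' (g x) (g y)}.

Lemma homW_sub (T' : finType) (e' : rel T') (W W' : seq T) (g : T -> T') : {subset W <= W'} -> homW e' W' g -> homW e' W g.
Proof.
by move=> h [h1 h2]; split=> x y hx hy; [apply: h1|apply: h2]; apply: h.
Qed.

Lemma within_sub (W W' : seq T) x y : {subset W <= W'} -> connect (within W) x y -> connect (within W') x y.
Proof.
move=> h; apply: connect_sub => a b /and3P[ha hb hab].
by apply: connect1; rewrite /within !h.
Qed.

Lemma within_sym W x y : connect (within W) x y = connect (within W) y x.
Proof.
apply: sym_connect_sym => a b; by rewrite /within esym; case: (a \in W); case: (b \in W).
Qed.

Lemma cnn_root W r : r \in W -> {in W, forall x, connect (within W) r x} -> cnn W.
Proof.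
by move=> hr h x y hx hy; apply: connect_trans (h y hy); rewrite within_sym h.
Qed.

Lemma cnn_cat W1 W2 r : cnn W1 -> cnn W2 -> r \in W1 -> r \in W2 -> cnn (W1 ++ W2).
Proof.
move=> h1 h2 r1 r2; apply: (@cnn_root _ r); first by rewrite mem_cat r1.
move=> x; rewrite mem_cat => /orP[hx|hx].
  by apply: (@within_sub W1); [move=> z; rewrite mem_cat => ->|apply: h1].
by apply: (@within_sub W2); [move=> z; rewrite mem_cat orbC => ->|apply: h2].
Qed.

(** A star with [t] leaves witnesses the lower bound and is carried along by every such map; no
    finite piece of the graph could witness an upper bound. *)
Lemma deg_supp t v : t <= deg e v -> exists W, [/\ size W <= t.+1, v \in W, cnn W &
  forall (T' : finType) (e' : rel T') (g : T -> T'), homW e' W g -> t <= deg e' (g v)].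
Proof.
move=> ht; set N := take t (enum [pred w | e v w]).
have sN : size N = t by rewrite size_takel // -cardE.
have hN x : x \in N -> e v x by move=> /mem_take; rewrite mem_enum.
exists (v :: N); split.
- by rewrite /= sN.
- by rewrite mem_head.
- apply: (@cnn_root _ v); first by rewrite mem_head.
  move=> x; rewrite inE => /orP[/eqP -> //|hx]; apply: connect1.
  by rewrite /within mem_head inE hx orbT hN.
- move=> T' e' g [gi ge]; rewrite /deg -sN -(size_map g N).
  have uN : uniq N by rewrite take_uniq // enum_uniq.
  have ug : uniq (map g N).
    rewrite map_inj_in_uniq // => x y hx hy; apply: gi; by rewrite inE ?hx ?hy orbT.
  rewrite -(card_uniqP ug); apply: subset_leq_card; apply/subsetP => y /mapP[x hx ->].
  by rewrite inE; apply: ge; rewrite ?mem_head ?inE ?hx ?orbT ?hN.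
Qed.

Lemma edge_supp u v : e u v -> cnn [:: u; v].
Proof.
move=> h; apply: (@cnn_root _ u); first by rewrite mem_head.
move=> x; rewrite !inE => /orP[/eqP -> //|/eqP ->]; apply: connect1.
by rewrite /within !inE !eqxx orbT.
Qed.

Lemma arc_supp tau u v : tau < 29 -> garc e tau u v -> exists W,
  [/\ size W <= 100, u \in W, v \in W, cnn W &
   forall (T' : finType) (e' : rel T') (g : T -> T'), homW e' W g -> garc e' tau (g u) (g v)].
Proof.
move=> htau /existsP[a /existsP[b /and5P[/and3P[ua ab bv] da db /andP[ub va] /andP[du dv]]]].
have [Wa [sa ia ca ha]] := deg_supp da; have [Wb [sb ib cb hb]] := deg_supp db.
have [Wu [su iu cu hu]] := deg_supp du; have [Wv [sv iv cv hv]] := deg_supp dv.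
have c1 : cnn (Wb ++ [:: b; v]).
  by apply: (@cnn_cat _ _ b) => //; [apply: edge_supp|rewrite inE eqxx].
have c2 : cnn ((Wb ++ [:: b; v]) ++ Wv).
  by apply: (@cnn_cat _ _ v) => //; rewrite mem_cat !inE eqxx !orbT.
have c3 : cnn ([:: a; b] ++ ((Wb ++ [:: b; v]) ++ Wv)).
  apply: (@cnn_cat _ _ b) => //; [exact: edge_supp|by rewrite !inE eqxx orbT|].
  by rewrite !mem_cat ib.
have c4 : cnn (Wa ++ ([:: a; b] ++ ((Wb ++ [:: b; v]) ++ Wv))).
  by apply: (@cnn_cat _ _ a) => //; rewrite mem_cat !inE eqxx.
have c5 : cnn ([:: u; a] ++ (Wa ++ ([:: a; b] ++ ((Wb ++ [:: b; v]) ++ Wv)))).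
  apply: (@cnn_cat _ _ a) => //; [exact: edge_supp|by rewrite !inE eqxx orbT|].
  by rewrite !mem_cat ia.
have c6 : cnn (Wu ++ ([:: u; a] ++ (Wa ++ ([:: a; b] ++ ((Wb ++ [:: b; v]) ++ Wv))))).
  by apply: (@cnn_cat _ _ u) => //; rewrite mem_cat !inE eqxx.
eexists; split; last 2 first.
- exact: c6.
- set W' := _ ++ _ => T' e' g hg.
  have ge : {in W' &, forall x y, e x y -> e' (g x) (g y)} by case: hg.
  have gi : {in W' &, injective g} by case: hg.
  have iW x : [|| x \in Wa, x \in Wb, x \in Wu, x \in Wv | x \in [:: u; a; b; v]] -> x \in W'.
    rewrite /W' !mem_cat !inE.
    case/or4P => [->|->|->|/orP[->|/or4P[->|->|->|->]]]; rewrite ?orbT //.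
  have [uW aW bW vW] : [/\ u \in W', a \in W', b \in W' & v \in W'].
    by split; apply: iW; rewrite !inE eqxx !orbT.
  apply/existsP; exists (g a); apply/existsP; exists (g b).
  rewrite !ge // (ha _ _ _ (homW_sub _ hg)); last by move=> x hx; apply: iW; rewrite hx.
  rewrite (hb _ _ _ (homW_sub _ hg)); last by move=> x hx; apply: iW; rewrite hx !orbT.
  rewrite (hu _ _ _ (homW_sub _ hg)); last by move=> x hx; apply: iW; rewrite hx !orbT.
  rewrite (hv _ _ _ (homW_sub _ hg)) /=; last by move=> x hx; apply: iW; rewrite hx !orbT.
  rewrite andbT; apply/andP; split.
    by apply: contraNneq ub => /gi -> //.
  by apply: contraNneq va => /gi -> //.
(* The four stars have at most [41 + tau], [37 - tau], 3 and 3 vertices and the three edges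
   contribute 6, at most 90 in all. *)
- rewrite !size_cat [size [:: _; _]]/=; move: sa sb su sv htau; clear; move: (size Wa) (size Wb) (size Wu) (size Wv) => p q r w h1 h2 h3 h4 h5.
rewrite /=; lia.
- by rewrite mem_cat iu.
- by rewrite !mem_cat iv !orbT.
Qed.

Definition atom := (nat * nat * nat)%type.
Definition sat1 (T' : finType) (e' : rel T') (x : nat -> T') (a : atom) :=
  garc e' a.1.1 (x a.1.2) (x a.2).
Definition avars (l : seq atom) : seq nat := flatten [seq [:: a.1.2; a.2] | a <- l].

(** Every atom shares a variable with what precedes it; this makes the support of a query connected,
    as the forbidden graphs have to be. *)
Fixpoint linked (vs : seq nat) (l : seq atom) : bool :=
  if l is a :: l' then ((a.1.2 \in vs) || (a.2 \in vs)) && linked [:: a.1.2, a.2 & vs] l'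
  else true.

Lemma atoms_supp (x : nat -> T) l : forall vs W0, linked vs l -> all (fun a => a.1.1 < 29) l ->
  cnn W0 -> {in vs, forall i, x i \in W0} -> all (sat1 e x) l ->
  exists W, [/\ size W <= size W0 + 100 * size l, {subset W0 <= W}, cnn W,
    {in vs ++ avars l, forall i, x i \in W} &
    forall (T' : finType) (e' : rel T') (g : T -> T'), homW e' W g -> all (sat1 e' (g \o x)) l].
Proof.
elim: l => [|[[tau i] j] l IH] vs W0 /=.
  by move=> _ _ h1 h2 _; exists W0; split=> //; [lia|rewrite cats0].
move=> /andP[hl hl'] /andP[ht hts] h1 h2 /andP[ha has].
have [W1 [s1 i1 j1 c1 g1]] := arc_supp ht ha.
have cW : cnn (W0 ++ W1).
  case/orP: hl => hi; first by apply: (@cnn_cat _ _ (x i)) => //; apply: h2.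
  by apply: (@cnn_cat _ _ (x j)) => //; apply: h2.
have [||W [sW subW cW' iW gW]] := IH [:: i, j & vs] (W0 ++ W1) hl' hts cW.
- move=> k; rewrite !inE mem_cat => /or3P[/eqP ->|/eqP ->|/h2 ->] //; rewrite ?i1 ?j1 ?orbT //.
- by [].
exists W; split=> //.
- by apply: leq_trans sW _; rewrite size_cat; move: s1; rewrite /=; lia.
- by move=> z hz; apply: subW; rewrite mem_cat hz.
- move=> k hk; apply: iW; move: hk; rewrite mem_cat /= !inE mem_cat -/(avars l).
  by case/orP => [->|/or3P[->|->|->]]; rewrite ?orbT.
- move=> T' e' g hg; rewrite gW // andbT; apply: g1; apply: homW_sub hg.
  by move=> z hz; apply: subW; rewrite mem_cat hz orbT.
Qed.
End Support.

(** * The finite family of connected forbidden graphs *)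

Section Local.
Variable C : finType.

Record query := Query {
  qat : seq atom;
  qne : seq (nat * nat);
  qcol : (nat -> C) -> Prop }.

Definition qmatch (T : finType) (e : rel T) (col : T -> C) (q : query) (x : nat -> T) :=
  [/\ all (sat1 e x) (qat q), {in qne q, forall p, x p.1 <> x p.2} & qcol q (col \o x)].

(** The bound 8 comes from the largest query, the square [Qsq] with four arcs and four labels; with
    at most 100 vertices per atom a match is supported by 800 vertices. The last clause confines the
    color condition to the pattern. *)
Definition wfq (q : query) := [/\ if qat q is a :: l then linked [:: a.1.2; a.2] l else false,
  all (fun a => a.1.1 < 29) (qat q), size (qat q) <= 8,
  {in qne q, forall p, (p.1 \in avars (qat q)) && (p.2 \in avars (qat q))} &
  forall c c', {in avars (qat q), c =1 c'} -> qcol q c -> qcol q c'].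

Definition bad (Qs : query -> Prop) (T : finType) (e : rel T) (col : T -> C) :=
  exists q x, Qs q /\ qmatch e col q x.

Lemma qmatch_supp (T : finType) (e : rel T) col q x : symmetric e -> wfq q -> qmatch e col q x ->
  exists W, [/\ size W <= 800, W != [::], cnn e W &
  forall (T' : finType) (e' : rel T') (col' : T' -> C) g, homW e e' W g ->
    {in W, forall z, col' (g z) = col z} -> qmatch e' col' q (g \o x)].
Proof.
move=> es [hl ht hs hn hc] [ha hne hcol].
case: q hl ht hs hn hc ha hne hcol => [[|a l] ne qc] //= hl /andP[ht hts] hs hn hc /andP[ha has] hne hcol.
have [W1 [s1 i1 j1 c1 g1]] := arc_supp es ht ha.
have [||W [sW subW cW iW gW]] := atoms_supp (x := x) es hl hts c1.
- by move=> k; rewrite !inE => /orP[/eqP ->|/eqP ->].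
- by [].
exists W; split.
- apply: leq_trans sW _; apply: (@leq_trans (100 + 100 * 7)) => //.
  by apply: leq_add => //; rewrite leq_mul2l.
- by move: (subW _ i1); case: (W).
- exact: cW.
move=> T' e' col' g hg hcol'.
have gi : {in W &, injective g} by case: hg.
split=> /=.
- rewrite gW // andbT; apply: g1; exact: homW_sub subW hg.
- move=> p hp /gi; move/andP: (hn p hp) => [h1 h2].
  by move=> /(_ (iW _ h1) (iW _ h2)); apply: hne.
- apply: hc hcol => i hi /=; rewrite hcol' //; exact: iW hi.
Qed.

Definition mkg m (p : {ffun 'I_m * 'I_m -> bool} * {ffun 'I_m -> C}) : cgraph C :=
  @CGraph C m (fun i j => p.1 (i, j)) p.2.

Lemma In_mem (A : eqType) (x : A) s : List.In x s <-> x \in s.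
Proof.
elim: s => //= y s IH; rewrite inE; split.
  by case=> [->|/IH ->]; rewrite ?eqxx ?orbT.
by case/orP => [/eqP ->|/IH h]; [left|right].
Qed.

(** The family consists of all bad connected graphs on at most 800 vertices. A bad match already
    lives in the subgraph induced on its support, which belongs to the family; conversely an
    embedding carries matches along. *)
Theorem bad_local (Qs : query -> Prop) : (forall q, Qs q -> wfq q) -> exists Fs : seq (cgraph C),
  (forall F, List.In F Fs -> cg_simple F /\ cg_connected F) /\
  forall n (e : rel 'I_n) (col : 'I_n -> C), symmetric e -> irreflexive e ->
   ((forall F, List.In F Fs -> ~ cg_embeds F e col) <-> ~ bad Qs e col).
Proof.
move=> hQ.
pose ok (F : cgraph C) := [/\ cg_simple F, cg_connected F & bad Qs (@cg_edge C F) (@cg_col C F)].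
pose Fs := List.flat_map (fun m => List.map (@mkg m)
  (filter (fun p => `[< ok (mkg p) >]) (enum {: {ffun 'I_m * 'I_m -> bool} * {ffun 'I_m -> C}}))) (iota 0 801).
have FsP F : List.In F Fs -> ok F.
  move/List.in_flat_map => [m [_ /List.in_map_iff [p [<-]]]].
  by move/In_mem; rewrite mem_filter => /andP[/asboolP].
exists Fs; split; first by move=> F /FsP [].
move=> n e col es ei; split.
  move=> hno [q [x [hq hm]]].
  have [W [sW W0 cW hW]] := qmatch_supp es (hQ q hq) hm.
  set U := undup W; have mU z : (z \in U) = (z \in W) by rewrite mem_undup.
  have [r hr] : exists r, r \in W by case: (W) W0 => // r ? _; exists r; rewrite mem_head.
  have sU : 0 < size U by rewrite -has_predT; apply/hasP; exists r; rewrite ?mU.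
  case em : (size U) sU => [//|k] _.
  pose h (i : 'I_k.+1) := nth r U i.
  pose g (z : 'I_n) : 'I_k.+1 := inord (index z U).
  have hg z : z \in W -> h (g z) = z.
    move=> hz; rewrite /h /g inordK ?nth_index ?mU // -em index_mem mU //.
  have hU i : h i \in W by rewrite -mU mem_nth // em.
  have hinj : injective h.
    move=> i j /eqP; rewrite /h nth_uniq ?em ?undup_uniq // => /eqP; exact: val_inj.
  pose eF := [ffun p : 'I_k.+1 * 'I_k.+1 => e (h p.1) (h p.2)].
  pose cF := [ffun i : 'I_k.+1 => col (h i)].
  pose F := mkg (eF, cF).
  have eFE i j : @cg_edge C F i j = e (h i) (h j) by rewrite /= ffunE.
  apply: (hno F); last first.
    exists h; split=> //; split; first by move=> i j; rewrite eFE.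
    by move=> i; rewrite /= ffunE.
  have okF : ok F.
    split.
    - by split=> [i j|i]; rewrite !eFE // es.
    - split=> // i j.
      have gh i' : g (h i') = i' by apply: hinj; rewrite hg.
      have : connect (within e W) (h i) (h j) by apply: cW.
      rewrite -{2}(gh i) -{2}(gh j).
      move/connectP => [p hp ->]; elim: p (h i) hp => [|z p IH] y //= /andP[/and3P[hy hz hyz] hp].
      apply: connect_trans (IH z hp); apply: connect1.
      by rewrite eFE !hg.
    - exists q, (g \o x); split=> //; apply: hW.
        split; first by move=> y z hy hz /(congr1 h); rewrite !hg.
        by move=> y z hy hz hyz; rewrite eFE !hg.
      by move=> z hz; rewrite /= ffunE hg.
  apply/List.in_flat_map; exists k.+1; split.
    apply/In_mem; rewrite mem_iota -em /= add0n ltnS (leq_trans (size_undup _)) //.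
  apply/List.in_map_iff; exists (eF, cF); split=> //.
  by apply/In_mem; rewrite mem_filter mem_enum andbT; apply/asboolP.
move=> hnb F hF [h [hi [he hc]]]; apply: hnb.
have [[Fs1 Fs2] _ [q [x [hq hm]]]] := FsP F hF.
have [W [_ _ _ hW]] := qmatch_supp Fs1 (hQ q hq) hm.
exists q, (h \o x); split=> //; apply: hW => //.
by split=> [y z _ _ /hi|y z _ _ /he].
Qed.
End Local.

(** * Tableaux *)

(** Used to read strings off a row, both from the labels of a graph and from the tape symbols of a
    tableau: once blank, the row stays blank. *)
Lemma mono_seq (a : nat -> option bool) S :
  (forall j, j.+1 < S -> a j = None -> a j.+1 = None) ->
  size (pmap a (iota 0 S)) <= S /\
  forall j, j < S -> a j = if j < size (pmap a (iota 0 S))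
     then Some (nth false (pmap a (iota 0 S)) j) else None.
Proof.
elim: S => [|S IH] H; first by [].
have [|h1 h2] := IH; first by move=> j hj; apply: H; lia.
rewrite -addn1 iotaD pmap_cat add0n /=; set z := pmap a (iota 0 S) in h1 h2 *.
case ea : (a S) => [b|] /=; last first.
  rewrite cats0; split; first by lia.
  move=> j hj; have [hjS|hjS] := ltnP j S; first exact: h2.
  have -> : j = S by lia.
  by rewrite ifF // ltnNge h1.
have hz : size z = S.
  apply/eqP; rewrite eqn_leq h1 leqNgt; apply/negP => hlt.
  have hS : S.-1.+1 = S by lia.
  have : a S.-1 = None.
    by rewrite h2; [rewrite ifF //; apply/negbTE; rewrite -leqNgt; lia|lia].
  by move/H; rewrite hS ea => /(_ (ltnSn _)).
rewrite size_cat /= hz; split; first by lia.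
move=> j hj; rewrite hj nth_cat hz; have [hjS|hjS] := ltnP j S.
  by rewrite h2 // hz hjS.
have -> : j = S by lia.
by rewrite subnn.
Qed.

Section Tableau.
Variable M : TM.

Definition cell : finType := (option bool * option (tm_st M))%type.

Definition own (m : cell) : bool :=
  if m.2 is Some q then tm_halt q && (m.1 == Some true) else false.

Definition act (m : cell) : option (tm_st M * option bool * bool) :=
  if m.2 is Some q then (if tm_halt q then None else Some (tm_delta q m.1)) else None.

(** The missing left neighbour marks cell 0, where a left move stays put. A head that moves right
    out of the last column simply disappears. *)
Definition phi (l : option cell) (m : cell) (r : option cell) : cell :=
  match m.2 with
  | Some q => match act m with
     | None => m
     | Some (q', w, d) => (w, if d then None else if l is None then Some q' else None)
     end
  | None => (m.1,
     if obind act l is Some (q', _, true) then Some q'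
     else if obind act r is Some (q', _, false) then Some q' else None)
  end.

Definition cellof (c : config M) (j : nat) : cell :=
  (nth None (rev (cfg_left c) ++ cfg_cur c :: cfg_right c) j,
   if j == size (cfg_left c) then Some (cfg_st c) else None).

Definition lft (row : nat -> cell) j := if j is j'.+1 then Some (row j') else None.
Definition rgt S (row : nat -> cell) j := if j.+1 < S then Some (row j.+1) else None.

Lemma nth_zip (l : seq (option bool)) a r j : nth None (rev l ++ a :: r) j =
  if j < size l then nth None l (size l - j.+1) else if j == size l then a else nth None r (j - (size l).+1).
Proof.
rewrite nth_cat size_rev; case: ltnP => h; first by rewrite nth_rev.
case: eqP => [->|hne]; first by rewrite subnn.
by rewrite (_ : j - size l = (j - (size l).+1).+1) //; lia.
Qed.

(** The only influence from beyond column [S] would be a head entering from there, and the head is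
    inside by hypothesis. *)
Lemma phi_ok (c : config M) S j : size (cfg_left c) < S -> j < S ->
  phi (lft (cellof c) j) (cellof c j) (rgt S (cellof c) j) = cellof (tm_step c) j.
Proof.
case: c => q l a r /= hS hj.
have hcur : cellof (Config q l a r) (size l) = (a, Some q).
  by rewrite /cellof /= nth_zip ltnn eqxx.
have hoth i : i != size l -> cellof (Config q l a r) i =
   (nth None (rev l ++ a :: r) i, None).
  by move=> h; rewrite /cellof /= (negbTE h).
have actoth i : i != size l -> act (cellof (Config q l a r) i) = None.
  by move=> h; rewrite hoth.
have [ej|nj] := eqVneq j (size l).
  rewrite ej hcur /phi /act /= /tm_step; case hq : (tm_halt q); first by rewrite hcur.
  case: (tm_delta q a) => [[q' w] []].
    case: r {hcur hoth actoth} => [|b r]; rewrite /cellof /= nth_zip /= ltnSn subnn /=;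
    by rewrite ltn_eqF.
  case: l ej hS {hcur hoth actoth} => [|b l] ej hS; first by [].
  by rewrite /cellof /= nth_zip /= ltnNge leqnSn /= gtn_eqF //= subnn.
rewrite (hoth _ nj) /phi /=.
have al : obind act (lft (cellof (Config q l a r)) j) =
   if (j == (size l).+1) && ~~ tm_halt q then Some (tm_delta q a) else None.
  case: (j) => [|i] //=; rewrite eqSS; case: eqP => [->|/eqP h] /=; last exact: actoth.
  by rewrite hcur /act /=; case: tm_halt.
have ar : obind act (rgt S (cellof (Config q l a r)) j) =
   if (j.+1 == size l) && ~~ tm_halt q then Some (tm_delta q a) else None.
  rewrite /rgt; case: ltnP => h /=; last by rewrite ifF //; lia.
  case: eqP => [->|/eqP h'] /=; last exact: actoth.
  by rewrite hcur /act /=; case: tm_halt.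
rewrite al ar /tm_step; case hq : (tm_halt q); first by rewrite !andbF hoth.
rewrite !andbT; case ed : (tm_delta q a) => [[q' w] d].
case: d ed => ed.
  have e1 : cellof (match r with
      | [::] => Config q' (w :: l) None [::] | b :: r' => Config q' (w :: l) b r' end) j =
      (nth None (rev l ++ a :: r) j, if j == (size l).+1 then Some q' else None).
    rewrite /cellof; case: r {hcur hoth actoth al ar} => [|b r] /=; congr pair; rewrite !nth_zip /=.
    - case: (ltngtP j (size l)) nj => //= h _; first by rewrite ltnS ltnW // (_ : (size l).+1 - j.+1 = (size l - j.+1).+1) //; lia.
      by rewrite ltnS leqNgt h /= !nth_nil if_same.
    - case: (ltngtP j (size l)) nj => //= h _; first by rewrite ltnS ltnW // (_ : (size l).+1 - j.+1 = (size l - j.+1).+1) //; lia.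
      rewrite ltnS leqNgt h /=; case: eqP => [->|h2]; first by rewrite subnn.
      by rewrite (_ : j - (size l).+1 = (j - (size l).+2).+1) //; lia.
  rewrite e1; case: eqP => //= _; case: eqP => //.
have -> : (match (if j == (size l).+1 then Some (q', w, false) else None) with
   | Some (q'0, _, true) => Some q'0
   | _ => if (if j.+1 == size l then Some (q', w, false) else None) is Some (q'0, _, false) then Some q'0 else None end) =
   if j.+1 == size l then Some q' else None.
  by case: (j == _); case: (j.+1 == _).
case: l nj hS hcur hoth actoth al ar => [|b l] nj hS hcur hoth actoth al ar.
  rewrite /cellof /=; congr pair; last by move: nj => /= /negbTE ->.
  by case: (j) nj.
rewrite /cellof /= !nth_zip /= eqSS; congr pair.
case: (ltngtP j (size l)) => h.
- by rewrite ltnS ltnW // (_ : (size l).+1 - j.+1 = (size l - j.+1).+1) //; lia.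
- have nj' : j != (size l).+1 by exact: nj.
  rewrite ltnS leqNgt h /= (negbTE nj').
  by rewrite (_ : j - (size l).+1 = (j - (size l).+2).+1) //; lia.
- by rewrite h ltnSn subnn.
Qed.

Definition tabl (z : seq bool) S T (m : nat -> nat -> cell) :=
  (forall j, j < S -> m 0 j = (if j < size z then Some (nth false z j) else None,
      if j == 0 then Some (@tm_start M) else None)) /\
  (forall t j, t < T -> j < S -> m t.+1 j = phi (lft (m t) j) (m t j) (rgt S (m t) j)).

Lemma cellof_init z j : cellof (tm_init M z) j =
  (if j < size z then Some (nth false z j) else None, if j == 0 then Some (@tm_start M) else None).
Proof.
case: z => [|b z]; rewrite /cellof /=; congr pair.
  by case: j => //= j; rewrite nth_nil.
case: j => //= j; rewrite ltnS; case: ltnP => h; first by rewrite (nth_map false).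
by rewrite nth_default ?size_map.
Qed.

Lemma lft_ext S (r r' : nat -> cell) j : j < S -> (forall i, i < S -> r i = r' i) -> lft r j = lft r' j.
Proof. by case: j => // j hj h /=; rewrite h //; lia. Qed.
Lemma rgt_ext S (r r' : nat -> cell) j : (forall i, i < S -> r i = r' i) -> rgt S r j = rgt S r' j.
Proof. by rewrite /rgt => h; case: ifP => // hj; rewrite h. Qed.

Lemma phi_nohead l m r : (forall c, l = Some c -> c.2 = None) -> m.2 = None ->
  (forall c, r = Some c -> c.2 = None) -> (phi l m r).2 = None.
Proof.
rewrite /phi => hl -> hr /=.
have -> : obind act l = None by case: l hl => //= c /(_ c erefl); rewrite /act => ->.
by have -> : obind act r = None by case: r hr => //= c /(_ c erefl); rewrite /act => ->.
Qed.

(** A head that leaves the [S] columns never comes back, because headless rows have headless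
    successors. An accepting head in a tableau thus belongs to a genuine run that stayed inside. *)
Lemma tabl_run z S T m : 0 < S -> tabl z S T m -> forall t, t <= T ->
  ((forall t', t' <= t -> size (cfg_left (tm_run t' (tm_init M z))) < S) /\
   (forall j, j < S -> m t j = cellof (tm_run t (tm_init M z)) j)) \/
  (forall j, j < S -> (m t j).2 = None).
Proof.
move=> hS [h0 hs]; elim=> [|t IH] ht.
  left; split.
    by move=> t'; rewrite leqn0 => /eqP ->; case: (z).
  by move=> j hj; rewrite h0 // cellof_init.
have [[h1 h2]|h] := IH (ltnW ht); last first.
  right=> j hj; rewrite hs //; apply: phi_nohead; rewrite ?h //.
    by case: (j) hj => //= i hi c [<-]; apply: h; lia.
  by rewrite /rgt; case: ifP => // hj' c [<-]; apply: h.
have e j : j < S -> m t.+1 j = cellof (tm_run t.+1 (tm_init M z)) j.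
  move=> hj; rewrite hs // (lft_ext hj h2) (rgt_ext _ h2) h2 //.
  by rewrite phi_ok //; apply: h1.
have [hlt|hge] := ltnP (size (cfg_left (tm_run t.+1 (tm_init M z)))) S.
  left; split=> // t'; rewrite leq_eqVlt => /orP[/eqP ->|] //; exact: h1.
right=> j hj; rewrite e // /cellof /= ltn_eqF //; lia.
Qed.

Lemma tabl_acc z S T m : 0 < S -> tabl z S T m -> (exists j, j < S /\ own (m T j)) -> accb M z S T.
Proof.
move=> hS ht [j [hj ho]].
have [[h1 h2]|h] := tabl_run hS ht (leqnn T); last by move: ho; rewrite /own h.
rewrite /accb; apply/andP; split.
  by apply/allP => t; rewrite mem_iota => ht'; apply: h1; lia.
move: ho; rewrite h2 // /own /cellof /=; case: eqP => // -> /andP[-> /=].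
by rewrite nth_zip ltnn eqxx.
Qed.

Lemma acc_tabl z S T : accb M z S T ->
  tabl z S T (fun t j => cellof (tm_run t (tm_init M z)) j) /\
  exists j, j < S /\ own (cellof (tm_run T (tm_init M z)) j).
Proof.
case/and3P => /allP h1 h2 h3; split.
  split=> [j hj|t j ht hj]; first exact: cellof_init.
  by rewrite phi_ok //; apply: h1; rewrite mem_iota; lia.
exists (size (cfg_left (tm_run T (tm_init M z)))); split; first by apply: h1; rewrite mem_iota; lia.
by rewrite /own /cellof /= eqxx h2 nth_zip ltnn eqxx.
Qed.
End Tableau.

(** * Grids inside a graph *)

(* Label of a cell: row class and column class (0 first, 1 inner, 2 last), and
   for cells of the first row the input bit (2 = part of the witness area). *)
Definition lbl : finType := ('I_3 * 'I_3 * 'I_3)%type.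
Definition lr (l : lbl) : nat := l.1.1.
Definition lc (l : lbl) : nat := l.1.2.
Definition lb (l : lbl) : nat := l.2.
(** The ternary digits number the 27 labels; the offset 2 leaves types 0 and 1 to the links of the
    grid. *)
Definition ltau (l : lbl) := 2 + 9 * lr l + 3 * lc l + lb l.
(** The last clause makes the input an initial segment of the first row: the witness area, once
    entered, is not left. *)
Definition hcomp l l' := [&& lc l != 2, lc l' != 0, lr l == lr l' &
  ((lr l == 0) && (lb l == 2)) ==> (lb l' == 2)].
Definition vcomp l l' := [&& lr l != 2, lr l' != 0 & lc l == lc l'].

Lemma ltau_lt l : ltau l < 29.
Proof. case: l => [[a b] c]; rewrite /ltau /lr /lc /lb /=; have := ltn_ord a; have := ltn_ord b; have := ltn_ord c; lia. Qed.

Section Grid.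
Variables (T : finType) (e : rel T).

Definition lab l u := garc e (ltau l) u u.
Definition HH u v := [exists l, exists l', [&& garc e 0 u v, lab l u, lab l' v & hcomp l l']].
Definition VV u v := [exists l, exists l', [&& garc e 1 u v, lab l u, lab l' v & vcomp l l']].
Definition startv u := [exists l, [&& lab l u, lr l == 0 & lc l == 0]].
Definition lastv u := [exists l, [&& lab l u, lr l == 2 & lc l == 2]].
Definition vbit v : option bool :=
  if [exists l, lab l v && (lb l == 1)] then Some true
  else if [exists l, lab l v && (lb l == 0)] then Some false else None.

Definition banfree :=
  [/\ forall tau u v v', tau < 2 -> garc e tau u v -> garc e tau u v' -> v = v',
      forall tau u u' v, tau < 2 -> garc e tau u v -> garc e tau u' v -> u = u' &
      forall l l' u, lab l u -> lab l' u -> l = l'].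

Definition sR v := odflt v [pick w | HH v w].
Definition sD v := odflt v [pick w | VV v w].
Definition pos u t j := iter j sR (iter t sD u).
Definition yof u S := pmap (fun j => vbit (pos u 0 j)) (iota 0 S).

(** A filled rectangle between a start corner and the cell [(t, j)], whether or not it extends to a
    complete grid. This is the region over which forcing spreads. *)
Definition okr u t j := [/\ startv u,
  forall t' j', t' <= t -> j' < j -> HH (pos u t' j') (pos u t' j'.+1) &
  forall t' j', t' < t -> j' <= j -> VV (pos u t' j') (pos u t'.+1 j')].
Definition rect u S Tm := [/\ 0 < S, okr u Tm S.-1 & lastv (pos u Tm S.-1)].

Hypothesis bf : banfree.

Lemma HHP u v : reflect (exists l l', [/\ garc e 0 u v, lab l u, lab l' v & hcomp l l']) (HH u v).
Proof.
apply: (iffP existsP) => [[l /existsP[l' /and4P h]]|[l [l' h]]].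
  by exists l, l'.
by exists l; apply/existsP; exists l'; apply/and4P.
Qed.
Lemma VVP u v : reflect (exists l l', [/\ garc e 1 u v, lab l u, lab l' v & vcomp l l']) (VV u v).
Proof.
apply: (iffP existsP) => [[l /existsP[l' /and4P h]]|[l [l' h]]].
  by exists l, l'.
by exists l; apply/existsP; exists l'; apply/and4P.
Qed.
Lemma labu l l' u : lab l u -> lab l' u -> l = l'. Proof. by case: bf => _ _; apply. Qed.
Lemma HHl u v l l' : HH u v -> lab l u -> lab l' v -> hcomp l l'.
Proof. by move=> /HHP[a [b [_ h1 h2 h3]]] /(labu h1) <- /(labu h2) <-. Qed.
Lemma VVl u v l l' : VV u v -> lab l u -> lab l' v -> vcomp l l'.
Proof. by move=> /VVP[a [b [_ h1 h2 h3]]] /(labu h1) <- /(labu h2) <-. Qed.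
Lemma HH_fun u v v' : HH u v -> HH u v' -> v = v'.
Proof. by case: bf => f _ _ /HHP[a [b [h1 _ _ _]]] /HHP[a' [b' [h2 _ _ _]]]; apply: f h1 h2. Qed.
Lemma VV_fun u v v' : VV u v -> VV u v' -> v = v'.
Proof. by case: bf => f _ _ /VVP[a [b [h1 _ _ _]]] /VVP[a' [b' [h2 _ _ _]]]; apply: f h1 h2. Qed.
Lemma HH_inj u u' v : HH u v -> HH u' v -> u = u'.
Proof. by case: bf => _ f _ /HHP[a [b [h1 _ _ _]]] /HHP[a' [b' [h2 _ _ _]]]; apply: f h1 h2. Qed.
Lemma VV_inj u u' v : VV u v -> VV u' v -> u = u'.
Proof. by case: bf => _ f _ /VVP[a [b [h1 _ _ _]]] /VVP[a' [b' [h2 _ _ _]]]; apply: f h1 h2. Qed.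

Lemma sR_ok v w : HH v w -> sR v = w.
Proof. by move=> h; rewrite /sR; case: pickP => [w' h'|/(_ w)]; [apply: HH_fun h' h|rewrite h]. Qed.
Lemma sD_ok v w : VV v w -> sD v = w.
Proof. by move=> h; rewrite /sD; case: pickP => [w' h'|/(_ w)]; [apply: VV_fun h' h|rewrite h]. Qed.
Lemma posR u t j : pos u t j.+1 = sR (pos u t j). Proof. by []. Qed.
Lemma posD0 u t : pos u t.+1 0 = sD (pos u t 0). Proof. by []. Qed.

Lemma okr_sub u t j t' j' : okr u t j -> t' <= t -> j' <= j -> okr u t' j'.
Proof.
move=> [h1 h2 h3] ht hj; split=> // a b ha hb; first by apply: h2; lia.
by apply: h3; lia.
Qed.

Lemma okr_lab u t j : okr u t j ->
  exists l, [/\ lab l (pos u t j), (lr l == 0) = (t == 0) & (lc l == 0) = (j == 0)].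
Proof.
elim: j => [|j IH] ho.
  elim: t ho => [|t IH] ho.
    by have [/existsP[l /and3P[h1 h2 h3]] _ _] := ho; exists l; rewrite h1 h2 h3.
  have [l [hl h1 h2]] := IH (okr_sub ho (leqnSn _) (leqnn _)).
  have [_ _ /(_ t 0 (ltnSn t) isT) hv] := ho.
  have /VVP[a [b [_ ha hb /and3P[c1 c2 /eqP c3]]]] := hv.
  exists b; split=> //; first by rewrite (negbTE c2).
  by rewrite -c3 (labu ha hl) h2.
have [l [hl h1 h2]] := IH (okr_sub ho (leqnn _) (leqnSn _)).
have [_ /(_ t j (leqnn t) (ltnSn j)) hh _] := ho.
have /HHP[a [b [_ ha hb /and4P[c1 c2 /eqP c3 _]]]] := hh.
exists b; split=> //; last by rewrite (negbTE c2).
by rewrite -c3 (labu ha hl) h1.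
Qed.

Lemma okr_labE u t j l : okr u t j -> lab l (pos u t j) ->
  ((lr l == 0) = (t == 0)) * ((lc l == 0) = (j == 0)).
Proof. by move=> /okr_lab[l' [h1 h2 h3]] h; rewrite (labu h h1). Qed.

(** Links are injective and the labels single out the first column and the first row, so walking
    back left and then up reaches these borders at the same moment in both rectangles. Hence grids
    neither overlap nor wrap around. *)
Lemma okr_uniq u t j u' t' j' : okr u t j -> okr u' t' j' -> pos u t j = pos u' t' j' ->
  [/\ u = u', t = t' & j = j'].
Proof.
move=> ho ho' ep.
have [l [hl h1 h2]] := okr_lab ho; have [l' [hl' h1' h2']] := okr_lab ho'.
have el : l = l' by apply: labu hl _; rewrite ep.
move: h1' h2'; rewrite -el h1 h2 => /esym ht /esym hj {l l' hl hl' h1 h2 el}.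
elim: j j' hj ho ho' ep => [|j IH] [|j'] // hj ho ho' ep; last first.
  have [_ /(_ t j (leqnn t) (ltnSn j)) hh _] := ho.
  have [_ /(_ t' j' (leqnn t') (ltnSn j')) hh' _] := ho'.
  rewrite ep in hh; have eq1 := HH_inj hh hh'.
  have so := okr_sub ho (leqnn t) (leqnSn j); have so' := okr_sub ho' (leqnn t') (leqnSn j').
  have [//|a b c] := IH j' _ so so' eq1; last by subst.
  have [l [hl h1 h2]] := okr_lab so; have [l' [hl' h1' h2']] := okr_lab so'.
  by move: h2 h2'; rewrite (labu hl (_ : lab l' _)) ?eq1 // => -> ->.
elim: t t' ht ho ho' ep => [|t IH] [|t'] // ht ho ho' ep.
have [_ _ /(_ t 0 (ltnSn t) isT) hh] := ho.
have [_ _ /(_ t' 0 (ltnSn t') isT) hh'] := ho'.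
rewrite ep in hh; have eq1 := VV_inj hh hh'.
have so := okr_sub ho (leqnSn t) (leqnn 0); have so' := okr_sub ho' (leqnSn t') (leqnn 0).
have [//|a b _] := IH t' _ so so' eq1; last by subst.
have [l [hl h1 h2]] := okr_lab so; have [l' [hl' h1' h2']] := okr_lab so'.
by move: h1 h1'; rewrite (labu hl (_ : lab l' _)) ?eq1 // => -> ->.
Qed.

Lemma rect_okr u S Tm t j : rect u S Tm -> t <= Tm -> j < S -> okr u t j.
Proof. by move=> [hS ho _] ht hj; apply: okr_sub ho ht _; lia. Qed.

(** Vertical links preserve the column class, so class 2 spreads upwards from the last corner; cells
    of all other columns have a right link, which excludes class 2. *)
Lemma rect_lc u S Tm t j l : rect u S Tm -> t <= Tm -> j < S -> lab l (pos u t j) ->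
  (lc l == 2) = (j.+1 == S).
Proof.
move=> hr ht hj hl; have [hS [_ oh ov] /existsP[lf /and3P[hlf _ hcf]]] := hr.
have [hjS|hjS] := eqVneq j.+1 S; last first.
  have hh := oh t j ht (ltac:(lia)).
  have /HHP[a [b [_ ha _ /and4P[c1 _ _ _]]]] := hh.
  by rewrite (labu hl ha) (negbTE c1).
have ej : j = S.-1 by lia.
suff H k : k <= Tm -> forall l, lab l (pos u (Tm - k) j) -> lc l == 2.
  by apply: (H (Tm - t)); [lia|rewrite subKn].
elim: k => [|k IH] hk l'; first by rewrite subn0 ej => h; rewrite (labu h hlf).
move=> h; have hv := ov (Tm - k.+1) j (ltac:(lia)) (ltac:(lia)).
rewrite (_ : (Tm - k.+1).+1 = Tm - k) in hv; last by lia.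
have /VVP[a [b [_ ha hb /and3P[_ _ /eqP c]]]] := hv.
rewrite (labu h ha) c; apply: IH hb; lia.
Qed.

Lemma rect_lr u S Tm t j l : rect u S Tm -> t <= Tm -> j < S -> lab l (pos u t j) ->
  (lr l == 2) = (t == Tm).
Proof.
move=> hr ht hj hl; have [hS [_ oh ov] /existsP[lf /and3P[hlf hcf _]]] := hr.
have [hjS|hjS] := eqVneq t Tm; last first.
  have hh := ov t j (ltac:(lia)) (ltac:(lia)).
  have /VVP[a [b [_ ha _ /and3P[c1 _ _]]]] := hh.
  by rewrite (labu hl ha) (negbTE c1).
subst t.
suff H k : k < S -> forall l, lab l (pos u Tm (S.-1 - k)) -> lr l == 2.
  apply: (H (S.-1 - j)); first by lia.
  by rewrite subKn //; lia.
elim: k => [|k IH] hk l'; first by rewrite subn0 => h; rewrite (labu h hlf).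
move=> h; have hv := oh Tm (S.-1 - k.+1) (leqnn _) (ltac:(lia)).
rewrite (_ : (S.-1 - k.+1).+1 = S.-1 - k) in hv; last by lia.
have /HHP[a [b [_ ha hb /and4P[_ _ /eqP c _]]]] := hv.
rewrite (labu h ha) c; apply: IH hb; lia.
Qed.

(** If one grid were larger, a border cell of the smaller one would carry class 2 and also lie in
    the interior of the larger one. *)
Lemma rect_uniq u S Tm S' Tm' : rect u S Tm -> rect u S' Tm' -> S = S' /\ Tm = Tm'.
Proof.
move=> hr hr'.
have [hS _ _] := hr; have [hS' _ _] := hr'.
have aux A B C D : rect u A B -> rect u C D -> A <= C.
  move=> ha hc; rewrite leqNgt; apply/negP => hlt.
  have [hC _ _] := hc.
  have [l [hl _ _]] := okr_lab (rect_okr hc (leq0n D) (ltac:(lia) : C.-1 < C)).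
  have := rect_lc hc (leq0n D) (ltac:(lia) : C.-1 < C) hl.
  by rewrite (rect_lc ha (leq0n B) (ltac:(lia) : C.-1 < A) hl); lia.
have aux2 A B C D : rect u A B -> rect u C D -> B <= D.
  move=> ha hc; rewrite leqNgt; apply/negP => hlt.
  have [hA _ _] := ha; have [hC _ _] := hc.
  have [l [hl _ _]] := okr_lab (rect_okr hc (leqnn D) hC).
  have := rect_lr hc (leqnn D) hC hl.
  by rewrite (rect_lr ha (ltnW hlt) hA hl); lia.
by split; apply/eqP; rewrite eqn_leq ?(aux S Tm S' Tm') ?(aux S' Tm' S Tm) ?(aux2 S Tm S' Tm') ?(aux2 S' Tm' S Tm).
Qed.

Lemma vbitE l v : lab l v -> vbit v = if lb l == 1 then Some true
  else if lb l == 0 then Some false else None.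
Proof.
move=> h; rewrite /vbit.
have ex k : [exists l', lab l' v && (lb l' == k)] = (lb l == k).
  apply/existsP/idP => [[l' /andP[h1 h2]]|hk]; first by rewrite (labu h h1).
  by exists l; rewrite h.
by rewrite !ex.
Qed.

Lemma yof_ok u S Tm : rect u S Tm -> size (yof u S) <= S /\
  forall j, j < S -> vbit (pos u 0 j) = if j < size (yof u S) then Some (nth false (yof u S) j) else None.
Proof.
move=> hr; apply: mono_seq => j hj.
have [hS [_ oh _] _] := hr.
have hh := oh 0 j (leq0n _) (ltac:(lia)).
have /HHP[a [b [_ ha hb /and4P[_ _ hr0 hb2]]]] := hh.
have [_ E] := (rect_okr hr (leq0n _) (ltnW hj), okr_labE (rect_okr hr (leq0n _) (ltnW hj)) ha).
rewrite (vbitE ha) (vbitE hb); move: hb2; rewrite E.1 eqxx /=.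
have := ltn_ord a.2; rewrite -/(lb a).
by case: (lb a) => [|[|[|k]]] //= _ /eqP ->.
Qed.
End Grid.

(** * Colorings as tableaux *)

Section Coloring.
Variables U K : TM.

(* left neighbour, cell, right neighbour, and whether an accepting head has been
   seen in the row up to this cell *)
Definition win (M : TM) : finType := (option (cell M) * cell M * option (cell M) * bool)%type.

(* None: unconstrained; Some None: forced but in an incomplete grid;
   Some (Some _): a cell of the computation *)
Definition color : finType := option (option (win U * win K)).

Definition unoM (M : TM) (wit : bool) (l : lbl) (w : win M) : bool :=
  let: (a, m, b, f) := w in
  [&& (lr l == 0) ==> [&& (if lb l == 1 then m.1 == Some true else if lb l == 0 then m.1 == Some false
                           else wit || (m.1 == None)) &
                          m.2 == if lc l == 0 then Some (@tm_start M) else None],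
      (lc l == 0) ==> ((a == None) && (f == own m)),
      (lc l == 2) ==> (b == None) & ((lr l == 2) && (lc l == 2)) ==> f].

(** The sources of the two passes: a start corner is forced, and a last corner that is forced has to
    compute. *)
Definition uno (l : lbl) (c : color) : bool :=
  match c with
  | None => ~~ ((lr l == 0) && (lc l == 0))
  | Some None => ~~ ((lr l == 2) && (lc l == 2))
  | Some (Some (w, w')) => unoM true l w && unoM false l w'
  end.

Definition hokM (M : TM) (l : lbl) (w w' : win M) : bool :=
  let: (a, m, b, f) := w in let: (a', m', b', f') := w' in
  [&& b == Some m', a' == Some m, f' == f || own m' &
      [&& lr l == 0, lb l == 2 & m.1 == None] ==> (m'.1 == None)].

(** Only in the first row does a forced cell force its right neighbour; further down forcing needs
    both predecessors, through [Qsq], lest it spread beyond filled rectangles. Forced cells joined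
    by a link agree on whether they compute. *)
Definition hok (l l' : lbl) (c c' : color) : bool :=
  match c, c' with
  | None, _ => true
  | Some _, None => lr l' != 0
  | Some None, Some None => true
  | Some (Some (w, v)), Some (Some (w', v')) => hokM l w w' && hokM l v v'
  | _, _ => false
  end.

Definition vokM (M : TM) (w w' : win M) : bool :=
  let: (a, m, b, f) := w in let: (a', m', b', f') := w' in m' == phi a m b.

Definition vok (l l' : lbl) (c c' : color) : bool :=
  match c, c' with
  | None, _ => true
  | Some _, None => lc l' != 0
  | Some None, Some None => true
  | Some (Some (w, v)), Some (Some (w', v')) => vokM w w' && vokM v v'
  | _, _ => false
  end.

Inductive queries : query color -> Prop :=
  | Qfun tau : tau < 2 -> queries (Query [:: (tau, 0, 1); (tau, 0, 2)] [:: (1, 2)] (fun=> True))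
  | Qinj tau : tau < 2 -> queries (Query [:: (tau, 0, 2); (tau, 1, 2)] [:: (0, 1)] (fun=> True))
  | Qlab l l' : l != l' -> queries (Query [:: (ltau l, 0, 0); (ltau l', 0, 0)] [::] (fun=> True))
  | Qun l : queries (Query [:: (ltau l, 0, 0)] [::] (fun c => ~~ uno l (c 0)))
  | Qh l l' : hcomp l l' -> queries (Query [:: (0, 0, 1); (ltau l, 0, 0); (ltau l', 1, 1)] [::]
      (fun c => ~~ hok l l' (c 0) (c 1)))
  | Qv l l' : vcomp l l' -> queries (Query [:: (1, 0, 1); (ltau l, 0, 0); (ltau l', 1, 1)] [::]
      (fun c => ~~ vok l l' (c 0) (c 1)))
  | Qsq l0 l1 l2 l3 : [&& hcomp l0 l1, vcomp l0 l2, hcomp l2 l3 & vcomp l1 l3] ->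
      queries (Query [:: (0, 0, 1); (1, 0, 2); (0, 2, 3); (1, 1, 3);
         (ltau l0, 0, 0); (ltau l1, 1, 1); (ltau l2, 2, 2); (ltau l3, 3, 3)] [::]
        (fun c => [&& c 1 != None, c 2 != None & c 3 == None])).

Lemma queries_wf q : queries q -> wfq q.
Proof.
case=> [tau ht|tau ht|l l' _|l|l l' _|l l' _|l0 l1 l2 l3 _]; split=> //=;
  rewrite ?ltau_lt // ?(ltn_trans ht) //; try by move=> p; rewrite inE => /eqP ->.
- by move=> c c' h; rewrite h ?inE.
- by move=> c c' h; rewrite !h ?inE.
- by move=> c c' h; rewrite !h ?inE.
- by move=> c c' h; rewrite !h ?inE.
Qed.

Section Good.
Variables (T : finType) (e : rel T) (col : T -> color).

Definition good := [/\ banfree e,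
  forall l u, lab e l u -> uno l (col u),
  forall l l' u v, garc e 0 u v -> lab e l u -> lab e l' v -> hcomp l l' -> hok l l' (col u) (col v),
  forall l l' u v, garc e 1 u v -> lab e l u -> lab e l' v -> vcomp l l' -> vok l l' (col u) (col v) &
  forall w' w u v, HH e w' w -> VV e w' u -> HH e u v -> VV e w v ->
    col w != None -> col u != None -> col v != None].

Lemma bad_good : ~ bad queries e col <-> good.
Proof.
split.
  move=> nb; split; first split.
  - move=> tau u v v' ht h h'; apply: contrapT => hne; apply: nb.
    exists (Query [:: (tau, 0, 1); (tau, 0, 2)] [:: (1, 2)] (fun=> True)), (nth u [:: u; v; v']).
    by split; [constructor|split=> //=; rewrite ?/sat1 /= ?h ?h' // => p; rewrite inE => /eqP ->].
  - move=> tau u u' v ht h h'; apply: contrapT => hne; apply: nb.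
    exists (Query [:: (tau, 0, 2); (tau, 1, 2)] [:: (0, 1)] (fun=> True)), (nth u [:: u; u'; v]).
    by split; [constructor|split=> //=; rewrite ?/sat1 /= ?h ?h' // => p; rewrite inE => /eqP ->].
  - move=> l l' u h h'; apply: contrapT => /eqP hne; apply: nb.
    exists (Query [:: (ltau l, 0, 0); (ltau l', 0, 0)] [::] (fun=> True)), (fun=> u).
    by split; [constructor|split=> //=; rewrite /sat1 /= -/(lab e l u) -/(lab e l' u) h h'].
  - move=> l u h; apply: contrapT => /negP hne; apply: nb.
    exists (Query [:: (ltau l, 0, 0)] [::] (fun c => ~~ uno l (c 0))), (fun=> u).
    by split; [constructor|split=> //=; rewrite /sat1 /= -/(lab e l u) h].
  - move=> l l' u v a h h' hc; apply: contrapT => /negP hne; apply: nb.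
    exists (Query [:: (0, 0, 1); (ltau l, 0, 0); (ltau l', 1, 1)] [::]
      (fun c => ~~ hok l l' (c 0) (c 1))), (nth u [:: u; v]).
    by split; [constructor|split=> //=; rewrite /sat1 /= -/(lab e l u) -/(lab e l' v) a h h'].
  - move=> l l' u v a h h' hc; apply: contrapT => /negP hne; apply: nb.
    exists (Query [:: (1, 0, 1); (ltau l, 0, 0); (ltau l', 1, 1)] [::]
      (fun c => ~~ vok l l' (c 0) (c 1))), (nth u [:: u; v]).
    by split; [constructor|split=> //=; rewrite /sat1 /= -/(lab e l u) -/(lab e l' v) a h h'].
  - move=> w' w u v /HHP[a0 [a1 [r1 x0 x1 c1]]] /VVP[b0 [b1 [r2 x2 x3 c2]]]
      /HHP[a2 [a3 [r3 x4 x5 c3]]] /VVP[b2 [b3 [r4 x6 x7 c4]]] hw hu.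
    apply/negP => hv.
    (* Each link of the square brings its own labels; uniqueness merges them into one label per
       vertex, as [Qsq] requires. *)
    have ul : forall l l' z, lab e l z -> lab e l' z -> l = l'.
      move=> l l' z h h'; apply: contrapT => /eqP hne; apply: nb.
      exists (Query [:: (ltau l, 0, 0); (ltau l', 0, 0)] [::] (fun=> True)), (fun=> z).
      by split; [constructor|split=> //=; rewrite /sat1 /= -/(lab e l z) -/(lab e l' z) h h'].
    have E0 := ul _ _ _ x0 x2; have E1 := ul _ _ _ x1 x6; have E2 := ul _ _ _ x3 x4.
    have E3 := ul _ _ _ x5 x7; subst b0 b2 a2 b3.
    apply: nb; exists (Query [:: (0, 0, 1); (1, 0, 2); (0, 2, 3); (1, 1, 3);
         (ltau a0, 0, 0); (ltau a1, 1, 1); (ltau b1, 2, 2); (ltau a3, 3, 3)] [::]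
        (fun c => [&& c 1 != None, c 2 != None & c 3 == None])), (nth u [:: w'; w; u; v]).
    split; first by constructor; rewrite c1 c2 c3.
    split=> //=; last by rewrite hw hu hv.
    by move: x0 x1 x3 x5; rewrite /lab /sat1 /= r1 r2 r3 r4 => -> -> -> ->.
move=> [[g1 g2 g3] gu gh gv gs] [q [x [hq [ha hne hc]]]].
case: hq ha hne hc => [tau ht|tau ht|l l' hl|l|l l' hl|l l' hl|l0 l1 l2 l3 hl] /=;
  rewrite /sat1 /= ?andbT => ha hne hc.
- case/andP: ha => h h'; apply: (hne (1, 2)); rewrite ?inE //=; exact: g1 ht h h'.
- case/andP: ha => h h'; apply: (hne (0, 1)); rewrite ?inE //=; exact: g2 ht h h'.
- case/andP: ha => h h'; move: hl; by rewrite (g3 _ _ _ h h') eqxx.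
- by move: hc; rewrite gu.
- by case/and3P: ha => h h1 h2; move: hc; rewrite gh.
- by case/and3P: ha => h h1 h2; move: hc; rewrite gv.
- case/and5P: ha => r1 r2 r3 r4 /and4P[x0 x1 x2 x3].
  case/and4P: hl => c1 c2 c3 c4; case/and3P: hc => hw hu hv.
  suff : col (x 3) != None by rewrite (eqP hv).
  apply: (gs (x 0) (x 1) (x 2) (x 3) _ _ _ _ hw hu).
  + by apply/HHP; exists l0, l1.
  + by apply/VVP; exists l0, l2.
  + by apply/HHP; exists l2, l3.
  + by apply/VVP; exists l1, l3.
Qed.
End Good.

Definition cond (y : seq bool) S Tm :=
  (exists v, size y + size v <= S /\ accb U (y ++ v) S Tm) /\ accb K y S Tm.

Section Core.
Variables (T : finType) (e : rel T).

Section Forward.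
Variable col : T -> color.
Hypothesis gd : good e col.
Variables (u : T) (S Tm : nat).
Hypothesis hr : rect e u S Tm.
Let p := pos e u.
Let bf : banfree e. Proof. by case: gd. Qed.

Lemma fw_lab t j : t <= Tm -> j < S -> exists l, lab e l (p t j).
Proof. by move=> ht hj; have [l [h _ _]] := okr_lab bf (rect_okr hr ht hj); exists l. Qed.

Lemma fw_HH t j : t <= Tm -> j.+1 < S -> HH e (p t j) (p t j.+1).
Proof. by move=> ht hj; case: hr => hS [_ h _] _; apply: h => //; lia. Qed.
Lemma fw_VV t j : t < Tm -> j < S -> VV e (p t j) (p t.+1 j).
Proof. by move=> ht hj; case: hr => hS [_ _ h] _; apply: h => //; lia. Qed.

Lemma fw_h t j l l' : t <= Tm -> j.+1 < S -> lab e l (p t j) -> lab e l' (p t j.+1) ->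
  hok l l' (col (p t j)) (col (p t j.+1)) && (lr l == lr l').
Proof.
move=> ht hj hl hl'; have hh := fw_HH ht hj.
have hc := HHl bf hh hl hl'; case/HHP: hh => a [b [r _ _ _]].
case: gd => _ _ gh _ _; rewrite (gh _ _ _ _ r hl hl' hc); by case/and4P: hc.
Qed.
Lemma fw_v t j l l' : t < Tm -> j < S -> lab e l (p t j) -> lab e l' (p t.+1 j) ->
  vok l l' (col (p t j)) (col (p t.+1 j)) && (lc l == lc l').
Proof.
move=> ht hj hl hl'; have hh := fw_VV ht hj.
have hc := VVl bf hh hl hl'; case/VVP: hh => a [b [r _ _ _]].
case: gd => _ _ _ gv _; rewrite (gv _ _ _ _ r hl hl' hc); by case/and3P: hc.
Qed.

(** Forcing runs from the start corner along the first row and the first column, and then fills the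
    grid square by square. *)
Lemma fw_nonbot t j : t <= Tm -> j < S -> col (p t j) != None.
Proof.
elim: t j => [|t IHt]; elim=> [|j IHj] ht hj.
- have [l hl] := fw_lab ht hj; case: gd => _ gu _ _ _; have := gu l _ hl.
  have E := okr_labE bf (rect_okr hr ht hj) hl; rewrite /uno.
  by case: (col _) => //; rewrite E.1 E.2.
- have [l hl] := fw_lab ht (ltnW hj); have [l' hl'] := fw_lab ht hj.
  have E := okr_labE bf (rect_okr hr ht hj) hl'.
  move: (fw_h ht hj hl hl') (IHj ht (ltnW hj)).
  case: (col (p 0 j)) => [c|] //; case: (col (p 0 j.+1)) => [c'|] //.
  by case: c => [[w w']|] /=; rewrite E.1.
- have ht' : t <= Tm by lia.
  have [l hl] := fw_lab ht' hj; have [l' hl'] := fw_lab ht hj.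
  have E := okr_labE bf (rect_okr hr ht hj) hl'.
  move: (fw_v ht hj hl hl') (IHt 0 ht' hj).
  case: (col (p t 0)) => [c|] //; case: (col (p t.+1 0)) => [c'|] //.
  by case: c => [[w w']|] /=; rewrite E.2.
- case: gd => _ _ _ _ gs; apply: (gs (p t j) (p t j.+1) (p t.+1 j)).
  + by apply: fw_HH => //; lia.
  + by apply: fw_VV => //; lia.
  + by apply: fw_HH => //; lia.
  + by apply: fw_VV => //; lia.
  + by apply: IHt => //; lia.
  + by apply: IHj => //; lia.
Qed.

Definition isreal (c : color) := if c is Some (Some _) then true else false.

(** The last corner is forced and hence computes; this goes back along the last row and then up
    every column. *)
Lemma fw_real t j : t <= Tm -> j < S -> isreal (col (p t j)).
Proof.
have [hS _ /existsP[l /and3P[hl h1 h2]]] := hr.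
have H0 : isreal (col (p Tm S.-1)).
  have : col (p Tm S.-1) != None by apply: fw_nonbot => //; lia.
  case: gd => _ gu _ _ _; have := gu l _ hl; rewrite /uno -/p h1 h2.
  by case: (col _) => // [[]].
have H1 k : k < S -> isreal (col (p Tm (S.-1 - k))).
  elim: k => [|k IH] hk; first by rewrite subn0.
  have [a ha] := fw_lab (leqnn Tm) (ltac:(lia) : S.-1 - k.+1 < S).
  have ek : (S.-1 - k.+1).+1 = S.-1 - k by lia.
  have [b hb] := fw_lab (leqnn Tm) (ltac:(lia) : (S.-1 - k.+1).+1 < S).
  have := fw_h (leqnn Tm) (ltac:(lia) : (S.-1 - k.+1).+1 < S) ha hb.
  have := fw_nonbot (leqnn Tm) (ltac:(lia) : S.-1 - k.+1 < S).
  have := IH (ltnW hk); rewrite -ek.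
  by case: (col (p Tm (S.-1 - k.+1))) => [[[]|]|] //; case: (col _) => [[[]|]|].
move=> ht hj.
suff H k : k <= Tm -> isreal (col (p (Tm - k) j)).
  by rewrite -(subKn ht); apply: H; lia.
elim: k => [|k IH] hk; first by rewrite subn0 -(subKn (_ : j <= S.-1)); [apply: H1; lia|lia].
have [a ha] := fw_lab (ltac:(lia) : Tm - k.+1 <= Tm) hj.
have ek : (Tm - k.+1).+1 = Tm - k by lia.
have [b hb] := fw_lab (ltac:(lia) : (Tm - k.+1).+1 <= Tm) hj.
have := fw_v (ltac:(lia) : Tm - k.+1 < Tm) hj ha hb.
have := fw_nonbot (ltac:(lia) : Tm - k.+1 <= Tm) hj.
have := IH (ltnW hk); rewrite -ek.
by case: (col (p (Tm - k.+1) j)) => [[[]|]|] //; case: (col _) => [[[]|]|].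
Qed.

(** The flag [wit] lets one statement serve both machines: the verifier may find a guessed word
    behind the input, while the clock finds blanks. *)
Lemma fw_machine (M : TM) (wit : bool) (W : nat -> nat -> win M) :
  (forall t j l, t <= Tm -> j < S -> lab e l (p t j) -> unoM wit l (W t j)) ->
  (forall t j l, t <= Tm -> j.+1 < S -> lab e l (p t j) -> hokM l (W t j) (W t j.+1)) ->
  (forall t j, t < Tm -> j < S -> vokM (W t j) (W t.+1 j)) ->
  exists v, [/\ size (yof e u S) + size v <= S, wit || (v == [::]) & accb M (yof e u S ++ v) S Tm].
Proof.
move=> hu hh hv; have [hS _ _] := hr.
pose m t j := (W t j).1.1.2; set y := yof e u S.
have [hy hb] := yof_ok bf hr; rewrite -/y in hy hb.
have hl t j : t <= Tm -> j < S -> (W t j).1.1.1 = lft (m t) j.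
  case: j => [|j] ht hj.
    have [l hl] := fw_lab ht hj; have := hu t 0 l ht hj hl.
    have E := okr_labE bf (rect_okr hr ht hj) hl.
    by case: (W t 0) => [[[a m0] b] f] /and4P[_]; rewrite E.2 /= => /andP[/eqP].
  have [l hl] := fw_lab ht (ltnW hj); have := hh t j l ht hj hl.
  by rewrite /m /=; case: (W t j) (W t j.+1) => [[[a m0] b] f] [[[a' m0'] b'] f'] /and4P[_ /eqP].
have hg t j : t <= Tm -> j < S -> (W t j).1.2 = rgt S (m t) j.
  move=> ht hj; have [l hl'] := fw_lab ht hj; rewrite /rgt; case: ltnP => hj'.
    have := hh t j l ht hj' hl'.
    by rewrite /m /=; case: (W t j) (W t j.+1) => [[[a m0] b] f] [[[a' m0'] b'] f'] /and4P[/eqP].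
  have := hu t j l ht hj hl'; have := rect_lc bf hr ht hj hl'.
  rewrite (_ : j.+1 == S); last by apply/eqP; lia.
  by case: (W t j) => [[[a m0] b] f] hc /and4P[_ _]; rewrite hc /= => /eqP.
(* Input cells are never blank, and within the witness area [hokM] lets only a blank follow a
   blank. *)
have mono j : j.+1 < S -> (m 0 j).1 = None -> (m 0 j.+1).1 = None.
  move=> hj hn; have [l hl'] := fw_lab (leq0n Tm) (ltnW hj).
  have E := okr_labE bf (rect_okr hr (leq0n Tm) (ltnW hj)) hl'.
  have := hu 0 j l (leq0n _) (ltnW hj) hl'; have := hh 0 j l (leq0n _) hj hl'.
  move: hn; rewrite /m; case: (W 0 j) (W 0 j.+1) => [[[a m0] b] f] [[[a' m0'] b'] f'] /= hn.
  move=> /and4P[_ _ _ h] /and4P[h2 _ _ _]; move: h h2; rewrite E.1 hn /=.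
  have := ltn_ord l.2; rewrite -/(lb l).
  by case: (lb l) => [|[|[|k]]] //= _ /eqP.
have [sz ez] := mono_seq mono; set z := pmap _ _ in sz ez.
have hyz j : j < size y -> j < size z /\ nth false z j = nth false y j.
  move=> hj; have hjS : j < S by lia.
  have [l hl'] := fw_lab (leq0n Tm) hjS.
  have E := okr_labE bf (rect_okr hr (leq0n Tm) hjS) hl'.
  have := hb j hjS; rewrite hj (vbitE bf hl').
  have := hu 0 j l (leq0n _) hjS hl'; move: (ez j hjS); rewrite /m.
  case: (W 0 j) => [[[a m0] b] f] /= em /and4P[]; rewrite E.1 /= => /andP[hs _] _ _ _.
  case: (lb l == 1) hs => [/eqP hs [<-]|].
    by move: em; rewrite hs; case: ltnP => // _ [].
  by case: (lb l == 0) => // /eqP hs [<-]; move: em; rewrite hs; case: ltnP => // _ [].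
have hsz : size y <= size z.
  by case ey : (size y) => [//|k]; have [] := hyz k (ltac:(lia)).
have eyz : z = y ++ drop (size y) z.
  rewrite -{1}(cat_take_drop (size y) z); congr (_ ++ _).
  apply: (@eq_from_nth _ false); first by rewrite size_takel.
  by rewrite size_takel // => j hj; rewrite nth_take //; have [_] := hyz j hj.
exists (drop (size y) z); rewrite -eyz; split.
- by rewrite size_drop subnKC.
- case ew : wit => //=; rewrite -size_eq0 size_drop subn_eq0 leqNgt; apply/negP => hlt.
  have hjS : size y < S by apply: leq_trans hlt sz.
  have [l hl'] := fw_lab (leq0n Tm) hjS.
  have E := okr_labE bf (rect_okr hr (leq0n Tm) hjS) hl'.
  have := hb _ hjS; rewrite ltnn (vbitE bf hl').
  have := hu 0 _ l (leq0n _) hjS hl'; move: (ez _ hjS); rewrite /m hlt.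
  case: (W 0 _) => [[[a m0] b] f] /= em /and4P[]; rewrite E.1 /= ew => /andP[hs _] _ _ _.
  by case: (lb l == 1) hs => //; case: (lb l == 0) => //=; rewrite em.
apply: (@tabl_acc M z S Tm m) => //.
  split.
    move=> j hj; rewrite -ez //; have [l hl'] := fw_lab (leq0n Tm) hj.
    have E := okr_labE bf (rect_okr hr (leq0n Tm) hj) hl'.
    have := hu 0 j l (leq0n _) hj hl'; rewrite /m.
    case: (W 0 j) => [[[a m0] b] f] /= /and4P[]; rewrite E.1 E.2 /= => /andP[_ /eqP h2] _ _ _.
    by case: m0 h2 => x1 x2 /= ->.
  move=> t j ht hj; have := hv t j ht hj; rewrite -hl ?(ltnW ht) // -hg ?(ltnW ht) // /m.
  by case: (W t j) (W t.+1 j) => [[[a m0] b] f] [[[a' m0'] b'] f'] /= /eqP.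
have hf j : j < S -> (W Tm j).2 -> exists i, i < S /\ own (m Tm i).
  elim: j => [|j IH] hj.
    have [l hl'] := fw_lab (leqnn Tm) hj; have := hu Tm 0 l (leqnn _) hj hl'.
    have E := okr_labE bf (rect_okr hr (leqnn _) hj) hl'.
    move=> h hf; exists 0; split=> //; move: h hf; rewrite /m.
    by case: (W Tm 0) => [[[a m0] b] f] /and4P[_]; rewrite E.2 /= => /andP[_ /eqP ->].
  have [l hl'] := fw_lab (leqnn Tm) (ltnW hj); have := hh Tm j l (leqnn _) hj hl'.
  move=> h hf; have [h1|h1] := boolP (W Tm j).2; first exact: IH (ltnW hj) h1.
  exists j.+1; split=> //; move: h hf h1; rewrite /m.
  case: (W Tm j) (W Tm j.+1) => [[[a m0] b] f] [[[a' m0'] b'] f'] /= /and4P[_ _ /eqP -> _].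
  by case: f.
apply: (hf S.-1); first by lia.
have [_ _ /existsP[l /and3P[hl' h1 h2]]] := hr.
have := hu Tm S.-1 l (leqnn _) (ltac:(lia)) hl'.
by case: (W Tm S.-1) => [[[a m0] b] f] /and4P[_ _ _]; rewrite h1 h2.
Qed.

Lemma fw_cond : cond (yof e u S) S Tm.
Proof.
have [hS _ _] := hr.
pose d : win U * win K := ((None, (None, None), None, false), (None, (None, None), None, false)).
pose W t j := if col (p t j) is Some (Some w) then w else d.
have eW t j : t <= Tm -> j < S -> col (p t j) = Some (Some (W t j)).
  by move=> ht hj; have := fw_real ht hj; rewrite /W; case: (col _) => [[]|].
have gu t j l : t <= Tm -> j < S -> lab e l (p t j) -> unoM true l (W t j).1 && unoM false l (W t j).2.
  move=> ht hj hl; case: gd => _ g _ _ _; have := g l _ hl; rewrite eW //.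
  by case: (W t j).
have gh t j l : t <= Tm -> j.+1 < S -> lab e l (p t j) ->
   hokM l (W t j).1 (W t j.+1).1 && hokM l (W t j).2 (W t j.+1).2.
  move=> ht hj hl; have [l' hl'] := fw_lab ht hj.
  case/andP: (fw_h ht hj hl hl') => + _; rewrite !eW // ?(ltnW hj) //.
  by case: (W t j); case: (W t j.+1).
have gv t j : t < Tm -> j < S -> vokM (W t j).1 (W t.+1 j).1 && vokM (W t j).2 (W t.+1 j).2.
  move=> ht hj; have [l hl] := fw_lab (ltnW ht) hj; have [l' hl'] := fw_lab ht hj.
  case/andP: (fw_v ht hj hl hl') => + _; rewrite !eW // ?(ltnW ht) //.
  by case: (W t j); case: (W t.+1 j).
split.
  have [|||v [h1 _ h2]] := @fw_machine U true (fun t j => (W t j).1).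
  - by move=> t j l h1 h2 h3; case/andP: (gu t j l h1 h2 h3).
  - by move=> t j l h1 h2 h3; case/andP: (gh t j l h1 h2 h3).
  - by move=> t j h1 h2; case/andP: (gv t j h1 h2).
  by exists v.
have [|||v [h1 /eqP h2 h3]] := @fw_machine K false (fun t j => (W t j).2).
- by move=> t j l h1 h2 h3; case/andP: (gu t j l h1 h2 h3).
- by move=> t j l h1 h2 h3; case/andP: (gh t j l h1 h2 h3).
- by move=> t j h1 h2; case/andP: (gv t j h1 h2).
by move: h3; rewrite h2 cats0.
Qed.
End Forward.
End Core.
End Coloring.

(** * Construction of a coloring from accepting runs *)

Section Backward.
Variables (U K : TM) (T : finType) (e : rel T).
Hypothesis bf : banfree e.
Hypothesis hcond : forall u S Tm, rect e u S Tm -> cond U K (yof e u S) S Tm.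

Definition mkwin (M : TM) (z : seq bool) S t j : win M :=
  let row := cellof (tm_run t (tm_init M z)) in
  (lft row j, row j, rgt S row j, has (fun i => own (row i)) (iota 0 j.+1)).

Lemma bw_uno (M : TM) wit z u S Tm t j l : rect e u S Tm -> accb M z S Tm ->
  (exists v, z = yof e u S ++ v /\ (wit || (v == [::]))) -> t <= Tm -> j < S ->
  lab e l (pos e u t j) -> unoM wit l (mkwin M z S t j).
Proof.
move=> hr hacc [v [hz hv]] ht hj hl; rewrite /mkwin /unoM.
have E := okr_labE bf (rect_okr hr ht hj) hl; rewrite E.1 E.2.
rewrite (rect_lc bf hr ht hj hl) (rect_lr bf hr ht hj hl).
apply/and4P; split.
- apply/implyP => /eqP t0; subst t; rewrite cellof_init /= eqxx andbT.
  have [hy hb] := yof_ok bf hr; have := hb j hj; rewrite (vbitE bf hl).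
  have hzy : size (yof e u S) <= size z by rewrite hz size_cat leq_addr.
  have [h|h] := ltnP j (size (yof e u S)).
    have -> : j < size z by apply: leq_trans h hzy.
    have -> : nth false z j = nth false (yof e u S) j by rewrite hz nth_cat h.
    case: (lb l == 1); first by move=> [<-].
    by case: (lb l == 0) => // -[<-].
  case: (lb l == 1) => //; case: (lb l == 0) => //= _; case: wit hv => //= /eqP hv.
  by rewrite hz hv cats0 ltnNge h.
- by apply/implyP => /eqP ->; rewrite /= orbF !eqxx.
- apply/implyP => /eqP hjS; rewrite /rgt ifF //; apply/negbTE; rewrite -leqNgt; lia.
- apply/implyP => /andP[/eqP -> /eqP hjS].
  have [_ [i [hi ho]]] := acc_tabl hacc.
  by apply/hasP; exists i => //; rewrite mem_iota hjS.
Qed.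

Lemma bw_hok (M : TM) z u S Tm t j l : rect e u S Tm -> t <= Tm -> j.+1 < S ->
  lab e l (pos e u t j) -> hokM l (mkwin M z S t j) (mkwin M z S t j.+1).
Proof.
move=> hr ht hj hl; rewrite /mkwin /hokM; apply/and4P; split.
- by rewrite /rgt hj.
- by [].
- by rewrite -(addn1 j.+1) iotaD has_cat /= orbF.
apply/implyP => /and3P[]; rewrite (okr_labE bf (rect_okr hr ht (ltnW hj)) hl).1.
move=> /eqP -> _; rewrite !cellof_init /=; case: ltnP => // h _.
by rewrite ltnNge (leq_trans h (leqnSn _)).
Qed.

Lemma bw_vok (M : TM) z S Tm t j : accb M z S Tm -> t < Tm -> j < S ->
  vokM (mkwin M z S t j) (mkwin M z S t.+1 j).
Proof. by move=> /acc_tabl[[_ h] _] ht hj; rewrite /vokM /mkwin; apply/eqP; apply: h. Qed.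

(** The least set of forced vertices; the coloring below forces these and no others. *)
Definition inX v := `[< exists u t j, okr e u t j /\ v = pos e u t j >].

Lemma inXP v : reflect (exists u t j, okr e u t j /\ v = pos e u t j) (inX v).
Proof. exact: asboolP. Qed.

Lemma coloring_exists : exists col, @good U K T e col.
Proof.
(* One witness is fixed per complete grid, so that all its cells show the same run. *)
have [gs hgs] : {gs : T * nat * nat -> seq bool & forall p, rect e p.1.1 p.1.2 p.2 ->
    accb U (yof e p.1.1 p.1.2 ++ gs p) p.1.2 p.2}.
  apply: (@choice _ _ (fun p v => rect e p.1.1 p.1.2 p.2 -> accb U (yof e p.1.1 p.1.2 ++ v) p.1.2 p.2)).
  move=> -[[u S] Tm] /=; have [/hcond[[v [_ h]] _]|hn] := pselect (rect e u S Tm).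
    by exists v.
  by exists [::].
(* Coordinates of [v] in a complete grid; [okr_uniq] and [rect_uniq] leave at most one
   possibility. *)
pose at_ v (c : T * nat * nat * nat * nat) := let: (u, n, Tm, t, j) := c in
  [/\ rect e u n Tm, t <= Tm, j < n & v = pos e u t j].
have [co hco] : {co : T -> option (T * nat * nat * nat * nat) & forall v,
    if co v is Some c then at_ v c else ~ exists c, at_ v c}.
  apply: (@choice _ _ (fun v o => if o is Some c then at_ v c else ~ exists c, at_ v c)).
  move=> v; have [[c hc]|hn] := pselect (exists c, at_ v c).
    by exists (Some c).
  by exists None.
have at_uniq v c c' : at_ v c -> at_ v c' -> c = c'.
  case: c c' => [[[[u S] Tm] t] j] [[[[u' S'] Tm'] t'] j'] [h1 h2 h3 h4] [h1' h2' h3' h4'].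
  have [|e1 e2 e3] := okr_uniq bf (rect_okr h1 h2 h3) (rect_okr h1' h2' h3'); first by rewrite -h4.
  by subst u' t' j'; have [-> ->] := rect_uniq bf h1 h1'.
have coE v c : at_ v c -> co v = Some c.
  move=> h; have := hco v; case: (co v) => [c' h'|]; first by rewrite (at_uniq _ _ _ h h').
  by case; exists c.
pose W (c : T * nat * nat * nat * nat) : win U * win K := let: (u, n, Tm, t, j) := c in
  (mkwin U (yof e u n ++ gs (u, n, Tm)) n t j, mkwin K (yof e u n) n t j).
pose col v : color U K := if co v is Some c then Some (Some (W c)) else if inX v then Some None else None.
have colX v : (col v != None) = inX v.
  rewrite /col; have := hco v; case: (co v) => [[[[[u S] Tm] t] j] [h1 h2 h3 h4]|_]; last by case: (inX v).
  by apply/esym/inXP; exists u, t, j; split=> //; apply: rect_okr h1 h2 h3.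
have XR u t j v : okr e u t j -> HH e (pos e u t j) v ->
   (forall t', t' < t -> VV e (pos e u t' j.+1) (pos e u t'.+1 j.+1)) ->
   (forall t', t' < t -> HH e (pos e u t' j) (pos e u t' j.+1)) ->
   okr e u t j.+1 /\ v = pos e u t j.+1.
  move=> [h1 h2 h3] hv hV hH.
  have ev : v = pos e u t j.+1 by rewrite posR (sR_ok bf hv).
  split=> //; split=> // t' j' ht hj.
    have [e1|n1] := eqVneq j' j; last by apply: h2 => //; lia.
    subst j'; have [e2|n2] := eqVneq t' t; first by rewrite e2 -ev.
    by apply: hH; lia.
  have [e1|n1] := eqVneq j' j.+1; last by apply: h3 => //; lia.
  by rewrite e1; apply: hV.
exists col; split=> //.
- move=> l v hl; rewrite /col; have := hco v.
  case: (co v) => [[[[[u S] Tm] t] j] [h1 h2 h3 h4]|hn].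
    have [[v' [_ _]] hK] := hcond h1; rewrite h4 in hl.
    rewrite /uno /W; apply/andP; split.
      by apply: (bw_uno h1) (hgs (u, S, Tm) h1) _ h2 h3 hl; exists (gs (u, S, Tm)).
    by apply: (bw_uno h1) hK _ h2 h3 hl; exists [::]; rewrite cats0.
  case: inXP => [[u [t [j [ho ev]]]]|hX] /=; apply/negP => /andP[h1 h2].
    (* A forced last corner would close a complete grid of [j.+1] columns and [t] steps, contrary to
       [hn]. *)
    apply: hn; exists (u, j.+1, t, t, j); split=> //; split=> //=.
    by apply/existsP; exists l; rewrite -ev hl h1 h2.
  apply: hX; exists v, 0, 0; split=> //; split=> //.
  by apply/existsP; exists l; rewrite hl h1 h2.
- move=> l l' u v r hl hl' hc.
  have hh : HH e u v by apply/HHP; exists l, l'.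
  (* Complete grids are closed under links: a predecessor lies inside by injectivity, a successor
     because the label of [u] excludes the last column. *)
  have bwd a S Tm t j : at_ v (a, S, Tm, t, j) -> exists j', j = j'.+1 /\ at_ u (a, S, Tm, t, j').
    case=> h1 h2 h3 h4; have E := okr_labE bf (rect_okr h1 h2 h3) (_ : lab e l' (pos e a t j)).
    rewrite -h4 in E; have {E} E := E hl'.
    case: j h3 h4 E => [|j] h3 h4 E; first by case/and4P: hc => _; rewrite E.2.
    exists j; split=> //; split=> //; first exact: ltnW.
    apply: HH_inj bf _ _ _ hh _; rewrite h4.
    by case: h1 => _ [_ h _] _; apply: h => //; lia.
  have fwd a S Tm t j : at_ u (a, S, Tm, t, j) -> at_ v (a, S, Tm, t, j.+1) /\ j.+1 < S.
    case=> h1 h2 h3 h4.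
    have hj : j.+1 < S.
      have := rect_lc bf h1 h2 h3 (_ : lab e l (pos e a t j)); rewrite -h4 => /(_ hl).
      by case/and4P: hc => /negbTE -> _ _ _; lia.
    split=> //; split=> //; rewrite posR -h4; apply/esym; exact: sR_ok.
  have := hco u; rewrite /col; case eu : (co u) => [[[[[a S] Tm] t] j]|].
    move=> hu; have [hv hj] := fwd _ _ _ _ _ hu; rewrite (coE _ _ hv).
    case: hu => h1 h2 h3 h4; rewrite h4 in hl; rewrite /hok /W.
    by rewrite !(bw_hok _ _ h1 h2 hj hl).
  move=> hnu.
  case ev : (co v) => [[[[[a S] Tm] t] j]|].
    have := hco v; rewrite ev => /bwd[j' [_ hu]].
    by case: hnu; exists (a, S, Tm, t, j').
  case: inXP => //= hu; case: inXP => //= hv.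
  apply/negP => h0; apply: hv; case: hu => a [t [j [ho eu']]].
  have E := okr_labE bf ho (_ : lab e l (pos e a t j)); rewrite -eu' in E.
  have {E} [E _] := E hl.
  have lr0 : lr l == 0 by case/and4P: hc => _ _ /eqP -> _.
  rewrite lr0 in E; have t0 : t = 0 by apply/eqP.
  subst t; exists a, 0, j.+1; apply: XR => //.
  by rewrite -eu'.
- move=> l l' u v r hl hl' hc.
  have hh : VV e u v by apply/VVP; exists l, l'.
  have bwd a S Tm t j : at_ v (a, S, Tm, t, j) -> exists t', t = t'.+1 /\ at_ u (a, S, Tm, t', j).
    case=> h1 h2 h3 h4; have E := okr_labE bf (rect_okr h1 h2 h3) (_ : lab e l' (pos e a t j)).
    rewrite -h4 in E; have {E} E := E hl'.
    case: t h2 h4 E => [|t] h2 h4 E; first by case/and3P: hc => _; rewrite E.1.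
    exists t; split=> //; split=> //; first exact: ltnW.
    apply: VV_inj bf _ _ _ hh _; rewrite h4.
    by case: h1 => _ [_ _ h] _; apply: h => //; lia.
  have fwd a S Tm t j : at_ u (a, S, Tm, t, j) -> at_ v (a, S, Tm, t.+1, j) /\ t < Tm.
    case=> h1 h2 h3 h4.
    have ht : t < Tm.
      have := rect_lr bf h1 h2 h3 (_ : lab e l (pos e a t j)); rewrite -h4 => /(_ hl).
      by case/and3P: hc => /negbTE -> _ _; lia.
    split=> //; split=> //.
    apply: VV_fun bf _ _ _ hh _; rewrite h4.
    by case: h1 => _ [_ _ h] _; apply: h => //; lia.
  have := hco u; rewrite /col; case eu : (co u) => [[[[[a S] Tm] t] j]|].
    move=> hu; have [hv ht] := fwd _ _ _ _ _ hu; rewrite (coE _ _ hv).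
    case: hu => h1 h2 h3 h4; rewrite /vok /W; have [_ hK] := hcond h1.
    by rewrite (bw_vok (hgs (a, S, Tm) h1) ht h3) (bw_vok hK ht h3).
  move=> hnu.
  case ev : (co v) => [[[[[a S] Tm] t] j]|].
    have := hco v; rewrite ev => /bwd[j' [_ hu]].
    by case: hnu; exists (a, S, Tm, j', j).
  case: inXP => //= hu; case: inXP => //= hv.
  apply/negP => h0; apply: hv; case: hu => a [t [j [ho eu']]].
  have E := okr_labE bf ho (_ : lab e l (pos e a t j)); rewrite -eu' in E.
  have {E} [_ E] := E hl.
  have lc0 : lc l == 0 by case/and3P: hc => _ _ /eqP ->.
  rewrite lc0 in E; have j0 : j = 0 by apply/eqP.
  subst j; exists a, t.+1, 0.
  have ev' : v = pos e a t.+1 0 by rewrite posD0 -eu' (sD_ok bf hh).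
  split=> //; case: ho => h1 h2 h3; split=> // t' j' ht; rewrite leqn0 => /eqP ->.
  by have [->|nt] := eqVneq t' t; [rewrite -eu' -ev'|apply: h3 => //; lia].
- move=> w' w u v h1 h2 h3 h4; rewrite !colX => /inXP hw /inXP hu; apply/inXP.
  case: hw => a [t [j1 [ho1 e1]]]; case: hu => a' [t1 [j [ho2 e2]]].
  case: j1 ho1 e1 => [|j1] ho1 e1.
    have /HHP[l [l' [_ _ hl' /and4P[_ hc _ _]]]] := h1.
    by have := okr_labE bf ho1 (_ : lab e l' (pos e a t 0)); rewrite -e1 => /(_ hl')[_]; rewrite (negbTE hc).
  case: t1 ho2 e2 => [|t1] ho2 e2.
    have /VVP[l [l' [_ _ hl' /and3P[_ hc _]]]] := h2.
    by have := okr_labE bf ho2 (_ : lab e l' (pos e a' 0 j)); rewrite -e2 => /(_ hl')[]; rewrite (negbTE hc).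
  (* The rectangles closed by [w] and by [u] both contain [w'], so they share start and coordinates;
     together with the new corner they fill the next rectangle. *)
  have w1 : w' = pos e a t j1.
    apply: HH_inj bf _ _ _ h1 _; rewrite e1; case: (ho1) => _ h _; exact: h.
  have w2 : w' = pos e a' t1 j.
    apply: VV_inj bf _ _ _ h2 _; rewrite e2; case: (ho2) => _ _ h; exact: h.
  have [|q1 q2 q3] := okr_uniq bf (okr_sub ho1 (leqnn t) (leqnSn j1)) (okr_sub ho2 (leqnSn t1) (leqnn j)).
    by rewrite -w1.
  subst a' t1 j1; case: (ho1) => _ o1 o2; case: (ho2) => _ o3 o4.
  exists a, t.+1, j.+1; apply: XR => //.
  + by rewrite -e2.
  + move=> t' ht'; have [q|q] := eqVneq t' t; last by apply: o2 => //; lia.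
    by rewrite q -e1 (_ : pos e a t.+1 j.+1 = v) // posR -e2 (sR_ok bf h3).
  + by move=> t' ht'; apply: o1 => //; lia.
Qed.
End Backward.

Theorem coloringP (U K : TM) (T : finType) (e : rel T) :
  (exists col, @good U K T e col) <->
  banfree e /\ forall u S Tm, rect e u S Tm -> cond U K (yof e u S) S Tm.
Proof.
split; last by case=> bf hc; apply: coloring_exists.
case=> col gd; split; first by case: gd.
by move=> u S Tm hr; exact: (@fw_cond U K T e col gd u S Tm hr).
Qed.

(** * Verifier and clock *)

Lemma halted_same (M : TM) (c : config M) t t' : tm_halt (cfg_st (tm_run t c)) ->
  tm_halt (cfg_st (tm_run t' c)) -> tm_run t c = tm_run t' c.
Proof.
move=> h h'; have [hl|hl] := leqP t t'; first by rewrite (run_halted h hl).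
by rewrite (run_halted h' (ltnW hl)).
Qed.

(** The tape grows only when the head steps onto a new last cell, and then all older cells are on
    its left, where the hypothesis bounds their number. *)
Lemma tape_space (M : TM) z S t : size z <= S ->
  (forall t', t' <= t -> size (cfg_left (tm_run t' (tm_init M z))) < S) ->
  size (cfg_left (tm_run t (tm_init M z))) + size (cfg_right (tm_run t (tm_init M z))) < S.
Proof.
move=> hz; elim: t => [|t IH] h.
  have := h 0 isT; case: z hz {h} => [|b z] //= hz _; by rewrite size_map.
have := IH (fun t' ht => h t' (leqW ht)); have := h t.+1 (leqnn _).
rewrite /tm_run iterS -/(tm_run t _); case: (tm_run t _) => q l a r; rewrite /tm_step /=.
case: (tm_halt q) => //=; case: (tm_delta q a) => [[q' w] []].
  by case: r => [|b r] /=; lia.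
by case: l => [|b l] /=; lia.
Qed.

Lemma size_read_out s : size (read_out s) <= size s.
Proof. by elim: s => //= [[b|]] s IH. Qed.

(** An accepting run of the clock holds its long output on at most [S] cells, and a tape can grow
    only by one cell per step; so both [S] and [T] exceed what the verifier needs with any
    admissible witness. Conversely acceptance by the clock fixes the input as an encoding, and the
    verifier then yields membership. *)
Theorem machines_exist (L : language) : in_NP L -> exists (U K : TM) (cK kK : nat),
  [/\ forall y S T, size y <= S -> (cond U K y S T <-> accb K y S T /\ exists x, y = enc1 x /\ L x),
      forall y S T, size y <= S -> accb K y S T -> exists x, y = enc1 x &
      forall x S T, cK * (size (enc1 x)).+1 ^ kK <= T -> T < S -> accb K (enc1 x) S T].
Proof.
case=> V0 [c0 [k0 [hV hL]]].
have [fU [[U [cU [kU hU]]] hfU]] := @verifier_inP c0 k0 V0 hV.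
(* With [N = (size y).+1], the length of input and witness stays below [A * N ^ k0.+1]. The bound
   [cP * N ^ kP] covers this length, the time of the verifier on it, and one further [N]. *)
pose A := 2 * c0 + 3; pose cP := 2 * A + cU * A ^ kU; pose kP := k0.+1 * kU.+1.
have hcP : 0 < cP by rewrite /cP /A; lia.
have [K [cK [kK hK]]] := @clockf_poly cP kP hcP isT.
exists U, K, cK, kK.
have accK y S T : size y <= S -> accb K y S T ->
   (exists x, y = enc1 x) /\ cP * (size y).+1 ^ kP <= minn S (size y + T).+1.
  move=> hy /and3P[/allP h1 h2 h3].
  have [t [ht [hh ho]]] := hK y.
  rewrite (halted_same hh h2) /tm_output in ho.
  have hne : clockf cP kP y != [::] by rewrite -ho; move: h3; case: (cfg_cur _) => [[]|].
  move: ho hne; rewrite /clockf; case: asboolP => // hx ho _; split=> //.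
  rewrite -(size_nseq (cP * _) true) -ho.
  apply: leq_trans (size_read_out _) _; rewrite /= leq_min; apply/andP; split.
    apply: leq_ltn_trans (leq_addl (size (cfg_left (tm_run T (tm_init K y)))) _) _.
    by apply: tape_space => // t' ht'; apply: h1; rewrite mem_iota; lia.
  by rewrite ltnS; apply: leq_trans (leq_addl _ _) (tape_size _ _ _).
split; last first.
- move=> x S T hT hS; have [t [ht [hh ho]]] := hK (enc1 x).
  apply/and3P; split.
  + by apply/allP => u; rewrite mem_iota => hu; apply: leq_ltn_trans (left_size _ _ _) _; lia.
  + by rewrite (run_halted hh (leq_trans ht hT)).
  + rewrite (run_halted hh (leq_trans ht hT)).
    move: ho; rewrite /clockf /tm_output; case: asboolP => [_|[]]; last by exists x.
    have : 0 < cP * (size (enc1 x)).+1 ^ kP by rewrite muln_gt0 hcP expn_gt0.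
    by case: (cP * _) => // n _ /=; case: (cfg_cur _) => [[]|].
- by move=> y S T hy /(accK _ _ _ hy) [].
move=> y S T hy; split.
  case=> [[v [hv hU']] hK']; split=> //.
  have [[x ex] _] := accK y S T hy hK'.
  exists x; split=> //.
  case/and3P: hU' => _ h2 h3; have [t [ht [hh ho]]] := hU (y ++ v).
  rewrite (halted_same hh h2) /tm_output in ho.
  have [[x' [w [ez hw]]] hVz] : ((exists x w, y ++ v = enc_list [:: x; w] /\ size w <= c0 * (size x).+1 ^ k0) /\ V0 (y ++ v)).
    apply: contrapT => /(proj2 (hfU (y ++ v))); rewrite -ho.
    by move: h3; case: (cfg_cur _) => [[]|].
  have : x = x' /\ v = enc1 w by apply: enc1_inj; rewrite -ex ez enc_list2.
  case=> exx _; subst x'; apply/hL; exists w; split=> //.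
  by rewrite -ez.
case=> hK' [x [ex /hL [w [hw hVz]]]]; split=> //.
have [_ hP] := accK y S T hy hK'.
exists (enc1 w); set z := y ++ enc1 w.
have ez : z = enc_list [:: x; w] by rewrite enc_list2 /z ex.
have sz : size z = size y + (2 * size w + 2) by rewrite size_cat size_enc1.
have sxy : size x <= size y by rewrite ex size_enc1; lia.
set N := (size y).+1 in hP.
have h1 : (size z).+1 <= A * N ^ k0.+1.
  have hw' : size w <= c0 * N ^ k0.
    by apply: leq_trans hw _; rewrite leq_mul2l leq_expl ?orbT // /N; lia.
  rewrite sz /A expnS; have : 0 < N ^ k0 by rewrite expn_gt0.
  rewrite /N; move: (_ ^ k0) hw' => e hw' he; nia.
have [t [ht [hh ho]]] := hU z.
have h2 : t <= cU * A ^ kU * N ^ (k0.+1 * kU).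
  by apply: leq_trans ht _; rewrite -mulnA leq_mul2l expnM -expnMn leq_expl ?orbT.
have h3 : (size z).+1 + t + N <= cP * N ^ kP.
  have hN : N <= A * N ^ k0.+1 by apply: leq_trans _ h1; rewrite sz /N; lia.
  have e1 : N ^ k0.+1 <= N ^ kP by rewrite leq_pexp2l // /kP leq_pmulr.
  have e2 : N ^ (k0.+1 * kU) <= N ^ kP by rewrite leq_pexp2l // /kP leq_mul2l leqnSn.
  have e3 : A * N ^ k0.+1 <= A * N ^ kP by rewrite leq_mul2l e1 orbT.
  have e4 : cU * A ^ kU * N ^ (k0.+1 * kU) <= cU * A ^ kU * N ^ kP by rewrite leq_mul2l e2 orbT.
  rewrite /cP mulnDl; lia.
have hS : (size z).+1 + t + N <= S by apply: leq_trans h3 (leq_trans hP (geq_minl _ _)).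
(* The extra [N] cancels [(size y).+1] on the right, which leaves [t <= T]. *)
have hT : (size z).+1 + t + N <= (size y + T).+1 by apply: leq_trans h3 (leq_trans hP (geq_minr _ _)).
split; first by rewrite -size_cat -/z; lia.
have htT : t <= T by rewrite /N in hT; lia.
have hf : fU z = [:: true].
  apply: (proj1 (hfU z)); split; last by rewrite ez.
  by exists x, w.
apply/and3P; split.
- apply/allP => u _; have [hu|hu] := leqP u t.
    by apply: leq_ltn_trans (left_size _ _ _) _; lia.
  by rewrite (run_halted hh (ltnW hu)); apply: leq_ltn_trans (left_size _ _ _) _; lia.
- by rewrite (run_halted hh htT).
- rewrite (run_halted hh htT); move: ho; rewrite hf /tm_output.
  by rewrite /=; case: (cfg_cur _) => [[]|].
Qed.

(** * The grid graph of an input *)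

(* The grid with Q+1 rows and columns: cell i = t * (Q+1) + j.  Vertex 307 i is
   the cell itself; gadget g < 3 (right, down, label) of cell i has the vertices
   a = 1 + 102 g, b = 2 + 102 g, 66 possible leaves at a and 34 at b. *)
Definition cls Q k := if k == 0 then 0 else if k == Q then 2 else 1.
Definition cbit (y : seq bool) (t j : nat) : nat :=
  if t == 0 then (if j < size y then nat_of_bool (nth false y j) else 2) else 0.
Definition clab (y : seq bool) Q i :=
  2 + 9 * cls Q (i %/ Q.+1) + 3 * cls Q (i %% Q.+1) + cbit y (i %/ Q.+1) (i %% Q.+1).
Definition gtau y Q g i := if g == 2 then clab y Q i else g.
Definition link Q g i i' :=
  if g == 0 then (i %% Q.+1 < Q) && (i' == i.+1)
  else if g == 1 then (i' == i + Q.+1) && (i' < Q.+1 * Q.+1) else i' == i.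

(** Besides the two path neighbours, [38 + tau] leaves give [a] the degree [40 + tau] and [34 - tau]
    leaves give a linked [b] the degree [36 - tau]. Slots that are not filled remain isolated
    vertices, so that all cells have the same layout of [307 = 1 + 3 * 102] vertices. *)
Definition hg y Q g i r i' r' :=
  [|| [&& i' == i, r == 0 & r' == 1 + 102 * g],
      [&& i' == i, r == 1 + 102 * g & r' == 2 + 102 * g],
      [&& r == 2 + 102 * g, r' == 0 & link Q g i i'],
      [&& i' == i, r == 1 + 102 * g, 3 + 102 * g <= r' & r' < 41 + 102 * g + gtau y Q g i] |
      [&& i' == i, r == 2 + 102 * g, 69 + 102 * g <= r' & r' < 103 + 102 * g - gtau y Q g i]].
Definition ghalf y Q p q := has (fun g => hg y Q g (p %/ 307) (p %% 307) (q %/ 307) (q %% 307)) (iota 0 3).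
Definition gadj y Q p q := ghalf y Q p q || ghalf y Q q p.
Definition gsize Q := 307 * (Q.+1 * Q.+1).

Section GridGraph.
Variables (y : seq bool) (Q : nat).
Hypothesis hQ : 0 < Q.
Hypothesis hy : size y <= Q.+1.

Let N := Q.+1 * Q.+1.
Let T : finType := 'I_(gsize Q).
Definition ge : rel T := fun p q => gadj y Q p q.
Let e := ge.

Lemma gtau_lt g i : g < 3 -> gtau y Q g i < 29.
Proof.
move=> hg'; rewrite /gtau; case: ifP => _; last by lia.
rewrite /clab /cls /cbit; repeat case: ifP => _; try lia.
Qed.

Lemma divmod i r : r < 307 -> ((307 * i + r) %/ 307 = i) * ((307 * i + r) %% 307 = r).
Proof.
by move=> hr; rewrite mulnC divnMDl // modnMDl divn_small // modn_small // addn0.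
Qed.

Lemma halfP p q : ghalf y Q p q <->
  exists g i r i' r', [/\ g < 3, p = 307 * i + r, q = 307 * i' + r', r < 307 & r' < 307] /\ hg y Q g i r i' r'.
Proof.
split.
  case/hasP => g; rewrite mem_iota => hg' h; exists g, (p %/ 307), (p %% 307), (q %/ 307), (q %% 307).
  split; last by []. split; rewrite ?ltn_pmod //; last by rewrite mulnC -divn_eq.
  by rewrite mulnC -divn_eq.
move=> [g [i [r [i' [r' [[h1 -> -> h4 h5] h]]]]]]; apply/hasP; exists g; first by rewrite mem_iota.
by rewrite !divmod.
Qed.

Lemma hg_lt g i r i' r' : g < 3 -> hg y Q g i r i' r' -> (r < 307) * (r' < 307).
Proof.
move=> hg'; have := gtau_lt i hg'; rewrite /hg; move: (gtau _ _ _ _) => k hk.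
case/or4P => [/and3P[b1 b2 b3]|/and3P[b1 b2 b3]|/and3P[b1 b2 b3]|/orP[/and4P[b1 b2 b3 b4]|/and4P[b1 b2 b3 b4]]]; split; lia.
Qed.

Lemma ge_sym : symmetric e. Proof. by move=> p q; rewrite /e /ge /gadj orbC. Qed.
Lemma ge_irr : irreflexive e.
Proof.
move=> p; rewrite /e /ge /gadj orbb; apply/negP => /hasP[g]; rewrite mem_iota => hg'.
by rewrite /hg; case/or4P => [/and3P[b1 b2 b3]|/and3P[b1 b2 b3]|/and3P[b1 b2 b3]|/orP[/and4P[b1 b2 b3 b4]|/and4P[b1 b2 b3 b4]]]; lia.
Qed.

Lemma deg_le (v : T) (l : seq nat) : (forall w : T, e v w -> (w : nat) \in l) -> deg e v <= size l.
Proof.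
move=> h; rewrite /deg cardE -(size_map val).
apply: uniq_leq_size; first by rewrite map_inj_uniq ?enum_uniq //; apply: val_inj.
by move=> k /mapP[w]; rewrite mem_enum inE => hw ->; apply: h.
Qed.
Lemma deg_ge (v : T) (l : seq nat) : uniq l ->
  (forall k, k \in l -> k < gsize Q /\ gadj y Q v k) -> size l <= deg e v.
Proof.
move=> hu h; rewrite /deg cardE -(size_map val); apply: uniq_leq_size => // k hk.
have [hlt ha] := h k hk; apply/mapP; exists (Ordinal hlt) => //.
by rewrite mem_enum.
Qed.

(** The three own [a] vertices, the [b] of the own label loop, and the [b] vertices that link from
    the left and from the upper cell. *)
Lemma nb_root i (v w : T) : (v : nat) = 307 * i -> e v w ->
  (w : nat) \in [:: 307 * i + 1; 307 * i + 103; 307 * i + 205; 307 * i + 206;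
             307 * i.-1 + 2; 307 * (i - Q.+1) + 104].
Proof.
move=> hv; rewrite /e /ge /gadj hv => /orP[]/halfP[g [a [r [a' [r' [[h1 h2 h3 h4 h5]]]]]]].
  have [ea er] : a = i /\ r = 0 by lia.
  subst a r; rewrite h3 !inE /hg; case/or4P => [/and3P[b1 b2 b3]|/and3P[b1 b2 b3]|/and3P[b1 b2 b3]|/orP[/and4P[b1 b2 b3 b4]|/and4P[b1 b2 b3 b4]]]; try lia.
have [ea er] : a' = i /\ r' = 0 by lia.
subst a' r'; rewrite h2 !inE /hg; case/or4P => [/and3P[b1 b2 b3]|/and3P[b1 b2 b3]|/and3P[b1 b2 b3]|/orP[/and4P[b1 b2 b3 b4]|/and4P[b1 b2 b3 b4]]]; try lia.
move: b3; rewrite /link; have : g = 0 \/ g = 1 \/ g = 2 by lia.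
by move=> [|[|]] eg; subst g => /=; lia.
Qed.

Lemma nb_a g i (v w : T) : g < 3 -> (v : nat) = 307 * i + (1 + 102 * g) -> e v w ->
  (w : nat) \in [:: 307 * i; 307 * i + (2 + 102 * g)] ++
     iota (307 * i + (3 + 102 * g)) (38 + gtau y Q g i).
Proof.
move=> hg' hv; rewrite /e /ge /gadj hv => /orP[]/halfP[g1 [a [r [a' [r' [[h1 h2 h3 h4 h5]]]]]]].
  have [ea er] : a = i /\ r = 1 + 102 * g by lia.
  subst a r; rewrite h3 mem_cat !inE mem_iota /hg; case/or4P => [/and3P[b1 b2 b3]|/and3P[b1 b2 b3]|/and3P[b1 b2 b3]|/orP[/and4P[b1 b2 b3 b4]|/and4P[b1 b2 b3 b4]]]; try lia.
  have eg : g1 = g by lia.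
  subst g1; lia.
have [ea er] : a' = i /\ r' = 1 + 102 * g by lia.
subst a' r'; rewrite h2 mem_cat !inE mem_iota /hg.
have := gtau_lt a h1; move: (gtau _ _ g1 a) => k hk.
case/or4P => [/and3P[b1 b2 b3]|/and3P[b1 b2 b3]|/and3P[b1 b2 b3]|/orP[/and4P[b1 b2 b3 b4]|/and4P[b1 b2 b3 b4]]]; lia.
Qed.

Definition tgt g i := if g == 0 then i.+1 else if g == 1 then i + Q.+1 else i.
Lemma link_tgt g i i' : g < 3 -> link Q g i i' -> i' = tgt g i.
Proof.
by move=> h; rewrite /link /tgt; do 2?[case: ifP => _]; [case/andP => _ /eqP|case/andP => /eqP|move/eqP].
Qed.

Lemma nb_b g i (v w : T) : g < 3 -> (v : nat) = 307 * i + (2 + 102 * g) -> e v w ->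
  ((w : nat) \in [:: 307 * i + (1 + 102 * g)] ++ iota (307 * i + (69 + 102 * g)) (34 - gtau y Q g i)) \/
  (exists i', (w : nat) = 307 * i' /\ link Q g i i').
Proof.
move=> hg' hv; rewrite /e /ge /gadj hv => /orP[]/halfP[g1 [a [r [a' [r' [[h1 h2 h3 h4 h5]]]]]]].
  have [ea er] : a = i /\ r = 2 + 102 * g by lia.
  subst a r; rewrite h3 mem_cat !inE mem_iota /hg; case/or4P => [/and3P[b1 b2 b3]|/and3P[b1 b2 b3]|/and3P[b1 b2 b3]|/orP[/and4P[b1 b2 b3 b4]|/and4P[b1 b2 b3 b4]]]; try lia.
    have eg : g1 = g by lia.
    by subst g1; right; exists a'; split=> //; lia.
  have eg : g1 = g by lia.
  subst g1; left; lia.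
have [ea er] : a' = i /\ r' = 2 + 102 * g by lia.
subst a' r'; rewrite h2 mem_cat !inE mem_iota /hg.
have := gtau_lt a h1; move: (gtau _ _ g1 a) => k hk.
case/or4P => [/and3P[b1 b2 b3]|/and3P[b1 b2 b3]|/and3P[b1 b2 b3]|/orP[/and4P[b1 b2 b3 b4]|/and4P[b1 b2 b3 b4]]]; left; lia.
Qed.

(** The offset [r.-1 %% 102] inside the gadget is 0 for [a] and 1 for [b]; below 68 a leaf hangs at
    [a], from 68 on at [b]. *)
Lemma nb_leaf i r (v w : T) : (v : nat) = 307 * i + r -> r < 307 -> r %% 102 \notin [:: 1; 2] -> 0 < r ->
  e v w -> (w : nat) = 307 * i + r - (r.-1 %% 102) + (if r.-1 %% 102 < 68 then 0 else 1).
Proof.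
move=> hv hr hm h0; rewrite /e /ge /gadj hv => /orP[]/halfP[g1 [a [q [a' [q' [[h1 h2 h3 h4 h5]]]]]]].
  have [ea er] : a = i /\ q = r by lia.
  subst a q; move: hm; rewrite !inE /hg => hm.
  by case/or4P => [/and3P[b1 b2 b3]|/and3P[b1 b2 b3]|/and3P[b1 b2 b3]|/orP[/and4P[b1 b2 b3 b4]|/and4P[b1 b2 b3 b4]]]; exfalso; move: hm; rewrite -?lock; lia.
have [ea er] : a' = i /\ q' = r by lia.
subst a' q'; have := gtau_lt a h1; move: hm; rewrite !inE /hg; move: (gtau _ _ g1 a) => k hm hk.
case/or4P => [/and3P[b1 b2 b3]|/and3P[b1 b2 b3]|/and3P[b1 b2 b3]|/orP[/and4P[b1 b2 b3 b4]|/and4P[b1 b2 b3 b4]]]; try (exfalso; lia).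
  have em : r.-1 %% 102 = r.-1 - 102 * g1.
    have hh : r.-1 = g1 * 102 + (r.-1 - 102 * g1) by lia.
    by rewrite {1}hh modnMDl modn_small //; lia.
  rewrite em; case: ltnP; lia.
have em : r.-1 %% 102 = r.-1 - 102 * g1.
  have hh : r.-1 = g1 * 102 + (r.-1 - 102 * g1) by lia.
    by rewrite {1}hh modnMDl modn_small //; lia.
rewrite em; case: ltnP; lia.
Qed.

Lemma deg_root i (v : T) : (v : nat) = 307 * i -> deg e v <= 6.
Proof. by move=> hv; apply: leq_trans (deg_le (fun w => nb_root hv)) _. Qed.

Lemma deg_leaf i r (v : T) : (v : nat) = 307 * i + r -> r < 307 -> r %% 102 \notin [:: 1; 2] -> 0 < r ->
  deg e v <= 1.
Proof.
move=> hv hr hm h0.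
apply: (@deg_le v [:: 307 * i + r - (r.-1 %% 102) + (if r.-1 %% 102 < 68 then 0 else 1)]) => w hw.
by rewrite (nb_leaf hv hr hm h0 hw) inE.
Qed.

Lemma deg_a g i (v : T) : g < 3 -> (v : nat) = 307 * i + (1 + 102 * g) -> deg e v <= 40 + gtau y Q g i.
Proof.
move=> hg' hv; apply: leq_trans (deg_le (fun w => nb_a hg' hv)) _.
by rewrite size_cat size_iota.
Qed.

Lemma deg_b g i (v : T) : g < 3 -> (v : nat) = 307 * i + (2 + 102 * g) -> deg e v <= 36 - gtau y Q g i.
Proof.
move=> hg' hv.
pose l := [:: 307 * tgt g i; 307 * i + (1 + 102 * g)] ++ iota (307 * i + (69 + 102 * g)) (34 - gtau y Q g i).
apply: (@leq_trans (size l)); last by rewrite size_cat size_iota /=; have := gtau_lt i hg'; lia.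
apply: deg_le => w hw; rewrite /l mem_cat in_cons.
have [|[i' [-> /(link_tgt hg') ->]]] := nb_b hg' hv hw; last by rewrite eqxx.
by rewrite mem_cat => /orP[->|->]; rewrite ?orbT.
Qed.

Lemma kind (v : T) : exists i, i < N /\ ((v : nat) = 307 * i \/
  (exists g, g < 3 /\ (v : nat) = 307 * i + (1 + 102 * g)) \/
  (exists g, g < 3 /\ (v : nat) = 307 * i + (2 + 102 * g)) \/ deg e v <= 1).
Proof.
have hv := ltn_ord v; rewrite /gsize -/N in hv.
set i := v %/ 307; set r := v %% 307.
have ev : (v : nat) = 307 * i + r by rewrite /i /r mulnC -divn_eq.
have hr : r < 307 by rewrite ltn_pmod.
exists i; split; first by rewrite /i ltn_divLR // mulnC.
have [r0|r0] := posnP r; first by left; rewrite ev r0 addn0.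
right; have [h1|h1] := eqVneq (r %% 102) 1.
  left; exists (r %/ 102); have := divn_eq r 102; rewrite h1 => hr'.
  by split; lia.
right; have [h2|h2] := eqVneq (r %% 102) 2.
  left; exists (r %/ 102); have := divn_eq r 102; rewrite h2 => hr'.
  by split; lia.
by right; apply: (deg_leaf ev) => //; rewrite !inE negb_or h1 h2.
Qed.

Lemma half_intro g i r i' r' : g < 3 -> hg y Q g i r i' r' -> ghalf y Q (307 * i + r) (307 * i' + r').
Proof.
move=> hg' h; have hl := hg_lt hg' h.
by apply/halfP; exists g, i, r, i', r'; split=> //; split; rewrite ?hl.1 ?hl.2.
Qed.

Lemma half_l g i i' r' : g < 3 -> hg y Q g i 0 i' r' -> ghalf y Q (307 * i) (307 * i' + r').
Proof. by move=> hg' h; have := half_intro hg' h; rewrite addn0. Qed.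
Lemma half_r g i r i' : g < 3 -> hg y Q g i r i' 0 -> ghalf y Q (307 * i + r) (307 * i').
Proof. by move=> hg' h; have := half_intro hg' h; rewrite addn0. Qed.

Lemma deg_root_ge i (v : T) : i < N -> (v : nat) = 307 * i -> 2 <= deg e v.
Proof.
move=> hi hv; apply: (@deg_ge v [:: 307 * i + 1; 307 * i + 103]); first by rewrite /= inE; lia.
move=> k; rewrite !inE => /orP[/eqP ->|/eqP ->]; (split; first by rewrite /gsize -/N; lia);
  rewrite /gadj hv.
  by rewrite (@half_l 0 i i 1) //; rewrite /hg eqxx.
by rewrite (@half_l 1 i i 103) //; rewrite /hg eqxx.
Qed.

Lemma deg_a_ge g i (v : T) : g < 3 -> i < N -> (v : nat) = 307 * i + (1 + 102 * g) ->
  40 + gtau y Q g i <= deg e v.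
Proof.
move=> hg' hi hv; have ht := gtau_lt i hg'.
pose l := [:: 307 * i; 307 * i + (2 + 102 * g)] ++ iota (307 * i + (3 + 102 * g)) (38 + gtau y Q g i).
have -> : 40 + gtau y Q g i = size l by rewrite size_cat size_iota.
apply: deg_ge.
  rewrite cat_uniq iota_uniq andbT; apply/andP; split; first by rewrite /= inE; lia.
  by apply/hasPn => k; rewrite mem_iota !inE; lia.
move=> k; rewrite mem_cat mem_iota !inE => hk; split; first by rewrite /gsize -/N; lia.
rewrite /gadj hv; have [e1|n1] := eqVneq k (307 * i).
  by rewrite e1 (@half_l g i i (1 + 102 * g)) ?orbT // /hg !eqxx.
pose r := k - 307 * i; have -> : k = 307 * i + r by rewrite /r; lia.
rewrite (@half_intro g i _ i r) // /hg !eqxx /=.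
by move: hk n1; rewrite /r; lia.
Qed.

Lemma deg_b_ge g i i' (v : T) : g < 3 -> i < N -> i' < N -> link Q g i i' ->
  (v : nat) = 307 * i + (2 + 102 * g) -> 36 - gtau y Q g i <= deg e v.
Proof.
move=> hg' hi hi' hl hv; have ht := gtau_lt i hg'.
pose l := [:: 307 * i'; 307 * i + (1 + 102 * g)] ++ iota (307 * i + (69 + 102 * g)) (34 - gtau y Q g i).
have -> : 36 - gtau y Q g i = size l by rewrite size_cat size_iota /=; lia.
apply: deg_ge.
  rewrite cat_uniq iota_uniq andbT; apply/andP; split; first by rewrite /= inE; lia.
  by apply/hasPn => k; rewrite mem_iota !inE; lia.
move=> k; rewrite mem_cat mem_iota !inE => hk; split; first by rewrite /gsize -/N; lia.
rewrite /gadj hv; have [e1|n1] := eqVneq k (307 * i').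
  by rewrite e1 (@half_r g i _ i') // /hg !eqxx hl !orbT.
have [e2|n2] := eqVneq k (307 * i + (1 + 102 * g)).
  by rewrite e2 (@half_intro g i (1 + 102 * g) i) ?orbT // /hg !eqxx orbT.
pose r := k - 307 * i; have -> : k = 307 * i + r by rewrite /r; lia.
rewrite (@half_intro g i _ i r) // /hg !eqxx /=.
by move: hk n1 n2; rewrite /r; move: (gtau _ _ _ _) => d; lia.
Qed.

Lemma link_lt g i i' : g < 3 -> i < N -> link Q g i i' -> i' < N.
Proof.
move=> hg' hi; rewrite /link; do 2?[case: ifP => _]; last by move/eqP ->.
  case/andP => h /eqP ->; rewrite /N in hi *.
  have := divn_eq i Q.+1; have : i %/ Q.+1 < Q.+1 by rewrite ltn_divLR.
  by move: (i %/ _) (i %% _) h => a b h h1 ->; nia.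
by case/andP.
Qed.

(** Cells have degree at most 6, leaves at most 1 and [b] vertices at most 36, so only an [a] vertex
    reaches 40; and [36 - tau] is at least 8, which excludes a cell in the place of [b]. The path
    thus runs through one gadget, the demand of degree 2 excludes leaves as its ends, and the two
    degree bounds squeeze [tau] from both sides. *)
Lemma arcP tau (u v : T) : tau < 29 -> garc e tau u v <->
  exists g i i', [/\ g < 3, (u : nat) = 307 * i, (v : nat) = 307 * i', link Q g i i' & tau = gtau y Q g i].
Proof.
move=> ht; split.
  case/existsP => a /existsP[b /and5P[/and3P[ua ab bv] da db /andP[ub va] /andP[du dv]]].
  have [i [hi]] := kind a; case=> [ea|[[g [hg' ea]]|[[g [hg' ea]]|h]]].
  - by have := deg_root ea; lia.
  - have da' := deg_a hg' ea.
    have nb := nb_a hg' ea.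
    have leafd w : e a w -> 2 <= deg e w -> (w : nat) = 307 * i \/ (w : nat) = 307 * i + (2 + 102 * g).
      move=> aw dw; move: (nb w aw); rewrite mem_cat !inE mem_iota => /orP[/orP[/eqP ->|/eqP ->]|hw]; [by left|by right|].
      have hgt := gtau_lt i hg'.
      have [hd1 hd2 hd3 hd4] : [/\ (w : nat) = 307 * i + (w - 307 * i), w - 307 * i < 307, 0 < w - 307 * i &
          2 < w - 307 * i - 102 * g < 102 /\ (w : nat) - 307 * i = g * 102 + (w - 307 * i - 102 * g)].
        by clear - hw hgt hg'; move: (nat_of_ord w) (gtau _ _ _ _) hw hgt => p q hw hgt; split; lia.
      have hr : ((w : nat) - 307 * i) %% 102 \notin [:: 1; 2].
        rewrite hd4.2 modnMDl !inE modn_small; last by case/andP: hd4.1.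
        by case/andP: hd4.1 => h _; clear - h; lia.
      by have := deg_leaf hd1 hd2 hr hd3; rewrite leqNgt dw.
    have eb : (b : nat) = 307 * i + (2 + 102 * g).
      have [] // := leafd b ab (ltac:(lia)) => eb; have := deg_root eb; lia.
    have db' := deg_b hg' eb.
    have htau : tau = gtau y Q g i by have := gtau_lt i hg'; lia.
    have eu : (u : nat) = 307 * i.
      have [] // := leafd u (_ : e a u) du; first by rewrite ge_sym.
      by move=> eu; case/eqP: ub; apply: val_inj; rewrite /= eu eb.
    have [|[i' [ev hl]]] := nb_b hg' eb bv; last by exists g, i, i'.
    rewrite mem_cat !inE mem_iota => /orP[/eqP ev|hw].
      by case/eqP: va; apply: val_inj; rewrite /= ev ea.
    have hr : ((v : nat) - 307 * i) %% 102 \notin [:: 1; 2].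
      have [hlt|hge] := ltnP (v - 307 * i) (102 + 102 * g).
        have -> : (v : nat) - 307 * i = g * 102 + (v - 307 * i - 102 * g) by lia.
        by rewrite modnMDl !inE modn_small; lia.
      have -> : (v : nat) - 307 * i = g.+1 * 102 + (v - 307 * i - 102 * g.+1) by lia.
      by rewrite modnMDl !inE modn_small; lia.
    by have := @deg_leaf i (v - 307 * i) v (ltac:(lia)) (ltac:(lia)) hr (ltac:(lia)); lia.
  - by have := deg_b hg' ea; lia.
  - by lia.
move=> [g [i [i' [hg' eu ev hl et]]]].
have hi : i < N by have := ltn_ord u; rewrite eu /gsize -/N; lia.
have hi' := link_lt hg' hi hl.
have ha : 307 * i + (1 + 102 * g) < gsize Q by rewrite /gsize -/N; lia.
have hb : 307 * i + (2 + 102 * g) < gsize Q by rewrite /gsize -/N; lia.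
apply/existsP; exists (Ordinal ha); apply/existsP; exists (Ordinal hb).
apply/and5P; split; first 1 last.
- by rewrite et; apply: (@deg_a_ge g i).
- by rewrite et; apply: (@deg_b_ge g i i').
- by apply/andP; split; apply/negP => /eqP /(congr1 val) /=; rewrite ?eu ?ev; lia.
- by rewrite (deg_root_ge hi eu) (deg_root_ge hi' ev).
apply/and3P; split; rewrite /e /ge /gadj /= ?eu ?ev.
- by apply/orP; left; apply: (half_l hg'); rewrite /hg; lia.
- by apply/orP; left; apply: (half_intro hg'); rewrite /hg; lia.
- by apply/orP; left; apply: (half_r hg'); rewrite /hg hl; lia.
Qed.
End GridGraph.

(** * The single complete grid of the grid graph *)

Section GridStructure.
Variables (y : seq bool) (Q : nat).
Hypothesis hQ : 0 < Q.
Hypothesis hy : size y <= Q.+1.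

Let N := Q.+1 * Q.+1.
Let T : finType := 'I_(gsize Q).
Let e := @ge y Q.

Definition li i : lbl := (inord (cls Q (i %/ Q.+1)), inord (cls Q (i %% Q.+1)),
  inord (cbit y (i %/ Q.+1) (i %% Q.+1))).

Lemma cls_lt k : cls Q k < 3. Proof. by rewrite /cls; do 2?case: ifP. Qed.
Lemma cbit_lt t j : cbit y t j < 3.
Proof. by rewrite /cbit; do 2?case: ifP => // _; case: nth. Qed.
Lemma lr_li i : lr (li i) = cls Q (i %/ Q.+1). Proof. by rewrite /lr /= inordK // cls_lt. Qed.
Lemma lc_li i : lc (li i) = cls Q (i %% Q.+1). Proof. by rewrite /lc /= inordK // cls_lt. Qed.
Lemma lb_li i : lb (li i) = cbit y (i %/ Q.+1) (i %% Q.+1). Proof. by rewrite /lb /= inordK // cbit_lt. Qed.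
Lemma ltau_li i : ltau (li i) = clab y Q i. Proof. by rewrite /ltau lr_li lc_li lb_li. Qed.

Lemma ltau_inj : injective ltau.
Proof.
move=> [[a b] c] [[a' b'] c']; rewrite /ltau /lr /lc /lb /= => h.
have := ltn_ord a; have := ltn_ord b; have := ltn_ord c.
have := ltn_ord a'; have := ltn_ord b'; have := ltn_ord c' => h1 h2 h3 h4 h5 h6.
congr (_, _, _); apply: val_inj => /=; lia.
Qed.

Lemma arc0P (u v : T) : garc e 0 u v <-> exists i, (u : nat) = 307 * i /\ (v : nat) = 307 * i.+1 /\ i %% Q.+1 < Q.
Proof.
rewrite arcP //; split.
  move=> [g [i [i' [hg eu ev hl ht]]]]; exists i.
  have g0 : g = 0 by move: ht; rewrite /gtau; case: eqP => // _; rewrite /clab; lia.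
  by subst g; move: hl; rewrite /link /= => /andP[h /eqP <-].
move=> [i [eu [ev h]]]; exists 0, i, i.+1; split=> //.
by rewrite /link /= h eqxx.
Qed.
Lemma arc1P (u v : T) : garc e 1 u v <-> exists i, (u : nat) = 307 * i /\ (v : nat) = 307 * (i + Q.+1).
Proof.
rewrite arcP //; split.
  move=> [g [i [i' [hg eu ev hl ht]]]]; exists i.
  have g1 : g = 1 by move: ht; rewrite /gtau; case: eqP => // _; rewrite /clab; lia.
  by subst g; move: hl; rewrite /link /= => /andP[/eqP <- _].
move=> [i [eu ev]]; exists 1, i, (i + Q.+1); split=> //.
rewrite /link /= eqxx /=; have := ltn_ord v; rewrite ev /gsize; lia.
Qed.
Lemma labP l (u : T) : lab e l u <-> exists i, (u : nat) = 307 * i /\ l = li i.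
Proof.
rewrite /lab arcP //; last exact: ltau_lt.
split.
  move=> [g [i [i' [hg eu ev hl ht]]]]; exists i; split=> //.
  have g2 : g = 2 by move: ht; rewrite /gtau; case: eqP => // _; rewrite /ltau; lia.
  by subst g; apply: ltau_inj; rewrite ltau_li.
move=> [i [eu ->]]; exists 2, i, i; split=> //; first by rewrite /link /=.
by rewrite ltau_li.
Qed.

Lemma grid_banfree : banfree e.
Proof.
split.
- move=> [|[|//]] u v v' _.
    move=> /arc0P[i [e1 [e2 _]]] /arc0P[i' [e1' [e2' _]]]; apply: val_inj => /=; lia.
  move=> /arc1P[i [e1 e2]] /arc1P[i' [e1' e2']]; apply: val_inj => /=; lia.
- move=> [|[|//]] u u' v _.
    move=> /arc0P[i [e1 [e2 _]]] /arc0P[i' [e1' [e2' _]]]; apply: val_inj => /=; lia.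
  move=> /arc1P[i [e1 e2]] /arc1P[i' [e1' e2']]; apply: val_inj => /=; lia.
- move=> l l' u /labP[i [e1 ->]] /labP[i' [e1' ->]]; congr li; lia.
Qed.

Lemma root_lt i : i < N -> 307 * i < gsize Q.
Proof. by rewrite /gsize -/N; lia. Qed.

Lemma cell_dm t j : j < Q.+1 -> ((t * Q.+1 + j) %/ Q.+1 = t) * ((t * Q.+1 + j) %% Q.+1 = j).
Proof. by move=> hj; rewrite divnMDl // modnMDl divn_small // modn_small // addn0. Qed.

Lemma cell_lt t j : t <= Q -> j <= Q -> t * Q.+1 + j < N.
Proof. by rewrite /N => h1 h2; nia. Qed.

Lemma HH_grid t j (u v : T) : t <= Q -> j < Q -> (u : nat) = 307 * (t * Q.+1 + j) ->
  (v : nat) = 307 * (t * Q.+1 + j.+1) -> HH e u v.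
Proof.
move=> ht hj eu ev; apply/HHP; exists (li (t * Q.+1 + j)), (li (t * Q.+1 + j.+1)).
have [d1 m1] := cell_dm t (ltnW hj : j < Q.+1); have [d2 m2] := cell_dm t (hj : j.+1 < Q.+1).
split.
- by apply/arc0P; exists (t * Q.+1 + j); rewrite m1 eu ev addnS.
- by apply/labP; exists (t * Q.+1 + j).
- by apply/labP; exists (t * Q.+1 + j.+1).
rewrite /hcomp !lc_li !lr_li !lb_li d1 d2 m1 m2 eqxx /=.
have -> : cls Q j != 2 by rewrite /cls; case: (j == 0) => //; rewrite (_ : (j == Q) = false) //; lia.
have -> : cls Q j.+1 != 0 by rewrite /cls /=; case: (j.+1 == Q).
apply/implyP => /andP[_]; rewrite /cbit; case: (t == 0) => //.
by case: ltnP => h; [case: nth|rewrite ltnNge (leq_trans h (leqnSn _))].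
Qed.

Lemma VV_grid t j (u v : T) : t < Q -> j <= Q -> (u : nat) = 307 * (t * Q.+1 + j) ->
  (v : nat) = 307 * (t.+1 * Q.+1 + j) -> VV e u v.
Proof.
move=> ht hj eu ev; apply/VVP; exists (li (t * Q.+1 + j)), (li (t.+1 * Q.+1 + j)).
have [d1 m1] := cell_dm t (hj : j < Q.+1); have [d2 m2] := cell_dm t.+1 (hj : j < Q.+1).
split.
- by apply/arc1P; exists (t * Q.+1 + j); split=> //; rewrite ev mulSn; lia.
- by apply/labP; exists (t * Q.+1 + j).
- by apply/labP; exists (t.+1 * Q.+1 + j).
rewrite /vcomp !lc_li !lr_li d1 d2 m1 m2 eqxx /=.
have -> : cls Q t != 2 by rewrite /cls; case: (t == 0) => //; rewrite (_ : (t == Q) = false) //; lia.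
by have -> : cls Q t.+1 != 0 by rewrite /cls /=; case: (t.+1 == Q).
Qed.

Lemma pos_grid (u : T) t j : (u : nat) = 0 -> t <= Q -> j <= Q ->
  (pos e u t j : nat) = 307 * (t * Q.+1 + j).
Proof.
move=> eu; have bf := grid_banfree; elim: j => [|j IH] ht hj.
  elim: t ht => [|t IH] ht; first by rewrite eu.
  rewrite posD0; pose w : T := Ordinal (root_lt (cell_lt ht hj)).
  by rewrite (sD_ok bf (_ : VV e _ w)) //; apply: (VV_grid (t := t) (j := 0)) => //; apply: IH; lia.
rewrite posR; pose w : T := Ordinal (root_lt (cell_lt ht hj)).
by rewrite (sR_ok bf (_ : HH e _ w)) //; apply: (HH_grid (t := t) (j := j)) => //; apply: IH; lia.
Qed.

Lemma start_grid (u : T) : startv e u = ((u : nat) == 0).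
Proof.
apply/existsP/eqP => [[l /and3P[/labP[i [eu ->]]]]|eu].
  have hi : i < N by have := ltn_ord u; rewrite eu /gsize -/N; lia.
  rewrite lr_li lc_li /cls; case: (eqVneq (i %/ Q.+1) 0) => [h1 _|]; last by case: (_ == Q).
  case: (eqVneq (i %% Q.+1) 0) => [h2 _|]; last by case: (_ == Q).
  by rewrite eu (divn_eq i Q.+1) h1 h2.
exists (li 0); rewrite lr_li lc_li div0n mod0n /cls eqxx !andbT.
by apply/labP; exists 0; rewrite eu.
Qed.

Lemma grid_rect (u : T) : (u : nat) = 0 -> rect e u Q.+1 Q /\ yof e u Q.+1 = y.
Proof.
move=> eu; have bf := grid_banfree.
have hr : rect e u Q.+1 Q.
  split=> //; first split.
  - by rewrite start_grid eu.
  - move=> t j ht hj; apply: (HH_grid (t := t) (j := j)) => //; first by apply: pos_grid => //; exact: ltnW.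
    exact: pos_grid.
  - move=> t j ht hj; apply: (VV_grid (t := t) (j := j)) => //; last exact: pos_grid.
    by apply: pos_grid => //; exact: ltnW.
  - apply/existsP; exists (li (Q * Q.+1 + Q)).
    have [d m] := cell_dm Q (ltnSn Q); rewrite lr_li lc_li d m /cls eqxx.
    rewrite (_ : (Q == 0) = false) ?eqxx ?andbT; last by lia.
    by apply/labP; exists (Q * Q.+1 + Q); rewrite pos_grid.
split=> //.
have [hs hb] := yof_ok bf hr; set z := yof e u Q.+1 in hs hb *.
have hv j : j < Q.+1 -> (if j < size z then Some (nth false z j) else None) =
   (if j < size y then Some (nth false y j) else None).
  move=> hj; rewrite -hb // (@vbitE _ _ bf (li j)); last first.
    by apply/labP; exists j; rewrite pos_grid.
  rewrite lb_li /cbit divn_small // modn_small //=.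
  by case: ltnP => // _; case: nth.
have hsz : size z = size y.
  apply/eqP; rewrite eqn_leq; apply/andP; split; rewrite leqNgt; apply/negP => hlt.
    by have := hv (size y) (leq_trans hlt hs); rewrite hlt ltnn.
  by have := hv (size z) (leq_trans hlt hy); rewrite hlt ltnn.
apply: (@eq_from_nth _ false) => // j hj.
have := hv j (leq_trans hj hs); rewrite hj -hsz hj; by case.
Qed.

(** Only vertex 0 is a start corner, and the dimensions of its grid are unique, so the condition
    over all grids shrinks to one instance. *)
Lemma grid_coloring (P : seq bool -> nat -> nat -> Prop) :
  (banfree e /\ forall u S Tm, rect e u S Tm -> P (yof e u S) S Tm) <-> P y Q.+1 Q.
Proof.
have bf := grid_banfree.
pose u0 : T := Ordinal (root_lt (cell_lt (leq0n Q) (leq0n Q))).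
have [hr ey] := @grid_rect u0 (erefl _).
split; first by case=> _ /(_ _ _ _ hr); rewrite ey.
move=> hP; split=> // u S Tm hr'.
have eu : u = u0.
  by case: (hr') => _ [+ _ _] _; rewrite start_grid => /eqP h; apply: val_inj; rewrite /= h.
by subst u; have [-> ->] := rect_uniq bf hr' hr; rewrite ey.
Qed.
End GridStructure.

(** * Computing the reduction *)

Lemma nth_enc1 x h : (nth false (enc1 x) (2 * h) = (h < size x)) *
  (nth false (enc1 x) (2 * h).+1 = nth false x h).
Proof.
elim: x h => [|b x IH] [|h] //; first by rewrite mulnS /enc1 /= !nth_nil.
by rewrite mulnS /=; apply: IH.
Qed.

Definition neT a b := NotT (EqT a b).
Lemma tevNot a s : tev (NotT a) s = ~~ tt a s.
Proof. by rewrite /tt /=; case: (tev a s). Qed.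
Lemma tevEq a b s : tev (EqT a b) s = (tev a s == tev b s).
Proof. by rewrite /EqT tevNot -ttNot -/(EqT a b) ttEq. Qed.
Lemma tevLe a b s : tev (LeT a b) s = (tev a s <= tev b s).
Proof. by rewrite /LeT tevNot -ttNot -/(LeT a b) ttLe. Qed.
Lemma tevAdd a b s : tev (Add a b) s = tev a s + tev b s. Proof. by []. Qed.
Lemma tevMul a b s : tev (Mul a b) s = tev a s * tev b s. Proof. by []. Qed.
Lemma tevSbt a b s : tev (Sbt a b) s = tev a s - tev b s. Proof. by []. Qed.
Lemma tevV i s : tev (V i) s = size (s i). Proof. by []. Qed.
Lemma tevC n s : tev (C n) s = n. Proof. by []. Qed.
Definition tevE := (tevEq, tevLe, tevNot, tevAdd, tevMul, tevSbt, tevV, tevC).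

(* stack 20 holds Q, 5 and 6 cell and residue of one vertex, 7 and 8 of the other,
   9 the gadget, 10 and 11 row and column of cell 5 *)
Definition clsT k := Mul (NotT (EqT k (C 0))) (Add (C 1) (EqT k (V 20))).
(** The bit of the encoded input at the column on stack 11, obtained from the raw input without
    building the encoding. The double negation turns a count into 0 or 1. *)
Definition ebitT := NotT (NotT (Cnt 12 (Mul (LtT (V 12) (V 2))
  (Add (EqT (V 11) (Mul (C 2) (V 12)))
       (Mul (EqT (V 11) (Add (C 1) (Mul (C 2) (V 12)))) (Bit 2 (V 12))))))).
Definition sizeT := Add (Mul (C 2) (V 2)) (C 2).
Definition cbitT := Mul (EqT (V 10) (C 0))
  (Add (Mul (LeT sizeT (V 11)) (C 2)) (Mul (NotT (LeT sizeT (V 11))) ebitT)).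
Definition clabT := Add (Add (Add (C 2) (Mul (C 9) (clsT (V 10)))) (Mul (C 3) (clsT (V 11)))) cbitT.
Definition gtauT := Add (Mul (EqT (V 9) (C 2)) clabT) (Mul (NotT (EqT (V 9) (C 2))) (V 9)).
Definition linkT := 
  Add (Mul (EqT (V 9) (C 0)) (Mul (LtT (V 11) (V 20)) (EqT (V 7) (Add (V 5) (C 1)))))
 (Add (Mul (EqT (V 9) (C 1)) (Mul (EqT (V 7) (Add (V 5) (Add (V 20) (C 1))))
         (LtT (V 7) (Mul (Add (V 20) (C 1)) (Add (V 20) (C 1))))))
      (Mul (EqT (V 9) (C 2)) (EqT (V 7) (V 5)))).
Definition offT k := Add (C k) (Mul (C 102) (V 9)).
Definition hgT :=
  Add (Mul (EqT (V 7) (V 5)) (Mul (EqT (V 6) (C 0)) (EqT (V 8) (offT 1))))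
 (Add (Mul (EqT (V 7) (V 5)) (Mul (EqT (V 6) (offT 1)) (EqT (V 8) (offT 2))))
 (Add (Mul (EqT (V 6) (offT 2)) (Mul (EqT (V 8) (C 0)) linkT))
 (Add (Mul (EqT (V 7) (V 5)) (Mul (EqT (V 6) (offT 1)) (Mul (LeT (offT 3) (V 8))
        (LtT (V 8) (Add (offT 41) gtauT)))))
      (Mul (EqT (V 7) (V 5)) (Mul (EqT (V 6) (offT 2)) (Mul (LeT (offT 69) (V 8))
        (LtT (V 8) (Sbt (offT 103) gtauT)))))))).
(** Terms have no division, so quotients and remainders are quantified and checked by
    multiplication. *)
Definition halfT a b := Cnt 9 (Cnt 5 (Cnt 6 (Cnt 7 (Cnt 8 (Cnt 10 (Cnt 11
  (Mul (LtT (V 9) (C 3)) (Mul (EqT (V a) (Add (Mul (C 307) (V 5)) (V 6)))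
  (Mul (EqT (V b) (Add (Mul (C 307) (V 7)) (V 8))) (Mul (LtT (V 6) (C 307)) (Mul (LtT (V 8) (C 307))
  (Mul (EqT (V 5) (Add (Mul (V 10) (Add (V 20) (C 1))) (V 11))) (Mul (LeT (V 11) (V 20)) hgT))))))))))))).

Section Cell.
Variables (x : seq bool) (Q : nat) (s : store).
Hypothesis h2 : s 2 = x.
Hypothesis hQ : size (s 20) = Q.
Hypothesis hB : size x < size (s 1).

Lemma ebitT_ok : tev ebitT s = nth false (enc1 x) (size (s 11)).
Proof.
rewrite tevNot ttNot negbK; congr nat_of_bool; apply/ttExP/idP.
  move=> [h [_]]; rewrite !ttE /= !updE /= !size_nseq h2 => /andP[hh /orP[/eqP ->|/andP[/eqP -> hb]]].
    by rewrite nth_enc1.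
  by rewrite add1n nth_enc1.
have [o [h ej]] : exists (o : bool) h, size (s 11) = o + 2 * h.
  by exists (odd (size (s 11))), (size (s 11))./2; rewrite mul2n odd_double_half.
rewrite ej => hb; have hs : h < size x.
  case: o hb {ej}; rewrite ?add1n ?add0n nth_enc1 //.
  by case: ltnP => // hh; rewrite nth_default.
exists h; split; first by lia.
rewrite !ttE /= !updE /= !size_nseq h2 hs ej /=.
by case: o hb {ej}; rewrite ?add1n ?add0n nth_enc1 eqxx //= => ->; rewrite orbT.
Qed.

Lemma clsT_ok k : tev (clsT k) s = cls Q (tev k s).
Proof.
rewrite /clsT !tevE !ttE !tevE hQ /cls.
by case: eqP => //= _; case: eqP.
Qed.

Lemma cbitT_ok : tev cbitT s = cbit (enc1 x) (size (s 10)) (size (s 11)).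
Proof.
rewrite /cbitT /cbit size_enc1 -ebitT_ok -h2; move: ebitT => t.
rewrite /sizeT !tevE !ttE !tevE.
case: eqP => //= _; case: ltnP => _; lia.
Qed.

Lemma gtauT_ok : size (s 11) <= Q -> 
   tev gtauT s = gtau (enc1 x) Q (size (s 9)) (size (s 10) * Q.+1 + size (s 11)).
Proof.
move=> hj; rewrite /gtauT /gtau /clab divnMDl // divn_small // modnMDl modn_small // addn0.
rewrite -cbitT_ok -!(tevV, clsT_ok) /clabT.
rewrite tevAdd !tevMul tevEq tevNot ttEq !tevC 3!tevAdd !tevC !tevMul !tevC.
by case: ifP => _ /=; lia.
Qed.

Lemma linkT_ok : size (s 11) <= Q -> size (s 9) < 3 -> size (s 5) = size (s 10) * Q.+1 + size (s 11) ->
  tt linkT s = link Q (size (s 9)) (size (s 5)) (size (s 7)).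
Proof.
move=> hj h9 h5; rewrite /linkT /link !ttE !tevE hQ !addn1.
have -> : size (s 5) %% Q.+1 = size (s 11) by rewrite h5 modnMDl modn_small.
by move: (size (s 9)) h9 => [|[|[|]]] //= _; rewrite ?orbF.
Qed.

Lemma hgT_ok : size (s 11) <= Q -> size (s 9) < 3 -> size (s 5) = size (s 10) * Q.+1 + size (s 11) ->
  tt hgT s = hg (enc1 x) Q (size (s 9)) (size (s 5)) (size (s 6)) (size (s 7)) (size (s 8)).
Proof.
move=> hj h9 h5; have := gtauT_ok hj; rewrite -h5 => ht; rewrite /hgT /hg -linkT_ok // -ht.
rewrite 4!ttOr.
rewrite !ttAnd !ttEq !ttLe !ttLt tevAdd tevSbt /offT !tevAdd !tevMul !tevV !tevC.
by [].
Qed.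
End Cell.

Lemma halfT_ok (a b : nat) x Q (s : store) : ((a == 3) || (a == 4)) && ((b == 3) || (b == 4)) ->
  s 2 = x -> size (s 20) = Q -> size x < size (s 1) -> 307 <= size (s 1) ->
  size (s a) < size (s 1) -> size (s b) < size (s 1) ->
  tt (halfT a b) s <-> ghalf (enc1 x) Q (size (s a)) (size (s b)).
Proof.
move=> hab h2 hQ hB h307 ha hb.
split.
  move=> /ttExP[g [_ /ttExP[i [_ /ttExP[r [_ /ttExP[i' [_ /ttExP[r' [_ /ttExP[t [_ /ttExP[j [_]]]]]]]]]]]]]].
  set s' := upd _ _ _; have [ea eb] : s' a = s a /\ s' b = s b.
    by split; move: hab; rewrite /s'; upd_cases.
  rewrite !ttAnd !ttEq ttLe !ttLt !(tevAdd, tevMul, tevV, tevC) ea eb !addn1 /s' !updE /= !size_nseq -/s'.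
  rewrite hQ => /and5P[hg' /eqP hp /eqP hq hr /and4P[hr' /eqP hi hj]].
  rewrite (@hgT_ok x Q); rewrite /s' ?updE ?eqxx /= ?size_nseq // => h.
  by apply/halfP; exists g, i, r, i', r'.
move/halfP => [g [i [r [i' [r' [[hg' hp hq hr hr'] h]]]]]].
apply/ttExP; exists g; split; first by lia.
apply/ttExP; exists i; split; first by rewrite !updE /=; lia.
apply/ttExP; exists r; split; first by rewrite !updE /=; lia.
apply/ttExP; exists i'; split; first by rewrite !updE /=; lia.
apply/ttExP; exists r'; split; first by rewrite !updE /=; lia.
apply/ttExP; exists (i %/ Q.+1); split; first by rewrite !updE /=; have := leq_div i Q.+1; lia.
apply/ttExP; exists (i %% Q.+1); split; first by rewrite !updE /=; have := leq_mod i Q.+1; lia.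
set s' := upd _ _ _; have [ea eb] : s' a = s a /\ s' b = s b.
  by split; move: hab; rewrite /s'; upd_cases.
have hm : i %% Q.+1 <= Q by rewrite -ltnS ltn_pmod.
rewrite !ttAnd !ttEq ttLe !ttLt !(tevAdd, tevMul, tevV, tevC) ea eb !addn1 /s' !updE /= !size_nseq -/s'.
rewrite hQ hg' hp hq hr hr' -divn_eq hm !eqxx /=.
by rewrite (@hgT_ok x Q); rewrite /s' ?updE ?eqxx /= ?size_nseq // -divn_eq.
Qed.

Lemma frame_trans l s1 s2 s3 : frame l s1 s2 -> frame l s2 s3 -> frame l s1 s3.
Proof. by move=> h1 h2 i hi; rewrite h2 ?h1. Qed.
Lemma frame_sub l l' s1 s2 : {subset l <= l'} -> frame l s1 s2 -> frame l' s1 s2.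
Proof. by move=> h h1 i hi; apply: h1; apply: contra hi; apply: h. Qed.
Lemma frame_upd (l : seq nat) i s v : i \in l -> frame l s (upd s i v).
Proof. by move=> h j hj; rewrite updE ifF //; apply: contraNF hj => /eqP ->. Qed.

Lemma for_emit x c (s : store) l (F : nat -> seq bool) : x != 0 -> x \in l -> 0 \in l ->
  (forall v s', v < size (s 1) -> frame l s s' -> s' x = nseq v true ->
     lexec c s' 0 = rev (F v) ++ s' 0 /\ frame l s' (lexec c s')) ->
  lexec (LFor x c) s 0 = rev (flatten (map F (iota 0 (size (s 1))))) ++ s 0 /\
  frame l s (lexec (LFor x c) s).
Proof.
move=> hx hl h0 h.
have [||s' [-> [e1 e2]]] := @for_inv x c s
  (fun n s' => s' 0 = rev (flatten (map F (iota 0 n))) ++ s 0 /\ frame l s s').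
- by split.
- move=> n s' hn [e1 e2]; have [||e3 e4] := h n (upd s' x (nseq n true)) hn.
  + exact: frame_trans e2 (frame_upd _ _ hl).
  + by rewrite updxx.
  split; last by apply: frame_trans e4; apply: frame_trans e2 (frame_upd _ _ hl).
  rewrite e3 updE ifF; last by rewrite eq_sym (negbTE hx).
  rewrite e1 -(addn1 n) iotaD map_cat flatten_cat rev_cat /= cats0 add0n catA //.
split; last exact: frame_trans e2 (frame_upd _ _ hl).
by rewrite updE ifF // eq_sym (negbTE hx).
Qed.

(** Every loop runs over the full range [b]; rounds outside the intended range [m] print nothing. *)
Lemma flatten_bound (T : Type) (G : nat -> seq T) m b : m <= b ->
  flatten [seq if v < m then G v else [::] | v <- iota 0 b] = flatten [seq G v | v <- iota 0 m].
Proof.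
move=> h; rewrite -(subnKC h) iotaD map_cat flatten_cat -[RHS]cats0; congr (_ ++ _).
  by congr flatten; apply/eq_in_map => v; rewrite mem_iota => /andP[_ ->].
have : all (leq m) (iota (0 + m) (b - m)) by apply/allP => v; rewrite mem_iota => /andP[].
by elim: (iota _ _) => //= v r IH /andP[hv hr]; rewrite ltnNge hv IH.
Qed.

Lemma nth_matrix (G : nat -> nat -> bool) w n i j : i < n -> j < w ->
  nth false (flatten [seq flatten [seq [:: G p q] | q <- iota 0 w] | p <- iota 0 n]) (i * w + j) = G i j.
Proof.
have er p : flatten [seq [:: G p q] | q <- iota 0 w] = mkseq (G p) w.
  by rewrite /mkseq; elim: (iota 0 w) => //= q r ->.
move=> hi hj; have H a : nth false (flatten [seq flatten [seq [:: G p q] | q <- iota 0 w] | p <- iota a n]) (i * w + j) = G (a + i) j.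
  elim: n a i hi => // n IH a [|i] hi /=; rewrite nth_cat er size_mkseq.
    by rewrite mul0n addn0 hj nth_mkseq.
  rewrite ifF; last by rewrite mulSn; lia.
  by rewrite mulSn -addnA addKn IH // addnS addSn.
by rewrite H.
Qed.

Lemma size_matrix (G : nat -> nat -> bool) w n :
  size (flatten [seq flatten [seq [:: G p q] | q <- iota 0 w] | p <- iota 0 n]) = n * w.
Proof.
have er p : size (flatten [seq [:: G p q] | q <- iota 0 w]) = w.
  by rewrite -[RHS](size_iota 0); elim: (iota 0 w) => //= q r ->.
rewrite -[in RHS](size_iota 0 n); elim: (iota 0 n) => //= p r IH.
by rewrite size_cat er IH mulSn.
Qed.

Section Reduction.
Variables cK kK : nat.

(** [Q] is the number of time steps: the first summand gives the clock its time, the second makes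
    room for the input. The [Q.+1] columns exceed the number of steps, as the clock requires. *)
Definition Qof m := cK * m.+1 ^ kK + m + 2.
Definition qT := Add (Add (Mul (C cK) (powT (Add sizeT (C 1)) kK)) sizeT) (C 2).
Definition gsizeT := Mul (C 307) (Mul (Add (V 20) (C 1)) (Add (V 20) (C 1))).
Definition redL := LSeq (LSet 20 qT) (LSeq (LSet 23 gsizeT)
  (LFor 3 (LIf (LtT (V 3) (V 23)) (LFor 4 (LIf (LtT (V 4) (V 23))
     (LIf (Add (halfT 3 4) (halfT 4 3)) (LOut true) (LOut false)) LNop)) LNop))).

Lemma wf_redL : wfl 60 redL.
Proof. by rewrite /= wft_pow. Qed.

Definition red (x : seq bool) : seq bool :=
  let Q := Qof (size (enc1 x)) in
  flatten [seq flatten [seq [:: gadj (enc1 x) Q p q] | q <- iota 0 (gsize Q)] | p <- iota 0 (gsize Q)].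

Lemma redL_ok x s : s 2 = x -> s 0 = [::] -> gsize (Qof (size (enc1 x))) < size (s 1) ->
  rev (lexec redL s 0) = red x.
Proof.
move=> h2 h0 hB; set Q := Qof _ in hB; set M := gsize Q in hB.
have hsz : size (enc1 x) <= Q by rewrite /Q /Qof; lia.
have hQM : 307 * Q.+1 <= M by rewrite /M /gsize; nia.
rewrite /redL !lexecSeq.
set s1 := lexec (LSet 20 _) s.
have e1 : s1 = upd s 20 (nseq Q true).
  rewrite /s1 -[lexec _ _]/(upd s 20 (nseq (minn (tev qT s) (size (s 1))) true)).
  congr (upd s 20 (nseq _ true)); rewrite /qT !(tevAdd, tevMul, tev_pow, tevC, tevV, h2).
  rewrite addn1 -size_enc1 -/(Qof _) -/Q; lia.
set s2 := lexec (LSet 23 _) s1.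
have e2 : s2 = upd s1 23 (nseq M true).
  rewrite /s2 -[lexec _ _]/(upd s1 23 (nseq (minn (tev gsizeT s1) (size (s1 1))) true)).
  congr (upd s1 23 (nseq _ true)).
  by rewrite /gsizeT !(tevAdd, tevMul, tevC, tevV) e1 !updE /= size_nseq addn1 -/(gsize Q) -/M; lia.
have [||||e3 _] := @for_emit 3 (LIf (LtT (V 3) (V 23)) (LFor 4 (LIf (LtT (V 4) (V 23))
     (LIf (Add (halfT 3 4) (halfT 4 3)) (LOut true) (LOut false)) LNop)) LNop) s2 [:: 0; 3; 4]
   (fun p => if p < M then flatten [seq [:: gadj (enc1 x) Q p q] | q <- iota 0 M] else [::]); last first.
- rewrite e3 rev_cat revK e2 e1 !updE /= h0 /= flatten_bound //; lia.
- move=> p s3 hp f3 e3.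
  have fr i : i \notin [:: 0; 3; 4] -> s3 i = s2 i by apply: f3.
  rewrite lexecIf ttLt !tevV e3 size_nseq fr // e2 updxx size_nseq; case: ltnP => hpM; last by [].
  have [||||e4 f4] := @for_emit 4 (LIf (LtT (V 4) (V 23)) (LIf (Add (halfT 3 4) (halfT 4 3)) (LOut true) (LOut false)) LNop) s3 [:: 0; 4]
   (fun q => if q < M then [:: gadj (enc1 x) Q p q] else [::]) => //.
  + move=> q s4 hq f4 e4.
    have fr4 i : i \notin [:: 0; 4] -> s4 i = s3 i by apply: f4.
    rewrite lexecIf ttLt !tevV e4 size_nseq fr4 // fr // e2 updxx size_nseq; case: ltnP => hqM; last by [].
    rewrite lexecIf ttOr.
    have hh a b : ((a == 3) || (a == 4)) && ((b == 3) || (b == 4)) -> size (s4 a) < M -> size (s4 b) < M ->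
       tt (halfT a b) s4 = ghalf (enc1 x) Q (size (s4 a)) (size (s4 b)).
      have es1 : s4 1 = s 1 by rewrite fr4 // fr // e2 e1 !updE.
      move=> hab ha hb; apply/idP/idP; rewrite halfT_ok ?es1 ?(fr4 20) ?(fr4 2) ?(fr 2) ?(fr 20) ?e2 ?e1 ?updE /= ?h2 ?size_nseq //.
      all: try by move: hsz; rewrite size_enc1; lia.
      all: try by apply: ltn_trans hB.
      all: try by move: hsz hQM; rewrite size_enc1; lia.
    have es3 : s4 3 = nseq p true by rewrite fr4.
    rewrite !hh ?es3 ?e4 ?size_nseq // -/(gadj _ _ _ _).
    by case: gadj; split=> //; apply: frame_upd.
  split; last by apply: frame_sub f4 => i; rewrite !inE => /orP[] ->; rewrite ?orbT.
  rewrite e4 flatten_bound //.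
  by rewrite fr // e2 e1 !updE /=; lia.
all: by [].
Qed.

Lemma red_poly : polytime red.
Proof.
have : isp (fun n => (gsize (Qof (2 * n + 2))).+1).
  rewrite /gsize /Qof; under eq_fun => n do rewrite -addn1 -[X in _ * X ^ _]addn1 -[X in X * X]addn1.
  have hm := isp_add (isp_mul (isp_const 2) isp_id) (isp_const 2).
  have hQ := isp_add (isp_add (isp_add (isp_mul (isp_const cK) (@isp_exp _ kK (isp_add hm (isp_const 1)))) hm)
    (isp_const 2)) (isp_const 1).
  exact: (isp_add (isp_mul (isp_const 307) (isp_mul hQ hQ)) (isp_const 1)).
move=> [_ [c [k hck]]].
have := @lpolytime 60 isT c k redL wf_redL; apply: polytime_ext => x.
by apply: redL_ok => //; rewrite inits1 size_nseq size_enc1; apply: hck.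
Qed.

Lemma red_graph x : let Q := Qof (size (enc1 x)) in
  encodes_graph (red x) (gsize Q) /\ @adj_of (red x) (gsize Q) = @ge (enc1 x) Q.
Proof.
move=> Q; have e (p q : 'I_(gsize Q)) : adj_of (red x) p q = gadj (enc1 x) Q p q.
  by rewrite /adj_of /red nth_matrix.
split; last by apply: funext => p; apply: funext => q; rewrite e.
split; first by rewrite /red size_matrix.
split=> [p q|p]; rewrite !e; first exact: (ge_sym (enc1 x) p q).
by apply: (ge_irr _ _ p); rewrite /Q /Qof; lia.
Qed.
End Reduction.

(** * Computing the instances of a graph *)

(* Stack 2 holds the adjacency matrix and stack 20 the number of vertices.  Parameters:
   3, 4, 5 for the ends and the type of an arc; 14 and 15 for vertices; the labels of
   14 and 15 are quantified as 16, 17, 18 and 19, 21, 22. *)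
Definition ExN v t := Cnt v (Mul (LtT (V v) (V 20)) t).
Definition Ex3 v t := Cnt v (Mul (LtT (V v) (C 3)) t).
Definition ExL r c b t := Ex3 r (Ex3 c (Ex3 b t)).
Definition edgeT a b := Bit 2 (Add (Mul (V a) (V 20)) (V b)).
Definition degT := Cnt 8 (Mul (LtT (V 8) (V 20)) (edgeT 9 8)).
Definition dT a := Let 9 (V a) degT.
Definition garcT := ExN 6 (ExN 7 (Mul (Mul (edgeT 3 6) (Mul (edgeT 6 7) (edgeT 7 4)))
  (Mul (LeT (Add (C 40) (V 5)) (dT 6)) (Mul (LeT (Sbt (C 36) (V 5)) (dT 7))
  (Mul (Mul (neT (V 3) (V 7)) (neT (V 4) (V 6))) (Mul (LeT (C 2) (dT 3)) (LeT (C 2) (dT 4)))))))).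
Definition callG t a b := Let 5 t (Let 3 (V a) (Let 4 (V b) garcT)).
Definition callL a r c b :=
  callG (Add (Add (Add (C 2) (Mul (C 9) (V r))) (Mul (C 3) (V c))) (V b)) a a.
Definition hcompT := Mul (neT (V 17) (C 2)) (Mul (neT (V 21) (C 0)) (Mul (EqT (V 16) (V 19))
  (Add (NotT (Mul (EqT (V 16) (C 0)) (EqT (V 18) (C 2)))) (EqT (V 22) (C 2))))).
Definition vcompT := Mul (neT (V 16) (C 2)) (Mul (neT (V 19) (C 0)) (EqT (V 17) (V 21))).
Definition llinkT k cT := Mul (LtT (V 14) (V 20)) (Mul (LtT (V 15) (V 20))
  (ExL 16 17 18 (ExL 19 21 22 (Mul (callG (C k) 14 15) (Mul (callL 14 16 17 18)
    (Mul (callL 15 19 21 22) cT)))))).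
Definition HHT := llinkT 0 hcompT.
Definition VVT := llinkT 1 vcompT.
Definition cornerT k := Mul (LtT (V 14) (V 20))
  (ExL 16 17 18 (Mul (callL 14 16 17 18) (Mul (EqT (V 16) (C k)) (EqT (V 17) (C k))))).
Definition hasbitT k := ExL 16 17 18 (Mul (callL 14 16 17 18) (EqT (V 18) (C k))).
Definition banT := Add (ExN 14 (ExN 15 (ExN 16 (Cnt 17 (Mul (LtT (V 17) (C 2)) (Mul (neT (V 15) (V 16))
    (Add (Mul (callG (V 17) 14 15) (callG (V 17) 14 16))
         (Mul (callG (V 17) 15 14) (callG (V 17) 16 14))))))))) 
  (ExN 14 (ExL 16 17 18 (ExL 19 21 22 (Mul (Add (neT (V 16) (V 19)) (Add (neT (V 17) (V 21)) (neT (V 18) (V 22))))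
    (Mul (callL 14 16 17 18) (callL 14 19 21 22)))))).

Lemma ttNe a b s : tt (neT a b) s = (tev a s != tev b s).
Proof. by rewrite /neT ttNot ttEq. Qed.

Section GraphTerms.
Variables (x : seq bool) (n : nat).
Let e : rel 'I_n := @adj_of x n.

Definition ctx (s : store) := [/\ s 2 = x, size (s 20) = n, n < size (s 1) & 2 < size (s 1)].
Lemma ctx_upd i l s : i \notin [:: 1; 2; 20] -> ctx s -> ctx (upd s i l).
Proof.
rewrite !inE !negb_or => /and3P[h1 h2 h3] [c1 c2 c3 c4].
by split; rewrite updE ifF // 1?eq_sym ?(negbTE h1) ?(negbTE h2) ?(negbTE h3).
Qed.

Lemma ExNP v t s : v \notin [:: 1; 2; 20] -> ctx s ->
  reflect (exists a : 'I_n, tt t (upd s v (nseq a true))) (tt (ExN v t) s).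
Proof.
move=> hv hc; have [_ c2 c3 _] := hc.
have e2 a : size (upd s v (nseq a true) 20) = n by have [] := ctx_upd (nseq a true) hv hc.
apply: (iffP (ttExP _ _ _)) => [[a [_]]|[a ha]].
  by rewrite ttAnd ttLt !tevV e2 updxx size_nseq => /andP[han ht]; exists (Ordinal han).
exists a; split; first exact: ltn_trans c3.
by rewrite ttAnd ttLt !tevV e2 updxx size_nseq ltn_ord.
Qed.
Lemma Ex3P v t s : v \notin [:: 1; 2; 20] -> ctx s ->
  reflect (exists a : 'I_3, tt t (upd s v (nseq a true))) (tt (Ex3 v t) s).
Proof.
move=> hv hc; have [_ _ _ c4] := hc.
apply: (iffP (ttExP _ _ _)) => [[a [_]]|[a ha]].
  by rewrite ttAnd ttLt tevV tevC updxx size_nseq => /andP[han ht]; exists (Ordinal han).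
exists a; split; first exact: leq_trans (ltn_ord a) c4.
by rewrite ttAnd ttLt tevV tevC updxx size_nseq ltn_ord.
Qed.

Definition updl s r c b (l : lbl) :=
  upd (upd (upd s r (nseq (lr l) true)) c (nseq (lc l) true)) b (nseq (lb l) true).
Lemma ctx_updl s r c b l : all (fun i => i \notin [:: 1; 2; 20]) [:: r; c; b] -> ctx s -> ctx (updl s r c b l).
Proof. by move=> /and4P[h1 h2 h3 _] hc; do 3!apply: ctx_upd => //. Qed.
Lemma ExLP r c b t s : all (fun i => i \notin [:: 1; 2; 20]) [:: r; c; b] -> ctx s ->
  reflect (exists l, tt t (updl s r c b l)) (tt (ExL r c b t) s).
Proof.
move=> /and4P[h1 h2 h3 _] hc; apply: (iffP (Ex3P _ h1 hc)).
  move=> [i /(Ex3P _ h2 (ctx_upd _ h1 hc))[j /(Ex3P _ h3 (ctx_upd _ h2 (ctx_upd _ h1 hc)))[k hk]]].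
  by exists (i, j, k).
move=> [[[i j] k] h]; exists i; apply/(Ex3P _ h2 (ctx_upd _ h1 hc)); exists j.
by apply/(Ex3P _ h3 (ctx_upd _ h2 (ctx_upd _ h1 hc))); exists k.
Qed.

Lemma count_ord (P : pred nat) b : n <= b ->
  count (fun v => (v < n) && P v) (iota 0 b) = #|[pred w : 'I_n | P w]|.
Proof.
move=> h; rewrite -(subnKC h) iotaD count_cat [X in _ + X](_ : _ = 0) ?addn0; last first.
  apply/eqP; rewrite -leqn0 leqNgt -has_count; apply/hasPn => v; rewrite mem_iota => hv.
  by rewrite ltnNge (proj1 (andP hv)).
rewrite -val_enum_ord count_map cardE [in RHS]/enum_mem size_filter enumT.
apply: eq_count => w /=; by rewrite ltn_ord.
Qed.

Lemma ttEdge a b s (u v : 'I_n) : ctx s -> size (s a) = u -> size (s b) = v -> tt (edgeT a b) s = e u v.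
Proof. by move=> [c1 c2 _ _] h1 h2; rewrite /edgeT ttBit !tevE h1 h2 c1 c2. Qed.

Lemma dT_ok a s (u : 'I_n) : ctx s -> size (s a) = u -> tev (dT a) s = deg e u.
Proof.
move=> hc ha; have hc9 : ctx (upd s 9 (nseq u true)) by apply: ctx_upd.
rewrite [LHS](_ : _ = tev degT (upd s 9 (nseq u true))); last by rewrite /= ha.
have [c1 c2 c3 _] := hc9; rewrite [LHS]/=.
transitivity (count (fun w => (w < n) && nth false x (u * n + w)) (iota 0 (size (s 1)))); last first.
  by apply: (@count_ord (fun w => nth false x (u * n + w))); have [_ _ /ltnW] := hc.
apply: eq_count => w /=.
rewrite !updE /= !size_nseq; move: c1 c2; rewrite !updE /= => -> ->.
by rewrite muln_eq0 negb_or subn_eq0 -ltnNge; case: nth.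
Qed.

Lemma garcT_ok s (u v : 'I_n) : ctx s -> size (s 3) = u -> size (s 4) = v ->
  tt garcT s = garc e (size (s 5)) u v.
Proof.
move=> hc h3 h4; have hcc a b : ctx (upd (upd s 6 (nseq a true)) 7 (nseq b true)) by do 2!apply: ctx_upd => //.
have H (a b : 'I_n) : tt (Mul (Mul (edgeT 3 6) (Mul (edgeT 6 7) (edgeT 7 4)))
  (Mul (LeT (Add (C 40) (V 5)) (dT 6)) (Mul (LeT (Sbt (C 36) (V 5)) (dT 7))
  (Mul (Mul (neT (V 3) (V 7)) (neT (V 4) (V 6))) (Mul (LeT (C 2) (dT 3)) (LeT (C 2) (dT 4)))))))
  (upd (upd s 6 (nseq a true)) 7 (nseq b true)) = [&& [&& e u a, e a b & e b v], 40 + size (s 5) <= deg e a, 36 - size (s 5) <= deg e b,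
     (u != b) && (v != a) & (2 <= deg e u) && (2 <= deg e v)].
  have E i (w : 'I_n) : size (upd (upd s 6 (nseq a true)) 7 (nseq b true) i) = w ->
    tev (dT i) (upd (upd s 6 (nseq a true)) 7 (nseq b true)) = deg e w by apply: dT_ok.
  rewrite !ttAnd (@ttEdge 3 6 _ u a) ?(@ttEdge 6 7 _ a b) ?(@ttEdge 7 4 _ b v) ?updE ?size_nseq //.
  rewrite !ttNe !ttLe (E 6 a) ?(E 7 b) ?(E 3 u) ?(E 4 v) ?updE ?size_nseq //.
  by rewrite !(tevAdd, tevSbt, tevC, tevV) !updE /= h3 h4 !size_nseq.
apply/idP/existsP.
  move/(@ExNP 6 _ _ isT hc) => [a /(@ExNP 7 _ _ isT (@ctx_upd 6 _ _ isT hc))[b]]; rewrite H => h.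
  by exists a; apply/existsP; exists b.
move=> [a /existsP[b h]]; apply/(@ExNP 6 _ _ isT hc); exists a.
by apply/(@ExNP 7 _ _ isT (@ctx_upd 6 _ _ isT hc)); exists b; rewrite H.
Qed.

Lemma callG_ok t a b s (u v : 'I_n) : ctx s -> a \notin [:: 3; 4; 5] -> b \notin [:: 3; 4; 5] ->
  size (s a) = u -> size (s b) = v -> tt (callG t a b) s = garc e (tev t s) u v.
Proof.
rewrite !inE !negb_or => hc /and3P[a3 a4 a5] /and3P[b3 b4 b5] ha hb.
rewrite /callG !ttLet !tevV !updE (negbTE a5) (negbTE b3) /= (negbTE b5) ha hb.
rewrite (@garcT_ok _ u v) ?updE /= ?size_nseq //.
Qed.
Lemma callL_ok a r c b s (u : 'I_n) l : ctx s -> a \notin [:: 3; 4; 5] -> size (s a) = u ->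
  size (s r) = lr l -> size (s c) = lc l -> size (s b) = lb l ->
  tt (callL a r c b) s = lab e l u.
Proof.
move=> hc ha hu h1 h2 h3; rewrite /callL (@callG_ok _ _ _ _ u u) //.
by rewrite !tevE h1 h2 h3.
Qed.
End GraphTerms.

Section GridTerms.
Variables (x : seq bool) (n : nat).
Let e : rel 'I_n := @adj_of x n.
Notation ctx := (ctx x n).

Lemma pair_ok k cT (comp : rel lbl) s (u v : 'I_n) l l' : ctx s ->
  (forall s l l', size (s 16) = lr l -> size (s 17) = lc l -> size (s 18) = lb l ->
     size (s 19) = lr l' -> size (s 21) = lc l' -> size (s 22) = lb l' -> tt cT s = comp l l') ->
  size (s 14) = u -> size (s 15) = v ->
  tt (Mul (callG (C k) 14 15) (Mul (callL 14 16 17 18) (Mul (callL 15 19 21 22) cT)))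
    (updl (updl s 16 17 18 l) 19 21 22 l') =
  [&& garc e k u v, lab e l u, lab e l' v & comp l l'].
Proof.
move=> hc hcomp hu hv; have hcc : ctx (updl (updl s 16 17 18 l) 19 21 22 l') by do 2!apply: ctx_updl => //.
rewrite !ttAnd (@callG_ok x n _ _ _ _ u v) // (@callL_ok x n _ _ _ _ _ u l) ?(@callL_ok x n _ _ _ _ _ v l') //=.
all: rewrite ?(hcomp _ l l') // /updl ?updE /= ?size_nseq //.
Qed.

Lemma link_ok k cT (comp : rel lbl) s : ctx s ->
  (forall s l l', size (s 16) = lr l -> size (s 17) = lc l -> size (s 18) = lb l ->
     size (s 19) = lr l' -> size (s 21) = lc l' -> size (s 22) = lb l' -> tt cT s = comp l l') ->
  tt (llinkT k cT) s <-> exists u v : 'I_n, [/\ size (s 14) = u, size (s 15) = v &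
    exists l l', [/\ garc e k u v, lab e l u, lab e l' v & comp l l']].
Proof.
move=> hc hcomp; have [_ c2 _ _] := hc; rewrite /llinkT !ttAnd !ttLt !tevV c2; split.
  move=> /and3P[hu hv /(@ExLP _ _ 16 17 18 _ _ isT hc)[l /(@ExLP _ _ 19 21 22 _ _ isT (@ctx_updl _ _ _ 16 17 18 _ isT hc))[l']]].
  rewrite (@pair_ok _ _ _ _ (Ordinal hu) (Ordinal hv) _ _ hc hcomp) // => /and4P h.
  by exists (Ordinal hu), (Ordinal hv); split=> //; exists l, l'.
move=> [u [v [hu hv [l [l' h]]]]]; rewrite hu hv !ltn_ord /=.
apply/(@ExLP _ _ 16 17 18 _ _ isT hc); exists l; apply/(@ExLP _ _ 19 21 22 _ _ isT (@ctx_updl _ _ _ 16 17 18 _ isT hc)); exists l'.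
by rewrite (@pair_ok _ _ _ _ u v _ _ hc hcomp)//; apply/and4P.
Qed.

Lemma HHT_ok s : ctx s -> tt HHT s <-> exists u v : 'I_n, [/\ size (s 14) = u, size (s 15) = v & HH e u v].
Proof.
move=> hc; rewrite (@link_ok _ _ hcomp _ hc); last first.
  move=> s' l l' h1 h2 h3 h4 h5 h6; rewrite /hcompT !ttAnd !ttNe ttOr !ttEq ttNot ttAnd !ttEq !(tevV, tevC).
  by rewrite h1 h2 h3 h4 h5 h6 /hcomp implybE.
by split=> -[u [v [h1 h2 /HHP h3]]]; exists u, v; split.
Qed.
Lemma VVT_ok s : ctx s -> tt VVT s <-> exists u v : 'I_n, [/\ size (s 14) = u, size (s 15) = v & VV e u v].
Proof.
move=> hc; rewrite (@link_ok _ _ vcomp _ hc); last first.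
  move=> s' l l' h1 h2 h3 h4 h5 h6; rewrite /vcompT !ttAnd !ttNe !ttEq !(tevV, tevC).
  by rewrite h1 h2 h4 h5.
by split=> -[u [v [h1 h2 /VVP h3]]]; exists u, v; split.
Qed.

Lemma cornerT_ok k s : ctx s -> tt (cornerT k) s <-> exists u : 'I_n, size (s 14) = u /\
  [exists l, [&& lab e l u, lr l == k & lc l == k]].
Proof.
move=> hc; have [_ c2 _ _] := hc; rewrite /cornerT ttAnd ttLt !tevV c2.
have H l (u : 'I_n) : size (s 14) = u -> tt (Mul (callL 14 16 17 18) (Mul (EqT (V 16) (C k)) (EqT (V 17) (C k))))
   (updl s 16 17 18 l) = [&& lab e l u, lr l == k & lc l == k].
  move=> hu; have hcc : ctx (updl s 16 17 18 l) by apply: ctx_updl.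
  rewrite !ttAnd (@callL_ok x n _ _ _ _ _ u l) // ?ttEq /= /updl ?updE /= ?size_nseq //.
split.
  move=> /andP[hu /(@ExLP _ _ 16 17 18 _ _ isT hc)[l]]; rewrite (H l (Ordinal hu)) // => h.
  by exists (Ordinal hu); split=> //; apply/existsP; exists l.
move=> [u [hu /existsP[l h]]]; rewrite hu ltn_ord /=.
by apply/(@ExLP _ _ 16 17 18 _ _ isT hc); exists l; rewrite (H l u).
Qed.

Lemma hasbitT_ok k s (u : 'I_n) : ctx s -> size (s 14) = u ->
  tt (hasbitT k) s = [exists l, lab e l u && (lb l == k)].
Proof.
move=> hc hu; have H l : tt (Mul (callL 14 16 17 18) (EqT (V 18) (C k))) (updl s 16 17 18 l) = lab e l u && (lb l == k).
  have hcc : ctx (updl s 16 17 18 l) by apply: ctx_updl.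
  rewrite !ttAnd (@callL_ok x n _ _ _ _ _ u l) // ?ttEq /= /updl ?updE /= ?size_nseq //.
apply/(@ExLP _ _ 16 17 18 _ _ isT hc)/existsP => -[l h]; exists l; first by rewrite -H.
by rewrite H.
Qed.

Lemma banT_ok s : ctx s -> tt banT s <-> ~ banfree e.
Proof.
move=> hc.
have hc1 a b c t : ctx (upd (upd (upd (upd s 14 (nseq a true)) 15 (nseq b true)) 16 (nseq c true)) 17 (nseq t true)).
  by do 4!apply: ctx_upd => //.
have H1 (a b c : 'I_n) t : tt (Mul (LtT (V 17) (C 2)) (Mul (neT (V 15) (V 16))
    (Add (Mul (callG (V 17) 14 15) (callG (V 17) 14 16))
         (Mul (callG (V 17) 15 14) (callG (V 17) 16 14)))))
  (upd (upd (upd (upd s 14 (nseq a true)) 15 (nseq b true)) 16 (nseq c true)) 17 (nseq t true)) =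
  [&& t < 2, b != c & (garc e t a b && garc e t a c) || (garc e t b a && garc e t c a)].
  rewrite !ttAnd ttOr !ttAnd ttNe ttLt.
  rewrite (@callG_ok x n _ 14 15 _ a b) ?(@callG_ok x n _ 14 16 _ a c) ?(@callG_ok x n _ 15 14 _ b a) ?(@callG_ok x n _ 16 14 _ c a) //.
  1-9: by rewrite ?(tevV, tevC, updE) /= ?size_nseq.
have H2 (u : 'I_n) l l' : tt (Mul (Add (neT (V 16) (V 19)) (Add (neT (V 17) (V 21)) (neT (V 18) (V 22))))
    (Mul (callL 14 16 17 18) (callL 14 19 21 22))) (updl (updl (upd s 14 (nseq u true)) 16 17 18 l) 19 21 22 l') =
    [&& l != l', lab e l u & lab e l' u].
  have hcc : ctx (updl (updl (upd s 14 (nseq u true)) 16 17 18 l) 19 21 22 l').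
    by do 2!apply: ctx_updl => //; apply: ctx_upd.
  rewrite !ttAnd !ttOr !ttNe (@callL_ok x n _ _ _ _ _ u l) ?(@callL_ok x n _ _ _ _ _ u l') ?(tevV, updE) //=.
  all: rewrite /updl ?(tevV, updE) /= ?size_nseq //.
  congr andb; move: l l' {hcc} => [[a b] c] [[a' b'] c']; rewrite /lr /lc /lb /= !xpair_eqE !negb_and -orbA.
  by rewrite -!val_eqE.
split.
  rewrite /banT ttOr => /orP[].
    move=> /(@ExNP _ _ 14 _ _ isT hc)[u].
    move=> /(@ExNP _ _ 15 _ _ isT (@ctx_upd _ _ 14 _ _ isT hc))[v].
    move=> /(@ExNP _ _ 16 _ _ isT (@ctx_upd _ _ 15 _ _ isT (@ctx_upd _ _ 14 _ _ isT hc)))[w].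
    move=> /ttExP[t [_]]; rewrite H1 => /and3P[ht /eqP hn hg] [b1 b2 _]; apply: hn.
    by case/orP: hg => /andP[g1 g2]; [apply: b1 g1 g2|apply: b2 g1 g2].
  move=> /(@ExNP _ _ 14 _ _ isT hc)[u].
  move=> /(@ExLP _ _ 16 17 18 _ _ isT (@ctx_upd _ _ 14 _ _ isT hc))[l].
  move=> /(@ExLP _ _ 19 21 22 _ _ isT (@ctx_updl _ _ _ 16 17 18 _ isT (@ctx_upd _ _ 14 _ _ isT hc)))[l'].
  by rewrite H2 => /and3P[/eqP hn h1 h2] [_ _ b3]; apply: hn; apply: b3 h1 h2.
move=> hb; rewrite /banT ttOr; apply/orP.
have hB : 2 < size (s 1) by case: hc.
apply: contrapT => hno; apply: hb.
have no1 (u v w : 'I_n) t : t < 2 -> v != w -> ~ ((garc e t u v && garc e t u w) || (garc e t v u && garc e t w u)).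
  move=> ht hvw hg; apply: hno; left.
  apply/(@ExNP _ _ 14 _ _ isT hc); exists u.
  apply/(@ExNP _ _ 15 _ _ isT (@ctx_upd _ _ 14 _ _ isT hc)); exists v.
  apply/(@ExNP _ _ 16 _ _ isT (@ctx_upd _ _ 15 _ _ isT (@ctx_upd _ _ 14 _ _ isT hc))); exists w.
  apply/ttExP; exists t; rewrite H1 ht hvw hg; split=> //; rewrite !updE /=; lia.
split.
- move=> t u v v' ht g1 g2; apply/eqP; apply: contraT => hn.
  by case: (no1 u v v' t ht hn); rewrite g1 g2.
- move=> t u u' v ht g1 g2; apply/eqP; apply: contraT => hn.
  by case: (no1 v u u' t ht hn); rewrite g1 g2 orbT.
- move=> l l' u g1 g2; apply/eqP; apply: contraT => hn; case: hno; right.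
  apply/(@ExNP _ _ 14 _ _ isT hc); exists u.
  apply/(@ExLP _ _ 16 17 18 _ _ isT (@ctx_upd _ _ 14 _ _ isT hc)); exists l.
  apply/(@ExLP _ _ 19 21 22 _ _ isT (@ctx_updl _ _ _ 16 17 18 _ isT (@ctx_upd _ _ 14 _ _ isT hc))); exists l'.
  by rewrite H2 hn g1 g2.
Qed.
End GridTerms.

(* the least out-neighbour of vertex 29, counted as the number of v below all of them *)
Definition succT lT := Cnt 40 (NotT (Cnt 41 (Mul (LeT (V 41) (V 40)) (Let 14 (V 29) (Let 15 (V 41) lT))))).
Definition posT := It 29 (It 29 (V 24) (V 27) (succT VVT)) (V 28) (succT HHT).
Definition cellsT pT lT dt dj := Let 27 (V 43) (Let 28 (V 44) (Let 45 pT
  (Let 27 (Add (V 43) (C dt)) (Let 28 (Add (V 44) (C dj)) (Let 46 pT (Let 14 (V 45) (Let 15 (V 46) lT))))))).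
Definition rowsT := AllT 43 (AllT 44 (Add (LtT (V 26) (V 43)) (Add (LeT (V 25) (Add (V 44) (C 1))) (cellsT posT HHT 0 1)))).
Definition colsT := AllT 43 (AllT 44 (Add (LeT (V 26) (V 43)) (Add (LeT (V 25) (V 44)) (cellsT posT VVT 1 0)))).
Definition rectT := Mul (LtT (C 0) (V 25)) (Mul (Let 14 (V 24) (cornerT 0)) (Mul rowsT (Mul colsT
  (Let 27 (V 26) (Let 28 (Sbt (V 25) (C 1)) (Let 14 posT (cornerT 2))))))).

Lemma tevCnt v a s : tev (Cnt v a) s = count (fun k => tt a (upd s v (nseq k true))) (iota 0 (size (s 1))).
Proof. by []. Qed.
Lemma tevIt v a b c s : tev (It v a b c) s =
  iter (tev b s) (fun k => minn (tev c (upd s v (nseq k true))) (size (s 1))) (tev a s).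
Proof. by []. Qed.

(** * Recognizing complete grids by terms *)

Section RectTerms.
Variables (x : seq bool) (n : nat).
Let e : rel 'I_n := @adj_of x n.
Notation ctx := (ctx x n).
Hypothesis bf : banfree e.

Definition linkterm lT (R : rel 'I_n) := forall s, ctx s ->
  (tt lT s <-> exists u v : 'I_n, [/\ size (s 14) = u, size (s 15) = v & R u v]).

Lemma succT_ok lT (R : rel 'I_n) s (u w : 'I_n) : linkterm lT R -> ctx s -> size (s 29) = u ->
  R u w -> (forall w', R u w' -> w' = w) -> tev (succT lT) s = w.
Proof.
move=> hl hc hu huw hun; have [_ _ c3 _] := hc.
rewrite [LHS](_ : _ = count (fun v => v < w) (iota 0 (size (s 1)))); last first.
  rewrite /succT tevCnt.
  apply: eq_in_count => v; rewrite mem_iota => /andP[_ hv]; rewrite ttNot ltnNge; congr negb.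
  have hcc z : ctx (upd (upd (upd (upd s 40 (nseq v true)) 41 (nseq z true)) 14 (nseq u true)) 15 (nseq z true)).
    by do 4!apply: ctx_upd => //.
  apply/ttExP/idP.
    move=> [z [_]]; rewrite ttAnd ttLe !ttLet !tevV !updE /= hu !size_nseq => /andP[hzv].
    rewrite (hl _ (hcc z)) => -[u' [w' [h1 h2 h3]]]; move: h1 h2 h3; rewrite !updE /= !size_nseq.
    by move=> /val_inj <- e2 /hun e3; rewrite -e3 -e2.
  move=> hwv; exists w; split; first by rewrite updE /=; exact: ltn_trans c3.
  rewrite ttAnd ttLe !ttLet !tevV !updE /= hu !size_nseq hwv /=.
  by rewrite (hl _ (hcc w)); exists u, w; rewrite !updE /= !size_nseq.
have hw : w <= size (s 1) by apply: ltnW; apply: ltn_trans c3.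
rewrite -(subnKC hw) iotaD count_cat [X in _ + X](_ : _ = 0); last first.
  apply/eqP; rewrite -leqn0 leqNgt -has_count; apply/hasPn => v; rewrite mem_iota => /andP[hv _].
  by rewrite -leqNgt.
rewrite addn0 -[RHS](size_iota 0); apply/eqP; rewrite -all_count; apply/allP => v.
by rewrite mem_iota.
Qed.

Definition posctx s u t j := [/\ ctx s, size (s 24) = u, size (s 27) = t & size (s 28) = j].
(** Only the links on the path that [pos] walks. Less than [okr], because positions have to be
    computed while the rectangle is still being checked. *)
Definition okp u t j := (forall t', t' < t -> VV e (pos e u t' 0) (pos e u t'.+1 0)) /\
  (forall j', j' < j -> HH e (pos e u t j') (pos e u t j'.+1)).

Lemma iter_succT lT (R : rel 'I_n) s (p : nat -> 'I_n) j : linkterm lT R -> ctx s ->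
  (forall u v v', R u v -> R u v' -> v = v') -> (forall j', j' < j -> R (p j') (p j'.+1)) ->
  iter j (fun k => minn (tev (succT lT) (upd s 29 (nseq k true))) (size (s 1))) (p 0) = p j.
Proof.
move=> hl hc hun; have [_ _ c3 _] := hc.
have hm (w : 'I_n) : minn w (size (s 1)) = w by have := ltn_trans (ltn_ord w) c3; lia.
elim: j => // j IH hR; rewrite iterS IH; last by move=> j' hj'; apply: hR; lia.
rewrite (succT_ok hl (@ctx_upd _ _ 29 _ _ isT hc) _ (hR j (ltnSn j))) ?hm ?updxx ?size_nseq //.
by move=> w hw; apply: hun hw (hR j _).
Qed.

(** Where a link is missing, [succT] returns the range bound and not the default of [sR]; term and
    position therefore agree only along existing links. *)
Lemma posT_ok s (u : 'I_n) t j : posctx s u t j -> okp u t j -> tev posT s = pos e u t j.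
Proof.
move=> [hc h1 h2 h3] [hV hH]; rewrite /posT tevIt tevIt [tev (V 24) s]tevV [tev (V 27) s]tevV [tev (V 28) s]tevV h1 h2 h3.
rewrite (@iter_succT _ _ _ (fun t => pos e u t 0) t (@VVT_ok x n) hc (VV_fun bf) hV).
by rewrite (@iter_succT _ _ _ (pos e u t) j (@HHT_ok x n) hc (HH_fun bf) hH).
Qed.

Lemma cellsT_ok pT lT (R : rel 'I_n) dt dj s u t j : linkterm lT R -> ctx s -> size (s 24) = u ->
  size (s 43) = t -> size (s 44) = j -> exists s1 s2, [/\ posctx s1 u t j, posctx s2 u (t + dt) (j + dj) &
   tt (cellsT pT lT dt dj) s <-> exists v w : 'I_n, [/\ tev pT s1 = v, tev pT s2 = w & R v w]].
Proof.
move=> hl hc hu ht hj.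
pose s1 := upd (upd s 27 (nseq t true)) 28 (nseq j true).
pose s2 := upd (upd (upd s1 45 (nseq (tev pT s1) true)) 27 (nseq (t + dt) true)) 28 (nseq (j + dj) true).
pose s3 := upd (upd (upd s2 46 (nseq (tev pT s2) true)) 14 (nseq (tev pT s1) true)) 15 (nseq (tev pT s2) true).
have c1 : ctx s1 by do 2!apply: ctx_upd => //.
have c2 : ctx s2 by do 3!apply: ctx_upd => //.
have c3 : ctx s3 by do 3!apply: ctx_upd => //.
exists s1, s2; split.
- by split=> //; rewrite /s1 !updE /= ?size_nseq.
- by split=> //; rewrite /s2 /s1 !updE /= ?size_nseq.
have -> : tt (cellsT pT lT dt dj) s = tt lT s3.
  rewrite /cellsT 3!ttLet !tevV (_ : upd s 27 _ 44 = s 44) // ht hj -/s1.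
  rewrite 3!ttLet !(tevAdd, tevV, tevC).
  rewrite (_ : upd s1 45 _ 43 = s 43) // (_ : upd (upd s1 45 _) 27 _ 44 = s 44) // ht hj -/s2.
  by rewrite 2!ttLet !tevV !updE /= !size_nseq.
rewrite (hl _ c3) /s3 !updE /= !size_nseq.
by split=> -[v [w h]]; exists v, w.
Qed.

Lemma rectT_ok s : ctx s -> size (s 25) < size (s 1) -> size (s 26) < size (s 1) ->
  tt rectT s <-> exists u : 'I_n, size (s 24) = u /\ rect e u (size (s 25)) (size (s 26)).
Proof.
move=> hc; move eS : (size (s 25)) => Sz; move eT : (size (s 26)) => Tm hS hT.
have hcc t j : ctx (upd (upd s 43 (nseq t true)) 44 (nseq j true)) by do 2!apply: ctx_upd => //.
have hrow : tt rowsT s <-> forall t j, t <= Tm -> j.+1 < Sz ->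
    tt (cellsT posT HHT 0 1) (upd (upd s 43 (nseq t true)) 44 (nseq j true)).
  rewrite /rowsT ttAll; split.
    move=> /allP H t j ht hj; have /H : t \in iota 0 (size (s 1)) by rewrite mem_iota; lia.
    rewrite ttAll => /allP /(_ j); rewrite mem_iota [upd _ _ _ 1]updE /= => /(_ (ltac:(lia))).
    rewrite 2!ttOr ttLt ttLe tevAdd !tevV tevC !updE /= !size_nseq eS eT.
    by case/or3P => //; lia.
  move=> H; apply/allP => t _; rewrite ttAll; apply/allP => j _.
  rewrite 2!ttOr ttLt ttLe tevAdd !tevV tevC !updE /= !size_nseq eS eT addn1.
  case: (ltnP Tm t) => //= ht; case: (leqP Sz j.+1) => //= hj; exact: H.
have hcol : tt colsT s <-> forall t j, t < Tm -> j < Sz ->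
    tt (cellsT posT VVT 1 0) (upd (upd s 43 (nseq t true)) 44 (nseq j true)).
  rewrite /colsT ttAll; split.
    move=> /allP H t j ht hj; have /H : t \in iota 0 (size (s 1)) by rewrite mem_iota; lia.
    rewrite ttAll => /allP /(_ j); rewrite mem_iota [upd _ _ _ 1]updE /= => /(_ (ltac:(lia))).
    rewrite 2!ttOr !ttLe !tevV !updE /= !size_nseq eS eT.
    by case/or3P => //; lia.
  move=> H; apply/allP => t _; rewrite ttAll; apply/allP => j _.
  rewrite 2!ttOr !ttLe !tevV !updE /= !size_nseq eS eT.
  case: (leqP Tm t) => //= ht; case: (leqP Sz j) => //= hj; exact: H.
have hstart : tt (Let 14 (V 24) (cornerT 0)) s <-> exists u : 'I_n, size (s 24) = u /\ startv e u.
  by rewrite ttLet tevV (@cornerT_ok x n 0 _ (@ctx_upd _ _ 14 _ _ isT hc)) updxx size_nseq.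
have [s1 [g1 hfin]] : exists s1, posctx s1 (size (s 24)) Tm Sz.-1 /\
   (tt (Let 27 (V 26) (Let 28 (Sbt (V 25) (C 1)) (Let 14 posT (cornerT 2)))) s <->
    exists w : 'I_n, tev posT s1 = w /\ lastv e w).
  pose s1 := upd (upd s 27 (nseq Tm true)) 28 (nseq Sz.-1 true).
  have c1 : ctx s1 by do 2!apply: ctx_upd => //.
  exists s1; split; first by split=> //; rewrite /s1 !updE /= ?size_nseq.
  rewrite 2!ttLet tevSbt !tevV tevC (_ : upd s 27 _ 25 = s 25) // eS eT subn1 -/s1 ttLet.
  by rewrite (@cornerT_ok x n 2 _ (@ctx_upd _ _ 14 _ _ isT c1)) updxx size_nseq.
have hcell k t j u lT R dt dj : linkterm lT R -> size (s 24) = u -> k = upd (upd s 43 (nseq t true)) 44 (nseq j true) ->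
  exists s1 s2, [/\ posctx s1 u t j, posctx s2 u (t + dt) (j + dj) &
   tt (cellsT posT lT dt dj) k <-> exists v w : 'I_n, [/\ tev posT s1 = v, tev posT s2 = w & R v w]].
  by move=> hl hu ->; apply: cellsT_ok => //; rewrite !updE /= ?size_nseq.
rewrite /rectT 4!ttAnd ttLt tevC tevV eS; split.
  move=> /and5P[h0 /hstart[u [hu hst]] /hrow hr /hcol hcl /hfin[w [hw hf]]].
  exists u; split=> //; rewrite hu in g1.
  (* The links are established in the order of the walk, so that each position term is known to be
     right before its outgoing link is read off. Strong induction does this for the first column and
     then for each row. *)
  have hV t : t < Tm -> VV e (pos e u t 0) (pos e u t.+1 0).
    elim/ltn_ind: t => t IH ht.
    have ok : okp u t 0 by split=> // t' ht'; apply: IH => //; lia.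
    have := hcl t 0 ht h0; have [a1 [a2 [ga _ ->]]] := hcell _ t 0 _ _ _ 1 0 (@VVT_ok x n) hu erefl.
    move=> [v [z [e1 _ hvz]]]; have ev : v = pos e u t 0 by apply: val_inj; rewrite /= -e1 (posT_ok ga ok).
    by rewrite posD0 -ev (sD_ok bf hvz).
  have hH t j : t <= Tm -> j.+1 < Sz -> HH e (pos e u t j) (pos e u t j.+1).
    move=> ht; elim/ltn_ind: j => j IH hj.
    have ok : okp u t j by split=> [t' ht'|j' hj']; [apply: hV; lia|apply: IH => //; lia].
    have := hr t j ht hj; have [a1 [a2 [ga _ ->]]] := hcell _ t j _ _ _ 0 1 (@HHT_ok x n) hu erefl.
    move=> [v [z [e1 _ hvz]]]; have ev : v = pos e u t j by apply: val_inj; rewrite /= -e1 (posT_ok ga ok).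
    by rewrite posR -ev (sR_ok bf hvz).
  have ok t j : t <= Tm -> j < Sz -> okp u t j.
    by move=> ht hj; split=> [t' ht'|j' hj']; [apply: hV; lia|apply: hH; lia].
  split=> //; last by rewrite (_ : pos _ _ _ _ = w) //; apply: val_inj; rewrite /= -hw (posT_ok g1 (ok Tm Sz.-1 (leqnn _) (ltac:(lia)))).
  split=> // t j ht hj; first by apply: hH; lia.
  have hj' : j < Sz by lia.
  have := hcl t j ht hj'; have [a1 [a2 [ga gb ->]]] := hcell _ t j _ _ _ 1 0 (@VVT_ok x n) hu erefl.
  rewrite addn1 addn0 in gb.
  move=> [v [z [e1 e2 hvz]]].
  have ev : v = pos e u t j by apply: val_inj; rewrite /= -e1 (posT_ok ga (ok t j (ltnW ht) hj')).
  have ez : z = pos e u t.+1 j by apply: val_inj; rewrite /= -e2 (posT_ok gb (ok t.+1 j ht hj')).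
  by rewrite -ev -ez.
move=> [u [hu [h0 [hst hH hV] hf]]]; rewrite hu in g1.
have ok t j : t <= Tm -> j < Sz -> okp u t j.
  by move=> ht hj; split=> [t' ht'|j' hj']; [apply: hV; lia|apply: hH; lia].
apply/and5P; split=> //.
- by apply/hstart; exists u.
- apply/hrow => t j ht hj; have [a1 [a2 [ga gb ->]]] := hcell _ t j _ _ _ 0 1 (@HHT_ok x n) hu erefl.
  rewrite addn1 addn0 in gb; exists (pos e u t j), (pos e u t j.+1).
  by split; [apply: posT_ok ga _; apply: ok; lia|apply: posT_ok gb _; apply: ok; lia|apply: hH; lia].
- apply/hcol => t j ht hj; have [a1 [a2 [ga gb ->]]] := hcell _ t j _ _ _ 1 0 (@VVT_ok x n) hu erefl.
  rewrite addn1 addn0 in gb; exists (pos e u t j), (pos e u t.+1 j).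
  by split; [apply: posT_ok ga _; apply: ok; lia|apply: posT_ok gb _; apply: ok; lia|apply: hV; lia].
- by apply/hfin; exists (pos e u Tm Sz.-1); split=> //; apply: posT_ok g1 _; apply: ok; lia.
Qed.

(** Distinct coordinates belong to distinct vertices. Hence there are only polynomially many
    candidates for a corner with its dimensions. *)
Lemma rect_le (u : 'I_n) Sz Tm : rect e u Sz Tm -> Sz <= n /\ Tm < n.
Proof.
move=> hr; have [h0 _ _] := hr; split.
  have inj : injective (fun j : 'I_Sz => pos e u 0 j).
    move=> j j' /(okr_uniq bf (rect_okr hr (leq0n _) (ltn_ord j)) (rect_okr hr (leq0n _) (ltn_ord j'))).
    by move=> [_ _ /val_inj].
  by have := leq_card _ inj; rewrite !card_ord.
have inj : injective (fun t : 'I_Tm.+1 => pos e u t 0).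
  move=> t t' /(okr_uniq bf (rect_okr hr (ltn_ord t : t <= Tm) h0) (rect_okr hr (ltn_ord t' : t' <= Tm) h0)).
  by move=> [_ /val_inj].
by have := leq_card _ inj; rewrite !card_ord.
Qed.
End RectTerms.

Lemma lexecSet i t s : lexec (LSet i t) s = upd s i (nseq (minn (tev t s) (size (s 1))) true).
Proof. by []. Qed.
Lemma lexecPush i b s : size (s i) < size (s 1) -> lexec (LPush i b) s = upd s i (b :: s i).
Proof. by move=> /= ->. Qed.

Definition constL (w : seq bool) := foldr (fun b c => LSeq (LOut b) c) LNop w.
Lemma constL_ok w s : lexec (constL w) s = upd s 0 (rev w ++ s 0).
Proof.
elim: w s => [|b w IH] s; first by rewrite /= upd_id.
by rewrite [constL _]/= lexecSeq IH /= upd2 updxx rev_cons cat_rcons.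
Qed.
Lemma wfl_constL w : wfl 60 (constL w).
Proof. by elim: w. Qed.

Definition outL := LFor 47 (LIf (LtT (V 47) (V 23)) (LIf (Bit 23 (V 47)) (LOut true) (LOut false)) LNop).
Lemma outL_ok s : size (s 23) <= size (s 1) ->
  lexec outL s 0 = rev (s 23) ++ s 0 /\ frame [:: 0; 47] s (lexec outL s).
Proof.
move=> hB; have [||||e1 f1] := @for_emit 47 (LIf (LtT (V 47) (V 23)) (LIf (Bit 23 (V 47)) (LOut true) (LOut false)) LNop)
  s [:: 0; 47] (fun v => if v < size (s 23) then [:: nth false (s 23) v] else [::]) => //.
  move=> v s' hv f e; have e23 : s' 23 = s 23 by apply: f.
  rewrite 2!lexecIf ttLt ttBit !tevV e size_nseq e23.
  by case: ltnP => h //; case: nth; split=> //; apply: frame_upd.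
split=> //; rewrite e1 flatten_bound //; congr (rev _ ++ _).
have -> r : flatten [seq [:: nth false (s 23) v] | v <- r] = [seq nth false (s 23) v | v <- r].
  by elim: r => //= v r ->.
by rewrite -[LHS]/(mkseq _ _) mkseq_nth.
Qed.

Definition dec (y : seq bool) := mkseq (fun h => nth false y (2 * h).+1) (size y - 2)./2.
Lemma decK z : dec (enc1 z) = z.
Proof.
rewrite /dec size_enc1 addnK mul2n doubleK; apply: (@eq_from_nth _ false); rewrite size_mkseq // => h hh.
by rewrite nth_mkseq // nth_enc1.
Qed.

Lemma enc_list_flatten (G : nat -> seq (seq bool)) r :
  flatten [seq enc_list (G v) | v <- r] = enc_list (flatten [seq G v | v <- r]).
Proof. by elim: r => //= v r ->; rewrite enc_list_cat. Qed.

Definition bitL := LIf (hasbitT 1) (LPush 23 true) (LIf (hasbitT 0) (LPush 23 false) LNop).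
(** The columns are visited from the last to the first, so that pushing leaves the string in reading
    order. *)
Definition cellL := LIf (LtT (V 47) (V 25)) (LSeq (LSet 27 (C 0))
  (LSeq (LSet 28 (Sbt (Sbt (V 25) (C 1)) (V 47))) (LSeq (LSet 14 posT) bitL))) LNop.
Definition buildL := LSeq (LSet 23 (C 0)) (LFor 47 cellL).

(** * The instance contributed by one candidate grid *)

Section Decide.
Variables (x : seq bool) (n : nat).
Let e : rel 'I_n := @adj_of x n.
Notation ctx := (ctx x n).
Hypothesis bf : banfree e.

Lemma ctx_frame l s s' : all (fun i => i \notin l) [:: 1; 2; 20] -> frame l s s' -> ctx s -> ctx s'.
Proof. by move=> /and4P[h1 h2 h3 _] hf [c1 c2 c3 c4]; split; rewrite ?(hf 1) ?(hf 2) ?(hf 20). Qed.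

Lemma bitL_ok s (u : 'I_n) : ctx s -> size (s 14) = u -> size (s 23) < size (s 1) ->
  lexec bitL s = upd s 23 (seq_of_opt (vbit e u) ++ s 23).
Proof.
move=> hc hu hB; rewrite /bitL 2!lexecIf !(hasbitT_ok _ hc hu) /vbit -/e.
case: ifP => _; first by rewrite lexecPush.
by case: ifP => _; [rewrite lexecPush|rewrite /= upd_id].
Qed.

Lemma buildL_ok s (u : 'I_n) Sz Tm : ctx s -> size (s 24) = u -> size (s 25) = Sz -> Sz <= size (s 1) ->
  rect e u Sz Tm -> lexec buildL s 23 = yof e u Sz /\ frame [:: 14; 23; 27; 28; 47] s (lexec buildL s).
Proof.
move=> hc hu hS hB hr; rewrite /buildL lexecSeq lexecSet min0n.
set s0 := upd s 23 _; have c0 : ctx s0 by apply: ctx_upd.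
pose fl := [:: 14; 23; 27; 28; 47].
pose Y v := pmap (fun j => vbit e (pos e u 0 j)) (iota (Sz - v) (Sz - (Sz - v))).
have [||s' [-> [e1 e2]]] := @for_inv 47 cellL s0 (fun v s' => s' 23 = Y v /\ frame fl s s').
- by split; [rewrite /Y subn0 subnn /s0 updxx|apply: frame_upd].
- move=> v s1 hv [e1 f1]; set s2 := upd s1 47 _.
  have f2 : frame fl s s2 by apply: frame_trans f1 (frame_upd _ _ _).
  have c2 : ctx s2 by apply: ctx_frame f2 hc.
  have e25 : size (s2 25) = Sz by rewrite f2.
  have e47 : size (s2 47) = v by rewrite /s2 updxx size_nseq.
  rewrite /cellL lexecIf ttLt [tev (V 47) s2]tevV [tev (V 25) s2]tevV e25 e47.
  case: ltnP => hvS; last first.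
    split=> //; rewrite [lexec _ _]/= /s2 updE /= e1 /Y.
    have [-> ->] : Sz - v = 0 /\ Sz - v.+1 = 0 by lia.
    by [].
  rewrite 3!lexecSeq lexecSet lexecSet lexecSet tevC min0n.
  set s3 := upd s2 27 _; rewrite !(tevSbt, tevV, tevC) (_ : s3 25 = s2 25) // (_ : s3 47 = s2 47) // (_ : s3 1 = s 1); last by rewrite /s3 updE /= f2.
  rewrite e25 e47 (minn_idPl _); last by lia.
  set j := Sz - 1 - v; set s4 := upd s3 28 _.
  have g4 : posctx x n s4 u 0 j.
    split; first by do 2!apply: ctx_upd => //.
    - by rewrite /s4 /s3 !updE /= f2.
    - by [].
    - by rewrite /s4 updxx size_nseq.
  have ok : okp x u 0 j by have [_ [_ hH _] _] := hr; split=> // j' hj'; apply: hH; rewrite /j in hj'; lia.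
  have hp := posT_ok bf g4 ok.
  have c4 : ctx s4 by case: g4.
  have hB1 : (pos e u 0 j < size (s4 1)) by have [_ _ c3 _] := c4; apply: ltn_trans c3.
  rewrite hp (minn_idPl (ltnW hB1)); set s5 := upd s4 14 _.
  have e5 : s5 23 = Y v by rewrite /s5 /s4 /s3 /s2 !updE.
  have f5 : frame fl s s5.
    by apply: frame_trans (frame_upd _ _ _); [do 2!apply: frame_trans (frame_upd _ _ _) => //|].
  rewrite (bitL_ok (u := pos e u 0 j)).
  + split; last exact: frame_trans f5 (frame_upd _ _ _).
    rewrite updxx e5 /Y (_ : Sz - (Sz - v.+1) = (Sz - (Sz - v)).+1); last by lia.
    rewrite (_ : iota (Sz - v.+1) _ = j :: iota (Sz - v) (Sz - (Sz - v))); last first.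
      rewrite [iota _ _]/= (_ : Sz - v.+1 = j); last by rewrite /j; lia.
      by congr (_ :: iota _ _); rewrite /j; lia.
    by rewrite [pmap _ (_ :: _)]/=; case: (vbit e _).
  + by apply: ctx_upd.
  + by rewrite /s5 updxx size_nseq.
  + rewrite e5 (_ : s5 1 = s 1); last by rewrite f5.
    apply: (@leq_ltn_trans v); last exact: hv.
    rewrite /Y size_pmap; apply: leq_trans (count_size _ _) _; rewrite size_iota; lia.
split; last exact: frame_trans e2 (frame_upd _ _ _).
rewrite updE /= e1 /Y (_ : s0 1 = s 1) //.
by rewrite (_ : Sz - size (s 1) = 0) ?subn0 //; lia.
Qed.

Variables (K : TM) (x0 : seq bool).
Hypothesis hK : forall y S T, size y <= S -> accb K y S T -> exists z, y = enc1 z.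

Definition bodyL := LIf (Mul (LeT (V 25) (V 20)) (Mul (LeT (V 26) (V 20)) rectT))
  (LSeq buildL (LSeq (LSet 36 (V 26)) (LSeq (LSet 38 (V 25)) (LSeq (simAcc K 23)
  (LIf (accT K) outL (constL (enc1 x0))))))) LNop.

(** A complete grid contributes its decoded input if the clock accepts, and otherwise the non-member
    [x0], because such a grid makes the graph uncolorable. A candidate that is no grid contributes
    nothing. *)
Definition emit v Sz Tm : seq (seq bool) :=
  if insub v is Some u then
    if `[< rect e u Sz Tm >] then
      [:: if accb K (yof e u Sz) Sz Tm then dec (yof e u Sz) else x0] else [::]
  else [::].

Definition fbody := [:: 0; 14; 23; 27; 28; 30; 31; 32; 33; 34; 35; 36; 37; 38; 47].

Lemma bodyL_ok s : ctx s -> #|tm_st K| + 2 <= size (s 1) -> 4 * n + 2 <= size (s 1) ->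
  size (s 25) < size (s 1) -> size (s 26) < size (s 1) ->
  lexec bodyL s 0 = rev (enc_list (emit (size (s 24)) (size (s 25)) (size (s 26)))) ++ s 0 /\
  frame fbody s (lexec bodyL s).
Proof.
move=> hc hB1 hB2; move eS : (size (s 25)) => Sz; move eT : (size (s 26)) => Tm hS hT.
have hrT : tt rectT s <-> exists u : 'I_n, size (s 24) = u /\ rect e u Sz Tm.
  by rewrite -eS -eT; apply: rectT_ok; rewrite ?eS ?eT.
have [_ c2 _ _] := hc.
rewrite /bodyL lexecIf 2!ttAnd 2!ttLe [tev (V 25) s]tevV [tev (V 26) s]tevV [tev (V 20) s]tevV c2 eS eT.
rewrite /emit; case: ifP => [/and3P[hSn hTn /hrT[u [hu hr]]]|hno]; last first.
  case: insubP => // u _ hu; case: asboolP => // hr; exfalso.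
  have [h1 h2] := rect_le bf hr.
  have hrr : tt rectT s by apply/hrT; exists u.
  by move: hno; rewrite h1 hrr (ltnW h2).
rewrite hu valK; case: asboolP => // _.
rewrite 4!lexecSeq.
have [e1 f1] := buildL_ok hc hu eS (ltnW hS) hr; set s1 := lexec buildL s in e1 f1 *.
have c1 : ctx s1 by apply: ctx_frame f1 hc.
have es1 : s1 1 = s 1 by apply: f1.
rewrite 2!lexecSet [tev (V 26) s1]tevV [tev (V 25) _]tevV.
set s2 := upd s1 36 _; rewrite (_ : s2 25 = s1 25) // (_ : s2 1 = s 1) // (f1 25) // eS.
set s3 := upd s2 38 _.
have e36 : size (s3 36) = Tm by rewrite /s3 /s2 !updE /= size_nseq f1 // eT es1 (minn_idPl (ltnW hT)).
have e38 : size (s3 38) = Sz by rewrite /s3 updxx size_nseq (minn_idPl (ltnW hS)).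
have e23 : s3 23 = yof e u Sz by rewrite /s3 /s2 !updE.
have es3 : s3 1 = s 1 by rewrite /s3 /s2 !updE.
have [hy _] := yof_ok bf hr.
have f3 : frame fbody s s3.
  do 2!apply: frame_trans (frame_upd _ _ _) => //.
  by apply: frame_sub f1 => i; rewrite !inE => /or4P[|||/orP[]] /eqP ->.
have [||| ha f4] := @simAcc_ok K 23 s3 => //; try by rewrite ?es3 // e23 e36; lia.
set s4 := lexec (simAcc K 23) s3 in ha f4 *.
have f4' : frame fbody s3 s4 by apply: frame_sub f4 => i; rewrite !inE => /or4P[|||/or4P[]] /eqP ->.
rewrite lexecIf ha e23 e38 e36 enc_list1.
have e40 : s4 0 = s 0 by rewrite f4 // /s3 /s2 !updE /= f1.
have f04 := frame_trans f3 f4'.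
case: ifP => hacc.
  have [|e5 f5] := @outL_ok s4.
    by rewrite (f4 1) // (f4 23) // es3 e23 (leq_trans hy (ltnW hS)).
  split; last by apply: frame_trans f04 _; apply: frame_sub f5 => i; rewrite !inE => /orP[] /eqP ->.
  rewrite e5 e40 (f4 23) // e23.
  by have [z ez] := hK hy hacc; rewrite ez decK.
rewrite constL_ok updxx e40; split=> //.
by apply: frame_trans f04 _; apply: frame_upd.
Qed.
End Decide.

(** * The number of vertices and the complete program *)

Definition isqrt m := count (fun v => v.+1 * v.+1 <= m) (iota 0 m).
Lemma isqrt_le m : isqrt m <= m.
Proof. by rewrite -{2}(size_iota 0 m) count_size. Qed.
Lemma isqrtE m b : m <= b -> count (fun v => v.+1 * v.+1 <= m) (iota 0 b) = isqrt m.
Proof.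
move=> h; rewrite -(subnKC h) iotaD count_cat [X in _ + X](_ : _ = 0) ?addn0 //.
apply/eqP; rewrite -leqn0 leqNgt -has_count; apply/hasPn => v; rewrite mem_iota => hv.
by rewrite -ltnNge; nia.
Qed.
Lemma isqrt_sq n : isqrt (n * n) = n.
Proof.
have hn : n <= n * n by nia.
rewrite /isqrt -(subnKC hn) iotaD count_cat [X in _ + X](_ : _ = 0) ?addn0 ?subnKC //.
  rewrite -[RHS](size_iota 0); apply/eqP; rewrite -all_count; apply/allP => v.
  by rewrite mem_iota; nia.
apply/eqP; rewrite -leqn0 leqNgt -has_count; apply/hasPn => v; rewrite mem_iota => hv.
by rewrite -ltnNge; nia.
Qed.

Definition isqrtT := Cnt 3 (LeT (Mul (Add (V 3) (C 1)) (Add (V 3) (C 1))) (V 2)).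
Lemma isqrtT_ok s : size (s 2) <= size (s 1) -> tev isqrtT s = isqrt (size (s 2)).
Proof.
move=> h; rewrite /isqrtT tevCnt -(isqrtE h); apply: eq_count => v.
by rewrite ttLe !(tevMul, tevAdd, tevV, tevC) !updE /= size_nseq addn1.
Qed.

Section Program.
Variables (K : TM) (x0 : seq bool).
Hypothesis hK : forall y S T, size y <= S -> accb K y S T -> exists z, y = enc1 z.

Definition loopL := LFor 24 (LFor 25 (LFor 26 (bodyL K x0))).
Definition progL := LSeq (LSet 20 isqrtT) (LIf banT (constL (enc1 x0)) loopL).

Lemma wf_progL : wfl 60 progL.
Proof.
by have := @wfl_simAcc K 23 isT; have := wft_accT K; rewrite /= wfl_constL => -> ->.
Qed.

(** The simulation of the clock needs [2 * (size y + T) + 2] with both sizes at most the number [n]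
    of vertices, hence [4 * n + 2], and room for the state codes; [n] is at most the length of the
    matrix. *)
Definition gbound (x : seq bool) := (#|tm_st K| + 4) * (size x).+1 ^ 1.
Definition glist (x : seq bool) : seq (seq bool) :=
  let n := isqrt (size x) in
  if `[< banfree (@adj_of x n) >] then
    flatten [seq flatten [seq flatten [seq @emit x n K x0 v Sz Tm
      | Tm <- iota 0 (gbound x)] | Sz <- iota 0 (gbound x)] | v <- iota 0 (gbound x)]
  else [:: x0].

Lemma loopL_ok x n s : banfree (@adj_of x n) -> ctx x n s ->
  #|tm_st K| + 2 <= size (s 1) -> 4 * n + 2 <= size (s 1) ->
  lexec loopL s 0 = rev (enc_list (flatten [seq flatten [seq flatten [seq @emit x n K x0 v Sz Tm
      | Tm <- iota 0 (size (s 1))] | Sz <- iota 0 (size (s 1))] | v <- iota 0 (size (s 1))])) ++ s 0.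
Proof.
move=> bf hc hB1 hB2; set B := size (s 1).
pose E3 v Sz Tm := enc_list (@emit x n K x0 v Sz Tm).
pose E2 v Sz := flatten [seq E3 v Sz Tm | Tm <- iota 0 B].
pose E1 v := flatten [seq E2 v Sz | Sz <- iota 0 B].
have [||||-> _] := @for_emit 24 (LFor 25 (LFor 26 (bodyL K x0))) s [:: 24, 25, 26 & fbody] E1 => //; last first.
  congr (rev _ ++ _); rewrite -enc_list_flatten; congr flatten; apply: eq_map => v.
  rewrite /E1 -enc_list_flatten; congr flatten; apply: eq_map => Sz.
  by rewrite /E2 -enc_list_flatten.
move=> v s1 hv f1 e1.
have [||||e2 f2] := @for_emit 25 (LFor 26 (bodyL K x0)) s1 [:: 25, 26 & fbody] (E2 v) => //; last first.
  rewrite e2 (_ : s1 1 = s 1); last by apply: f1.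
  by split=> //; apply: frame_sub f2 => i hi; rewrite in_cons hi orbT.
move=> Sz s2 hSz f2 e2.
have [||||e3 f3] := @for_emit 26 (bodyL K x0) s2 [:: 26 & fbody] (E3 v Sz) => //; last first.
  rewrite e3 (_ : s2 1 = s 1); last by rewrite f2 // f1.
  by split=> //; apply: frame_sub f3 => i hi; rewrite in_cons hi orbT.
move=> Tm s3 hTm f3 e3.
have es3 : s3 1 = s 1 by rewrite f3 // f2 // f1.
have e24 : s3 24 = nseq v true by rewrite f3 // f2.
have e25 : s3 25 = nseq Sz true by rewrite f3.
have c3 : ctx x n s3.
  by apply: ctx_frame f3 _ => //; apply: ctx_frame f2 _ => //; apply: ctx_frame f1 hc.
have [||||e4 f4] := @bodyL_ok x n bf K x0 hK s3 c3.
- by rewrite es3.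
- by rewrite es3.
- by rewrite e25 size_nseq es3; rewrite f1 in hSz.
- by rewrite e3 size_nseq es3; rewrite f2 // f1 in hTm.
rewrite e4 e24 e25 e3 !size_nseq; split=> //.
by apply: frame_sub f4 => i hi; rewrite in_cons hi orbT.
Qed.

Theorem glist_poly : polytime (fun x => enc_list (glist x)).
Proof.
have := @lpolytime 60 isT (#|tm_st K| + 4) 1 progL wf_progL; apply: polytime_ext => x.
set s := inits _ _ _; have es1 : size (s 1) = gbound x by rewrite /s inits1 size_nseq.
have hr := isqrt_le (size x).
have hb : #|tm_st K| + 4 + 4 * size x <= size (s 1).
  rewrite es1 /gbound expn1; move: (#|tm_st K|) => k; nia.
rewrite /progL lexecSeq lexecSet isqrtT_ok; last by rewrite (_ : s 2 = x) //; lia.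
rewrite (_ : s 2 = x) // (minn_idPl _); last by lia.
set n := isqrt _ in hr *; set s1 := upd s 20 _.
have hc : ctx x n s1 by split=> //; rewrite /s1 !updE /= ?size_nseq //; lia.
rewrite lexecIf /glist -/n; case: asboolP => hbf; last first.
  have -> : tt banT s1 by apply: (proj2 (banT_ok hc)).
  by rewrite constL_ok updxx cats0 revK enc_list1.
have -> : tt banT s1 = false by case hb' : (tt banT s1) => //; case: (proj1 (banT_ok hc) hb' hbf).
have hs1 : s1 1 = s 1 by rewrite /s1 updE.
rewrite (loopL_ok hbf hc) hs1 ?rev_cat ?revK; last by lia.
  by rewrite es1.
by apply: leq_trans hb; rewrite -addnA leq_add2l.
Qed.
End Program.

Lemma encodes_graph_uniq s n n' : encodes_graph s n -> encodes_graph s n' -> n = n'.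
Proof. by move=> [h _] [h' _]; apply/eqP; rewrite -(eqn_exp2r _ _ (ltn0Sn 1)) -!mulnn -h h'. Qed.

(** * Colorability in terms of the language *)

Section Coloring.
Variables (L : language) (U K : TM).
Hypothesis hcond : forall y S T, size y <= S ->
  (cond U K y S T <-> accb K y S T /\ exists x, y = enc1 x /\ L x).
Hypothesis hK : forall y S T, size y <= S -> accb K y S T -> exists x, y = enc1 x.
Variable Fs : seq (cgraph (color U K)).
Hypothesis hFs : forall n (e : rel 'I_n) (col : 'I_n -> color U K), symmetric e -> irreflexive e ->
  ((forall F, List.In F Fs -> ~ cg_embeds F e col) <-> ~ bad (@queries U K) e col).

Lemma free_coloring_rect s n : encodes_graph s n ->
  (free_coloring_lang Fs s <-> banfree (@adj_of s n) /\
    forall u S Tm, rect (@adj_of s n) u S Tm -> cond U K (yof (@adj_of s n) u S) S Tm).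
Proof.
move=> hs; have [_ [sym irr]] := hs; rewrite -coloringP; split.
  move=> [n' [hs']]; rewrite -(encodes_graph_uniq hs hs') => -[col hcol].
  by exists col; apply/bad_good/hFs.
by move=> [col /bad_good hcol]; exists n; split=> //; exists col; apply/hFs.
Qed.

(** For an ambiguous graph both sides fail, the right one through the non-member. Otherwise
    colorability is a conjunction over the complete grids, and [hcond] splits each conjunct into the
    decidable test of the clock and one membership in [L]. *)
Lemma glist_coloring x0 s : ~ L x0 -> is_graph s ->
  (free_coloring_lang Fs s <-> forall I, I \in glist K x0 s -> L I).
Proof.
move=> hx0 [n hs]; rewrite (free_coloring_rect hs) /glist.
have -> : isqrt (size s) = n by rewrite (proj1 hs) isqrt_sq.
case: asboolP => bf; last first.
  split; first by case.
  by move=> /(_ x0); rewrite inE eqxx => /(_ isT).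
have memP I : reflect (exists v S T, [/\ v < gbound K s, S < gbound K s, T < gbound K s & I \in @emit s n K x0 v S T])
   (I \in flatten [seq flatten [seq flatten [seq @emit s n K x0 v Sz Tm
      | Tm <- iota 0 (gbound K s)] | Sz <- iota 0 (gbound K s)] | v <- iota 0 (gbound K s)]).
  apply: (iffP flatten_mapP) => [[v]|[v [S [T [hv hS hT hI]]]]].
    rewrite mem_iota => hv /flatten_mapP[S]; rewrite mem_iota => hS /flatten_mapP[T]; rewrite mem_iota => hT hI.
    by exists v, S, T.
  exists v; first by rewrite mem_iota.
  apply/flatten_mapP; exists S; first by rewrite mem_iota.
  by apply/flatten_mapP; exists T; first by rewrite mem_iota.
have hn : n < gbound K s.
  rewrite /gbound expn1 (proj1 hs); move: (#|tm_st K|) => k; nia.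
split.
  move=> [_ hr] I /memP[v [S [T [_ _ _]]]]; rewrite /emit.
  case: insubP => // u _ _; case: asboolP => // hrect; rewrite inE => /eqP ->.
  have [hy _] := yof_ok bf hrect.
  have [-> [z [-> hz]]] := (hcond _ hy).1 (hr _ _ _ hrect).
  by rewrite decK.
move=> h; split=> // u S T hrect.
have [hy _] := yof_ok bf hrect; have [hS hT] := rect_le bf hrect.
have hin : (if accb K (yof (@adj_of s n) u S) S T then dec (yof (@adj_of s n) u S) else x0) \in @emit s n K x0 u S T.
  by rewrite /emit valK; case: asboolP => // _; rewrite inE.
have := h _ (introT (memP _) (ex_intro _ (u : nat) (ex_intro _ S (ex_intro _ T (And4 (ltn_trans (ltn_ord u) hn)
   (leq_ltn_trans hS hn) (ltn_trans hT hn) hin))))).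
case: ifP => // hacc hL; apply/(hcond _ hy); split=> //.
by have [z ez] := hK hy hacc; exists z; split=> //; move: hL; rewrite ez decK.
Qed.

(** The grid is built so large that the clock accepts, and only membership remains of its single
    condition. *)
Lemma red_coloring cK kK : (forall x S T, cK * (size (enc1 x)).+1 ^ kK <= T -> T < S -> accb K (enc1 x) S T) ->
  forall x, L x <-> free_coloring_lang Fs (red cK kK x).
Proof.
move=> hacc x; have [hg he] := red_graph cK kK x; rewrite (free_coloring_rect hg) he.
set Q := Qof _ _ _; have hQ : size (enc1 x) <= Q.+1 by rewrite /Q /Qof; lia.
have hQ0 : 0 < Q by rewrite /Q /Qof; lia.
rewrite (grid_coloring hQ0 hQ (cond U K)) hcond //; split.
  by move=> hx; split; [apply: hacc; rewrite // /Q /Qof -addnA leq_addr|exists x].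
by move=> [_ [z [ez hz]]]; have [-> _] := @enc1_inj x z [::] [::] (congr1 (cat^~ [::]) ez).
Qed.
End Coloring.

Lemma polytime_nil : polytime (fun=> [::]).
Proof. by have := @lpolytime 60 isT 0 0 LNop isT; apply: polytime_ext. Qed.

Theorem theorem4p2 (L : language) :
  in_NP L ->
  exists (C : finType) (Fs : seq (cgraph C)),
    (forall F, List.In F Fs -> cg_simple F /\ cg_connected F) /\
    poly_reduces L (free_coloring_lang Fs) /\
    exists g : seq bool -> seq (seq bool),
      polytime (fun s => enc_list (g s)) /\
      forall s, is_graph s ->
        (free_coloring_lang Fs s <-> forall I, I \in g s -> L I).
Proof.
move=> hNP; have [hall|/existsNP[x0 hx0]] := pselect (forall x, L x).
  (* If every string is in [L], there is no non-member to report failed tests with; then one color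
     and an empty family make every graph colorable. *)
  exists unit, [::]; split=> //; split.
    exists (fun=> [::]); split; first exact: polytime_nil.
    move=> x; split=> // _; exists 0; split; last by exists (fun=> Datatypes.tt).
    by split=> //; split=> -[].
  exists (fun=> [::]); split; first exact: polytime_nil.
  by move=> s [n hs]; split=> // _; exists n; split=> //; exists (fun=> Datatypes.tt).
have [U [K [cK [kK [hcond hK hacc]]]]] := machines_exist hNP.
have [Fs [hF hFs]] := bad_local (@queries_wf U K).
exists (color U K), Fs; split=> //; split.
  by exists (red cK kK); split; [exact: red_poly|exact: (red_coloring hcond hFs hacc)].
exists (glist K x0); split; first exact: glist_poly.
by move=> s hs; exact: (glist_coloring hcond hK hFs hx0 hs).
Qed.
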